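(* Let $n\ge 1$, let $T>0$, and let $h\colon[0,T]\times\mathbf{T}^n\to\mathbf{R}$ be a smooth solution of the Hele-Shaw equation $$\partial_t h+G(h)h=0 .$$ For a function $\Phi\colon\mathbf{R}\to\mathbf{R}^+$ set $I_\Phi(t)=\int_{\mathbf{T}^n}\Phi(h(t,x))\,dx$. (i) If $\Phi$ is a convex $C^2$ function, then $\frac{d}{dt}I_\Phi\le 0$. (ii) If $\Phi$ is a convex $C^3$ function whose derivative $\Phi'$ is also convex, then $$\frac{d}{dt}I_\Phi\le 0\quad\text{and}\quad \frac{d^2}{dt^2}I_\Phi\ge 0 .$$
   Context: $\mathbf{T}^n$ denotes an $n$-dimensional torus. For a function $h$ on $\mathbf{T}^n$ (time being a parameter), let $\Omega=\{(x,y)\in\mathbf{T}^n\times\mathbf{R}: y<h(x)\}$. For a function $\psi$ on $\mathbf{T}^n$, let $\varphi$ be its harmonic extension, i.e. the (variational) solution of $\Delta_{x,y}\varphi=0$ in $\Omega$, $\varphi|_{y=h}=\psi$. The Dirichlet-to-Neumann operator is $$G(h)\psi(x)=\partial_y\varphi(x,h(x))-\nabla h(x)\cdot\nabla_x\varphi(x,h(x)).$$ A smooth solution means a solution $h$ of $\partial_t h+G(h)h=0$ which is $C^\infty$ in $(t,x)$ on $[0,T]\times\mathbf{T}^n$. *)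

(* Defs.v *)
From HB Require Import structures.
From mathcomp Require Import all_boot all_order all_algebra.
From mathcomp Require Import all_classical all_reals all_analysis.
Set Implicit Arguments. Unset Strict Implicit. Unset Printing Implicit Defensive.
Import Order.TTheory GRing.Theory Num.Theory.
Import numFieldNormedType.Exports.
Local Open Scope classical_set_scope.
Local Open Scope ring_scope.

Section Defs.
Variable R : realType.

Definition iter_D (V : normedModType R) (f : V -> R) (vs : seq V) : V -> R :=
  foldr (fun v g => fun x => derive g x v) f vs.

Definition Ck_on (V : normedModType R) (k : nat) (U : set V) (f : V -> R) :=
  (forall (vs : seq V) (v : V) x, (size vs < k)%N -> U x ->
      derivable (iter_D f vs) x v) /\
  (forall (vs : seq V) x, (size vs <= k)%N -> U x ->
      {for x, continuous (iter_D f vs)}).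

Definition smooth_on (V : normedModType R) (U : set V) (f : V -> R) :=
  forall k, Ck_on k U f.

Definition Ck_near (V : normedModType R) (k : nat) (A : set V) (f : V -> R) :=
  exists U : set V, [/\ open U, A `<=` U & Ck_on k U f].

Definition smooth_near (V : normedModType R) (A : set V) (f : V -> R) :=
  exists U : set V, [/\ open U, A `<=` U & smooth_on U f].

Definition e_ (n : nat) (i : 'I_n) : 'rV[R]_n := delta_mx 0 i.

Definition periodic (n : nat) (f : 'rV[R]_n -> R) :=
  forall (i : 'I_n) x, f (x + e_ i) = f x.

(* Integral over T^n (fundamental domain [0,1]^n), as the iterated
   Lebesgue integral over the coordinates (Fubini). *)
Fixpoint torus_int (n : nat) : ('rV[R]_n -> R) -> R :=
  match n with
  | 0 => fun f => f 0
  | m.+1 => fun f =>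
      (\int[@lebesgue_measure R]_(s in `[0%R, 1%R]) torus_int
          (fun x : 'rV[R]_m => f (row_mx (s%:M : 'rV[R]_1) x)))%R
  end.

(* Same, for nonnegative extended-real valued functions (Tonelli). *)
Fixpoint torus_eint (n : nat) : ('rV[R]_n -> \bar R) -> \bar R :=
  match n with
  | 0 => fun f => f 0
  | m.+1 => fun f =>
      (\int[@lebesgue_measure R]_(s in `[0%R, 1%R]) torus_eint
          (fun x : 'rV[R]_m => f (row_mx (s%:M : 'rV[R]_1) x)))%E
  end.

Definition Omega (n : nat) (h : 'rV[R]_n -> R) : set ('rV[R]_n * R) :=
  [set p | p.2 < h p.1].

Definition Omega_closure (n : nat) (h : 'rV[R]_n -> R) : set ('rV[R]_n * R) :=
  [set p | p.2 <= h p.1].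

Definition dx (n : nat) (i : 'I_n) : 'rV[R]_n * R := (e_ i, 0).
Definition dy (n : nat) : 'rV[R]_n * R := (0, 1).

Definition laplacian (n : nat) (f : 'rV[R]_n * R -> R) (p : 'rV[R]_n * R) : R :=
  \sum_(i < n) iter_D f [:: dx i; dx i] p + iter_D f [:: dy n; dy n] p.

Definition grad_sq (n : nat) (f : 'rV[R]_n * R -> R) (p : 'rV[R]_n * R) : R :=
  \sum_(i < n) (derive f p (dx i)) ^+ 2 + (derive f p (dy n)) ^+ 2.

Definition dirichlet_energy (n : nat) (h : 'rV[R]_n -> R)
    (phi : 'rV[R]_n * R -> R) : \bar R :=
  torus_eint (fun x : 'rV[R]_n =>
    (\int[@lebesgue_measure R]_(y in `]-oo, h x[) (grad_sq phi (x, y))%:E)%E).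

Definition harmonic_ext (n : nat) (h psi : 'rV[R]_n -> R)
    (phi : 'rV[R]_n * R -> R) :=
  [/\ forall (i : 'I_n) x y, phi (x + e_ i, y) = phi (x, y),
      Ck_near 1 (Omega_closure h) phi /\ Ck_on 2 (Omega h) phi,
      forall p, Omega h p -> laplacian phi p = 0,
      (dirichlet_energy h phi < +oo)%E &
      forall x, phi (x, h x) = psi x].

(* Dirichlet-to-Neumann operator G(h)psi, computed from the harmonic
   extension phi of psi:
   G(h)psi(x) = d_y phi(x,h(x)) - grad h(x) . grad_x phi(x,h(x)). *)
Definition DtN (n : nat) (h : 'rV[R]_n -> R) (phi : 'rV[R]_n * R -> R)
    (x : 'rV[R]_n) : R :=
  derive phi (x, h x) (dy n)
  - \sum_(i < n) derive h x (e_ i) * derive phi (x, h x) (dx i).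

Definition hele_shaw_smooth_solution (n : nat) (T : R)
    (h : R -> 'rV[R]_n -> R) :=
  [/\ smooth_near [set p : R * 'rV[R]_n | 0 <= p.1 <= T]
        (fun p : R * 'rV[R]_n => h p.1 p.2),
      (forall t, 0 <= t <= T -> periodic (h t)) &
      forall t, 0 <= t <= T ->
        exists phi : 'rV[R]_n * R -> R,
          harmonic_ext (h t) (h t) phi /\
          forall x, derive (fun s : R => h s x) t 1 + DtN (h t) phi x = 0].

Definition convex_fun (Phi : R -> R) :=
  forall (a b l : R), 0 <= l <= 1 ->
    Phi (l * a + (1 - l) * b) <= l * Phi a + (1 - l) * Phi b.

Definition I_Phi (n : nat) (Phi : R -> R) (h : R -> 'rV[R]_n -> R) (t : R) : R :=
  torus_int (fun x => Phi (h t x)).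

End Defs.

(* Main.v *)
(* Put [F = Phi'] and [u = d_t h = - G(h)h], and let [phi] be the harmonic extension of [h] at time [s].
   Then [I_Phi' = - int F(h) G(h)h].

   (i) On the level [{y = h(x) - c}] consider the flux of [F(phi) grad phi].  By the divergence theorem it is monotone
   in [c] with rate [int F'(phi) |grad phi|^2 >= 0], and by finiteness of the energy it is arbitrarily small on suitable
   deep levels; hence [int F(h) G(h)h >= 0].

   (ii) [I_Phi'' = int F(h) d_t u + F'(h) u^2].  Instead of differentiating the Dirichlet-to-Neumann operator,
   compare the solution at times [s] and [s + d].  With [phi'] the extension at time [s + d] and [K] large, the function
   [e(x,y) = phi'(x, y + d K) - 2 phi(x,y) + phi(x, y - d (K - 1))] is harmonic below the graph of [h(s + d) - d K],
   which lies below the graph of [h(s)], so no function is evaluated outside its domain.  If [e >= - eps] on this graph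
   then, by Green's formula and [F'' >= 0],
     [int F(phi') d_n e = int F'(phi') grad phi' . grad e <= int (e + eps) F'(phi') d_n phi'].
   On the graph [e / d] tends to [N = |grad phi|^2 = B + u - B u >= 0], where [B = d_y phi], and the fluxes of [phi]
   through the nearby graphs are expanded to first order in [d] by the divergence theorem.  Letting [d] tend to [0+] gives
     [int F d_t u >= int N F' u - int F' (B + u) u + int F' (B + u)],
   that is, [I_Phi'' >= int F' N (1 + u)], and [1 + u = 1 - G(h)h >= 0] by the maximum principle. *)
Require Import Defs.
From HB Require Import structures.
From mathcomp Require Import all_boot all_order all_algebra.
From mathcomp Require Import all_classical all_reals all_analysis.
From mathcomp Require Import ring lra.
Set Implicit Arguments. Unset Strict Implicit. Unset Printing Implicit Defensive.
Import Order.TTheory GRing.Theory Num.Theory.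
Import numFieldNormedType.Exports.
Local Open Scope classical_set_scope.
Local Open Scope ring_scope.

(** Formally the comparison function divided by [d] tends to [d_t phi + d_y phi], since the shifts
    contribute [K - (K - 1) = 1] vertical derivative. On the graph, [d_t phi = u (1 - B)] has no
    sign, whereas Green's inequality needs one; adding [d_y phi = B] turns it into [|grad phi|^2].
    [K] cancels from every limit and serves to lower the graph. The derivative [d_t phi] is never
    formed: the extension is merely given at each time, with no regularity in time, and its second
    derivatives are known to exist only strictly below the graph. So everything goes through fluxes,
    which involve first derivatives: they are differentiated with respect to the graph strictly
    inside the domain and reach the boundary by continuity. Integration over the unbounded domain is
    avoided as well. Each integral inequality is read as monotonicity of a flux in the depth
    [z < 0], and finite energy supplies deep levels on which the flux is small. All limits under the
    integral are uniform limits on the compact unit cube. *)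

Lemma cvg_comp_at (I : Type) (F : set_system I) (T U : topologicalType)
    (g : I -> T) (f : T -> U) (l : T) {FF : Filter F} :
  g @ F --> l -> {for l, continuous f} -> f (g i) @[i --> F] --> f l.
Proof. by move=> gl fl; exact: (cvg_comp _ _ gl fl). Qed.

(** * Pointwise continuity *)

Section ContinuityAt.
Variables (R : realType) (T : topologicalType) (x : T).

Lemma cont_pair (U V : topologicalType) (f : T -> U) (g : T -> V) :
  {for x, continuous f} -> {for x, continuous g} ->
  {for x, continuous (fun y => (f y, g y))}.
Proof. by move=> cf cg; exact: (cvg_pair cf cg). Qed.

Lemma cont_comp (U V : topologicalType) (f : T -> U) (g : U -> V) :
  {for x, continuous f} -> {for f x, continuous g} ->
  {for x, continuous (fun y => g (f y))}.
Proof. by move=> cf cg; exact: (continuous_comp cf cg). Qed.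

Lemma contD (f g : T -> R) : {for x, continuous f} -> {for x, continuous g} ->
  {for x, continuous (fun y => f y + g y)}.
Proof. by move=> cf cg; exact: (continuousD cf cg). Qed.

Lemma contM (f g : T -> R) : {for x, continuous f} -> {for x, continuous g} ->
  {for x, continuous (fun y => f y * g y)}.
Proof. by move=> cf cg; exact: (continuousM cf cg). Qed.

Lemma contN (f : T -> R) : {for x, continuous f} ->
  {for x, continuous (fun y => - f y)}.
Proof. by move=> cf; exact: (continuousN cf). Qed.

Lemma contB (f g : T -> R) : {for x, continuous f} -> {for x, continuous g} ->
  {for x, continuous (fun y => f y - g y)}.
Proof. by move=> cf cg; apply: contD => //; exact: contN. Qed.

Lemma cont_sum (I : finType) (f : I -> T -> R) :
  (forall i, {for x, continuous (f i)}) -> {for x, continuous (fun y => \sum_i f i y)}.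
Proof.
move=> cf; elim: (index_enum I) => [|i r IH].
  have -> : (fun y => \sum_(i <- [::]) f i y) = fun=> 0 by apply/funext => y; rewrite big_nil.
  exact: cst_continuous.
have -> : (fun y => \sum_(j <- i :: r) f j y) = fun y => f i y + \sum_(j <- r) f j y.
  by apply/funext => y; rewrite big_cons.
exact: contD.
Qed.

Lemma cont_cst (U : topologicalType) (c : U) : {for x, continuous (fun _ : T => c)}.
Proof. exact: cst_continuous. Qed.

Lemma cont_id : {for x, continuous (fun y : T => y)}.
Proof. exact: cvg_id. Qed.

Lemma continuous_at_distP (f : T -> R) :
  {for x, continuous f} <-> (forall e, 0 < e -> \forall y \near x, `|f x - f y| <= e).
Proof. exact: cvgrPdist_le. Qed.

End ContinuityAt.

Lemma cont_fst (T U : topologicalType) (p : T * U) :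
  {for p, continuous (fun q : T * U => q.1)}.
Proof. by case: p => a b; exact: cvg_fst. Qed.

Lemma cont_snd (T U : topologicalType) (p : T * U) :
  {for p, continuous (fun q : T * U => q.2)}.
Proof. by case: p => a b; exact: cvg_snd. Qed.

(** * Integration over the torus *)

Section TorusIntegral.
Variable R : realType.
Local Notation mu := (@lebesgue_measure R).

Definition cube n : set 'rV[R]_n := [set x | forall i, 0 <= x 0 i <= 1].
(** Continuity is in the ambient space, at the points of the cube, and not relative to the cube:
    slices and compositions then need no subspace topology. *)
Definition cube_continuous n (f : 'rV[R]_n -> R) :=
  forall x, cube x -> {for x, continuous f}.

Lemma compact_cube n : compact (@cube n).
Proof.
have := @rV_compact R n (fun=> `[0, 1]%classic) (fun=> @segment_compact R 0 1).
by congr compact; apply/seteqP; split => x /= H i; have := H i; rewrite in_itv.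
Qed.

Lemma cvg_rV (I : Type) (F : set_system I) n (f : I -> 'rV[R]_n) (l : 'rV[R]_n) {FF : Filter F} :
  (forall j, f i 0 j @[i --> F] --> l 0 j) -> f @ F --> l.
Proof.
move=> H A [P lP sPA]; apply: (@filterS _ F FF [set i | forall j k, P j k (f i j k)]).
  by move=> i /= Pi; apply: sPA.
apply: filter_forall => j; apply: filter_forall => k.
by rewrite ord1; apply: H; have := lP j k; rewrite ord1.
Qed.

Lemma row_mx_s0 m (s : R) (x : 'rV[R]_m) :
  row_mx (s%:M : 'rV[R]_1) x 0 (@lshift 1 m 0) = s.
Proof. by rewrite row_mxEl mxE eqxx mulr1n. Qed.

Lemma row_mx_sS m (s : R) (x : 'rV[R]_m) j :
  row_mx (s%:M : 'rV[R]_1) x 0 (@rshift 1 m j) = x 0 j.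
Proof. by rewrite row_mxEr. Qed.

Lemma cvg_row_mx (I : Type) (F : set_system I) m (f : I -> R) (g : I -> 'rV[R]_m)
    (s : R) (x : 'rV[R]_m) {FF : Filter F} : f @ F --> s -> g @ F --> x ->
  (row_mx ((f i)%:M : 'rV[R]_1) (g i)) @[i --> F] --> row_mx (s%:M : 'rV[R]_1) x.
Proof.
move=> fs gx; apply: cvg_rV => j.
case: (@splitP 1 m j) => k jk.
  have -> : j = @lshift 1 m 0 by apply/val_inj; rewrite /= jk ord1.
  by rewrite row_mx_s0; under eq_fun do rewrite row_mx_s0.
have -> : j = @rshift 1 m k by apply/val_inj.
rewrite row_mx_sS; under eq_fun do rewrite row_mx_sS.
apply: (@cvg_comp_at _ F _ _ g (fun M : 'rV[R]_m => M 0 k)) => //.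
exact: coord_continuous.
Qed.

Lemma cube_row_mx m (s : R) (x : 'rV[R]_m) :
  0 <= s <= 1 -> cube x -> cube (row_mx (s%:M : 'rV[R]_1) x).
Proof.
move=> s01 cx j; case: (@splitP 1 m j) => k jk.
  have -> : j = @lshift 1 m 0 by apply/val_inj; rewrite /= jk ord1.
  by rewrite row_mx_s0.
have -> : j = @rshift 1 m k by apply/val_inj.
by rewrite row_mx_sS.
Qed.

Lemma cube_continuous_slice m (f : 'rV[R]_m.+1 -> R) (s : R) :
  cube_continuous f -> 0 <= s <= 1 ->
  cube_continuous (fun x => f (row_mx (s%:M : 'rV[R]_1) x)).
Proof.
move=> cf s01 x cx.
apply: (@cvg_comp_at _ (nbhs x) _ _ (fun x : 'rV[R]_m => row_mx (s%:M : 'rV[R]_1) x) f); last exact: (cf _ (cube_row_mx s01 cx)).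
by apply: (@cvg_row_mx _ _ _ (fun=> s) id); [exact: cvg_cst|exact: cvg_id].
Qed.

Lemma eq_torus_int n (f g : 'rV[R]_n -> R) :
  (forall x, cube x -> f x = g x) -> torus_int f = torus_int g.
Proof.
elim: n f g => [|m IH] f g fg /=; first by apply: fg => -[].
apply: eq_Rintegral => s; rewrite inE /= in_itv /= => s01.
by apply: IH => x cx; apply: fg; exact: cube_row_mx.
Qed.

(** The three properties are bundled because one induction on the dimension proves them together.
    The outer integral needs an integrable integrand; this follows from continuity of the slice
    integrals, which rests on linearity, positivity and normalisation one dimension below. *)
Definition torus_int_basic n :=
  [/\ forall (f g : 'rV[R]_n -> R) a, cube_continuous f -> cube_continuous g ->
        torus_int (fun x => a * f x + g x) = a * torus_int f + torus_int g,
      forall f : 'rV[R]_n -> R, cube_continuous f -> (forall x, cube x -> 0 <= f x) ->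
        0 <= torus_int f &
      forall c : R, torus_int (fun _ : 'rV[R]_n => c) = c].

Lemma cube_continuous_cst n (c : R) : cube_continuous (fun _ : 'rV[R]_n => c).
Proof. by move=> x _; exact: cst_continuous. Qed.

Lemma cube_continuousD n (f g : 'rV[R]_n -> R) : cube_continuous f -> cube_continuous g ->
  cube_continuous (fun x => f x + g x).
Proof. by move=> cf cg x cx; exact: (continuousD (cf x cx) (cg x cx)). Qed.

Lemma cube_continuousM n (f g : 'rV[R]_n -> R) : cube_continuous f -> cube_continuous g ->
  cube_continuous (fun x => f x * g x).
Proof. by move=> cf cg x cx; exact: (continuousM (cf x cx) (cg x cx)). Qed.

Lemma cube_continuousN n (f : 'rV[R]_n -> R) : cube_continuous f ->
  cube_continuous (fun x => - f x).
Proof. by move=> cf x cx; exact: (continuousN (cf x cx)). Qed.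

(** Positivity is applied to [g + e - f] and to [f + e - g]. The suffix [_from] marks statements
    relative to [torus_int_basic], usable inside the induction. *)
Lemma torus_int_dist_from n (f g : 'rV[R]_n -> R) e : torus_int_basic n ->
  cube_continuous f -> cube_continuous g ->
  (forall x, cube x -> `|f x - g x| <= e) ->
  `|torus_int f - torus_int g| <= e.
Proof.
move=> [TL T0 TC] cf cg fge.
have L1 : 0 <= torus_int (fun x => (-1) * f x + (1 * g x + e)).
  apply: T0 => [|x cx].
    apply: cube_continuousD; first by apply: cube_continuousM => //; exact: cube_continuous_cst.
    apply: cube_continuousD; last exact: cube_continuous_cst.
    by apply: cube_continuousM => //; exact: cube_continuous_cst.
  by have := fge x cx; rewrite ler_norml => /andP[]; lra.
have L2 : 0 <= torus_int (fun x => (-1) * g x + (1 * f x + e)).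
  apply: T0 => [|x cx].
    apply: cube_continuousD; first by apply: cube_continuousM => //; exact: cube_continuous_cst.
    apply: cube_continuousD; last exact: cube_continuous_cst.
    by apply: cube_continuousM => //; exact: cube_continuous_cst.
  by have := fge x cx; rewrite ler_norml => /andP[]; lra.
have aux h : cube_continuous h -> cube_continuous (fun x => 1 * h x + e).
  move=> ch; apply: cube_continuousD; last exact: cube_continuous_cst.
  by apply: cube_continuousM => //; exact: cube_continuous_cst.
rewrite !TL ?TC in L1 L2; do ?[exact: cube_continuous_cst | exact: aux | by []].
by rewrite ler_norml; apply/andP; split; lra.
Qed.

(** Joint convergence at every point of the compact cube is uniform convergence, which suffices to
    pass to the limit; no dominated convergence is involved. *)
Lemma torus_int_cvg_from n (I : Type) (F : set_system I)
    (k : I -> 'rV[R]_n -> R) (k0 : 'rV[R]_n -> R) {FF : Filter F} :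
  torus_int_basic n ->
  (\forall i \near F, cube_continuous (k i)) -> cube_continuous k0 ->
  (forall x, cube x ->
     (fun p : I * 'rV[R]_n => k p.1 p.2) @ filter_prod F (nbhs x) --> k0 x) ->
  torus_int (k i) @[i --> F] --> torus_int k0.
Proof.
move=> TB ck ck0 kk0; apply/cvgrPdist_le => e e0.
have /compact_near_coveringP/(_ I F (fun i x => `|k0 x - k i x| <= e)) := @compact_cube n.
move=> /(_ FF) => H.
have {}H : \near F, @cube n `<=` (fun x => `|k0 x - k F x| <= e).
  apply: H => x cx.
  have e2 : 0 < e / 2 by rewrite divr_gt0.
  have /cvgrPdist_le/(_ _ e2) [[A B] /= [FA xB] AB] := kk0 x cx.
  have /cvgrPdist_le/(_ _ e2) D := ck0 x cx.
  exists (B `&` [set y | `|k0 x - k0 y| <= e / 2], A) => /=.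
    by split => //; exact: filterI.
  move=> [y i] /= [[By Dy] Ai].
  have /= := AB (i, y) (conj Ai By).
  by move=> H1; move: Dy H1; rewrite !ler_norml => /andP[? ?] /andP[? ?]; apply/andP; split; lra.
near=> i; apply: torus_int_dist_from => //; first by near: i.
by near: i.
Unshelve. all: by end_near. Qed.

Lemma within_continuous_slice m (f : 'rV[R]_m.+1 -> R) :
  torus_int_basic m -> cube_continuous f ->
  {within `[0, 1], continuous (fun s => torus_int
     (fun x : 'rV[R]_m => f (row_mx (s%:M : 'rV[R]_1) x)))}.
Proof.
move=> TB cf; apply/subspace_continuousP => s /=; rewrite in_itv /= => s01.
apply: torus_int_cvg_from => //.
- near=> t; apply: cube_continuous_slice => //.
  have : `[0, 1]%classic t by near: t; exact: withinT.
  by rewrite /= in_itv.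
- exact: cube_continuous_slice.
- move=> x cx; apply: (@cvg_comp_at _ (filter_prod (within `[0, 1] (nbhs s)) (nbhs x)) _ _ (fun p : R * 'rV[R]_m => row_mx (p.1%:M : 'rV[R]_1) p.2) f); last exact: (cf _ (cube_row_mx s01 cx)).
  apply: (@cvg_row_mx _ _ _ fst snd); last exact: cvg_snd.
  by apply: (cvg_trans (@cvg_fst _ _ _ _ _)); exact: cvg_within.
Unshelve. all: by end_near. Qed.

Lemma integrable_slice m (f : 'rV[R]_m.+1 -> R) :
  torus_int_basic m -> cube_continuous f ->
  mu.-integrable `[0, 1] (EFin \o (fun s => torus_int
     (fun x : 'rV[R]_m => f (row_mx (s%:M : 'rV[R]_1) x)))).
Proof.
move=> TB cf; apply: continuous_compact_integrable; first exact: segment_compact.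
exact: within_continuous_slice.
Qed.

Lemma torus_int_basicP n : torus_int_basic n.
Proof.
elim: n => [|m IH]; first by split => // f _; apply => -[].
have [TL T0 TC] := IH; split => /=.
- move=> f g a cf cg.
  under eq_Rintegral.
    move=> s; rewrite inE /= in_itv /= => s01.
    rewrite TL; [over|exact: cube_continuous_slice..].
  rewrite RintegralD//=; [|apply: continuous_compact_integrable; [exact: segment_compact|move=> s; apply: continuousM; [exact: cst_continuous|exact: within_continuous_slice]]|exact: integrable_slice].
  by rewrite RintegralZl//; exact: integrable_slice.
- move=> f cf f0; apply: Rintegral_ge0 => s; rewrite /= in_itv /= => s01.
  by apply: T0 => [|x cx]; [exact: cube_continuous_slice|apply: f0; exact: cube_row_mx].
- move=> c; under eq_Rintegral do rewrite TC.
  by rewrite Rintegral_cst// /= lebesgue_measure_itv/= lte_fin ltr01 /= oppr0 addr0 mulr1.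
Qed.

End TorusIntegral.

Section TorusIntegralTheory.
Variable R : realType.
Local Notation mu := (@lebesgue_measure R).

Section Basic.
Variable n : nat.
Implicit Types (f g : 'rV[R]_n -> R) (a c : R).

Lemma torus_int_cst c : torus_int (fun _ : 'rV[R]_n => c) = c.
Proof. by have [_ _ ->] := torus_int_basicP R n. Qed.

Lemma torus_int_ge0 f : cube_continuous f -> (forall x, cube x -> 0 <= f x) ->
  0 <= torus_int f.
Proof. by have [_ + _] := torus_int_basicP R n; exact. Qed.

Lemma torus_intD f g : cube_continuous f -> cube_continuous g ->
  torus_int (fun x => f x + g x) = torus_int f + torus_int g.
Proof.
move=> cf cg; have [+ _ _] := torus_int_basicP R n.
by move/(_ f g 1 cf cg); rewrite mul1r => <-; congr torus_int; apply/funext => x; rewrite mul1r.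
Qed.

Lemma torus_intZ f a : cube_continuous f ->
  torus_int (fun x => a * f x) = a * torus_int f.
Proof.
move=> cf; have [+ _ _] := torus_int_basicP R n.
move/(_ f (fun=> 0) a cf (@cube_continuous_cst R n 0)); rewrite torus_int_cst addr0 => <-.
by congr torus_int; apply/funext => x; rewrite addr0.
Qed.

Lemma torus_intN f : cube_continuous f -> torus_int (fun x => - f x) = - torus_int f.
Proof.
by move=> cf; rewrite -mulN1r -torus_intZ//; congr torus_int; apply/funext => x; rewrite mulN1r.
Qed.

Lemma torus_intB f g : cube_continuous f -> cube_continuous g ->
  torus_int (fun x => f x - g x) = torus_int f - torus_int g.
Proof. by move=> cf cg; rewrite torus_intD ?torus_intN//; exact: cube_continuousN. Qed.

Lemma torus_int_le f g : cube_continuous f -> cube_continuous g ->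
  (forall x, cube x -> f x <= g x) -> torus_int f <= torus_int g.
Proof.
move=> cf cg fg; rewrite -subr_ge0 -torus_intB//; apply: torus_int_ge0 => [|x cx].
  by apply: cube_continuousD => //; exact: cube_continuousN.
by rewrite subr_ge0 fg.
Qed.

Lemma torus_int_cvg (I : Type) (F : set_system I)
    (k : I -> 'rV[R]_n -> R) (k0 : 'rV[R]_n -> R) {FF : Filter F} :
  (\forall i \near F, cube_continuous (k i)) -> cube_continuous k0 ->
  (forall x, cube x ->
     (fun p : I * 'rV[R]_n => k p.1 p.2) @ filter_prod F (nbhs x) --> k0 x) ->
  torus_int (k i) @[i --> F] --> torus_int k0.
Proof. by apply: torus_int_cvg_from; exact: torus_int_basicP. Qed.

Lemma cube_continuous_sum (I : finType) (f : I -> 'rV[R]_n -> R) :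
  (forall i, cube_continuous (f i)) -> cube_continuous (fun x => \sum_i f i x).
Proof.
move=> cf; elim: (index_enum I) => [|i r IH].
  by under eq_fun do rewrite big_nil; exact: cube_continuous_cst.
by under eq_fun do rewrite big_cons; exact: cube_continuousD.
Qed.

Lemma torus_int_sum (I : finType) (f : I -> 'rV[R]_n -> R) :
  (forall i, cube_continuous (f i)) ->
  torus_int (fun x => \sum_i f i x) = \sum_i torus_int (f i).
Proof.
move=> cf; suff : cube_continuous (fun x => \sum_(i <- index_enum I) f i x) /\
  torus_int (fun x => \sum_(i <- index_enum I) f i x) = \sum_(i <- index_enum I) torus_int (f i) by case.
elim: (index_enum I) => [|i r [IH1 IH2]].
  under eq_fun do rewrite big_nil; rewrite big_nil torus_int_cst.
  by split=> //; exact: cube_continuous_cst.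
under eq_fun do rewrite big_cons; rewrite big_cons -IH2 torus_intD//; split => //.
exact: cube_continuousD.
Qed.

End Basic.

Lemma MVT_ball (f df : R -> R) (s0 r a b : R) :
  (forall z, `|z - s0| < r -> is_derive z 1 f (df z)) ->
  `|a - s0| < r -> `|b - s0| < r ->
  exists2 c, `|c - s0| < r & f b - f a = df c * (b - a).
Proof.
move=> fdf.
wlog ab : a b / a <= b.
  move=> W ar br; have [ab|/ltW ba] := leP a b; first exact: W.
  have [c cr E] := W b a ba br ar; exists c => //.
  by rewrite -opprB E -mulrN opprB.
move=> ar br.
have I z : a <= z <= b -> `|z - s0| < r.
  move=> /andP[az zb]; move: ar br; rewrite !ltr_norml => /andP[? ?] /andP[? ?].
  by apply/andP; split; lra.
have [||c cab E] := @MVT_segment R f df a b ab.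
- by move=> z; rewrite in_itv /= => /andP[az zb]; apply: fdf; apply: I; rewrite !ltW.
- apply/continuous_in_subspaceT => z; rewrite inE /= in_itv /= => zab.
  have H := fdf z (I z zab).
  by apply/differentiable_continuous/derivable1_diffP.
- by exists c => //; apply: I; move: cab; rewrite in_itv.
Qed.

(** By the mean value theorem the difference quotient is [k'] at an intermediate time. Joint
    continuity of [k'] at [s0] makes its convergence uniform on the cube. *)
Lemma torus_int_is_derive n (k k' : R -> 'rV[R]_n -> R) (s0 : R) :
  (forall x, cube x -> \forall p \near (s0, x), is_derive (p.1 : R) 1 (k^~ p.2) (k' p.1 p.2)) ->
  (\forall s \near s0, cube_continuous (k s)) ->
  (forall x, cube x -> {for (s0, x), continuous (fun p => k' p.1 p.2)}) ->
  is_derive s0 1 (fun s => torus_int (k s)) (torus_int (k' s0)).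
Proof.
move=> dk ck ck'.
have ck0 : cube_continuous (k s0) by exact: nbhs_singleton ck.
have near0 (P : R -> Prop) : (\forall s \near s0, P s) -> \forall h \near 0^', P (h *: 1 + s0).
  move=> [e /= e0 H]; exists e => //= h /=; rewrite sub0r normrN => he _; apply: H => /=.
  by rewrite opprD addrCA subrr addr0 normrN /GRing.scale /= mulr1.
have ck0' : cube_continuous (k' s0).
  move=> x cx.
  apply: (@cont_comp _ _ _ _ (fun y => (s0, y)) (fun p => k' p.1 p.2)); last exact: ck'.
  by apply: cont_pair; [exact: cont_cst|exact: cont_id].
have L : h^-1 *: (torus_int (k (h *: 1 + s0)) - torus_int (k s0)) @[h --> 0^'] --> torus_int (k' s0).
  have E : \forall h \near (0 : R)^', torus_int (fun x => h^-1 * (k (h *: 1 + s0) x - k s0 x)) =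
      h^-1 *: (torus_int (k (h *: 1 + s0)) - torus_int (k s0)).
    have := near0 _ ck; apply: filterS => h ckh.
    rewrite torus_intZ ?torus_intB//.
    by apply: cube_continuousD => //; exact: cube_continuousN.
  apply: cvg_trans (near_eq_cvg E) _.
  apply: torus_int_cvg => //.
    have := near0 _ ck; apply: filterS => h ckh.
    apply: cube_continuousM; first exact: cube_continuous_cst.
    by apply: cube_continuousD => //; exact: cube_continuousN.
  move=> x0 cx0; apply/cvgrPdist_le => e e0.
  have /cvgrPdist_le/(_ _ e0) H2 := ck' x0 cx0.
  have [[A B] /= [[r /= r0 rA] xB] AB] := filterI (dk x0 cx0) H2.
  exists ([set h | `|h| < r /\ h != 0], B) => /=.
    split => //; exists r => //= h /=; rewrite sub0r normrN => hr h0; split => //.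
  move=> [h x] /= [[hr h0] Bx].
  have [|||c cr ->] := @MVT_ball (k^~ x) (k'^~ x) s0 r s0 (h *: 1 + s0).
  - move=> z zr; have [] := AB (z, x); last by [].
    by split => //=; apply: rA => /=; rewrite distrC.
  - by rewrite subrr normr0.
  - by rewrite /GRing.scale /= mulr1 addrK.
  rewrite addrK [h *: 1]mulr1 mulrC mulfK//.
  have [] := AB (c, x); last by move=> _ /=.
  by split => //=; apply: rA => /=; rewrite distrC.
apply: DeriveDef; first by apply/cvg_ex; exists (torus_int (k' s0)).
exact: cvg_lim L.
Qed.

End TorusIntegralTheory.

(** * Energies as iterated integrals *)

Section Energy.
Variable R : realType.
Local Notation mu := (@lebesgue_measure R).

(* No measurability is needed: the integral of a nonnegative function is a supremum over simple functions. *)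
Lemma ge0_integral_mono (A B : set R) (f g : R -> \bar R) :
  A `<=` B -> (forall x, A x -> 0 <= f x <= g x)%E -> (forall x, B x -> 0 <= g x)%E ->
  (\int[mu]_(x in A) f x <= \int[mu]_(x in B) g x)%E.
Proof.
move=> AB fg g0; rewrite integral_mkcond [leRHS]integral_mkcond.
have fg' x : (0 <= (f \_ A) x <= (g \_ B) x)%E.
  rewrite !patchE; case: ifPn => [|_]; first by rewrite inE => Ax; rewrite mem_set ?fg//; exact: AB.
  by case: ifPn => [|_]; rewrite ?lexx//= inE => /g0 ->.
have f0' x : (0 <= (f \_ A) x)%E by have /andP[] := fg' x.
have g0' x : (0 <= (g \_ B) x)%E by have /andP[? ?] := fg' x; apply: le_trans (f0' x) _.
rewrite [leLHS]ge0_integralTE; last exact: f0'.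
rewrite [leRHS]ge0_integralTE; last exact: g0'.
apply: le_ereal_sup => _ [h /= hf <-]; exists h => //= x.
by apply: le_trans (hf x) _; have /andP[] := fg' x.
Qed.

Lemma segment_integrable (f : R -> R) (a b : R) :
  {within `[a, b], continuous f} -> mu.-integrable `[a, b] (EFin \o f).
Proof. by apply: continuous_compact_integrable; exact: segment_compact. Qed.

Lemma continuous_within_segment (f : R -> R) (a b : R) :
  (forall x, a <= x <= b -> {for x, continuous f}) -> {within `[a, b], continuous f}.
Proof.
by move=> cf; apply/continuous_in_subspaceT => x; rewrite inE /= in_itv /=; exact: cf.
Qed.

Lemma Rintegral_subset_le (f : R -> R) (a b c d : R) :
  c <= a -> b <= d -> {within `[c, d], continuous f} ->
  (forall x, c <= x <= d -> 0 <= f x) ->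
  \int[mu]_(x in `[a, b]) f x <= \int[mu]_(x in `[c, d]) f x.
Proof.
move=> ca bd cf f0.
have sub : `[a, b]%classic `<=` `[c, d]%classic.
  by apply: subset_itv; rewrite bnd_simp.
have icd := segment_integrable cf.
have iab : mu.-integrable `[a, b] (EFin \o f) by apply: integrableS icd.
rewrite /Rintegral fine_le//; [exact: integrable_fin_num|exact: integrable_fin_num|].
apply: ge0_integral_mono => [//|x|x].
  by move=> /sub; rewrite /= in_itv /= => /f0; rewrite lee_fin lexx andbT.
by rewrite /= in_itv /= => /f0; rewrite lee_fin.
Qed.

Lemma Rintegral_cst_segment (a b c : R) : a <= b ->
  \int[mu]_(x in `[a, b]) c = c * (b - a).
Proof.
move=> ab; rewrite Rintegral_cst// /= lebesgue_measure_itv/= lte_fin.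
move: ab; rewrite le_eqVlt => /predU1P[->|->//].
by rewrite ltxx subrr.
Qed.

Lemma Rintegral_dist (f g : R -> R) (a b e : R) : a <= b ->
  {within `[a, b], continuous f} -> {within `[a, b], continuous g} ->
  (forall x, a <= x <= b -> `|f x - g x| <= e) ->
  `|\int[mu]_(x in `[a, b]) f x - \int[mu]_(x in `[a, b]) g x| <= e * (b - a).
Proof.
move=> ab cf cg fg.
have cfg : {within `[a, b], continuous (fun x => f x - g x)}.
  by move=> x; apply: cvgB; [exact: cf|exact: cg].
have cn : {within `[a, b], continuous (fun x => `|f x - g x|)}.
  by move=> x; apply: cvg_norm; exact: cfg.
have cc : {within `[a, b], continuous (fun _ : R => e)}.
  by move=> x; exact: cst_continuous.
rewrite -RintegralB//; [|exact: segment_integrable..].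
apply: le_trans (le_normr_Rintegral _ _) _ => //; first exact: segment_integrable.
rewrite -(Rintegral_cst_segment e ab); apply: le_Rintegral => //.
- exact: (segment_integrable cn).
- exact: (segment_integrable cc).
Qed.

Lemma Rintegral_eq0 (f : R -> R) : {within `[0, 1], continuous f} ->
  (forall x, 0 <= x <= 1 -> 0 <= f x) -> \int[mu]_(x in `[0, 1]) f x = 0 ->
  forall x, 0 <= x <= 1 -> f x = 0.
Proof.
move=> cf f0 If x x01; apply/eqP; rewrite eq_le f0// andbT leNgt; apply/negP => fx.
have /subspace_continuousP/(_ x) := cf.
rewrite /= in_itv /= => /(_ x01)/cvgrPdist_le/(_ (f x / 2)) H.
have [r /= r0 rH] := H (divr_gt0 fx (ltr0n _ 2)).
pose a := Num.max 0 (x - r / 2); pose b := Num.min 1 (x + r / 2).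
have /andP[x0 x1] := x01.
have ab : a < b.
  rewrite /a /b lt_min !gt_max; apply/andP; split; apply/andP; split => //; lra.
have a0 : 0 <= a by rewrite /a le_max lexx.
have b1 : b <= 1 by rewrite /b ge_min lexx.
have := Rintegral_subset_le a0 b1 cf f0; rewrite If leNgt => /negP; apply.
apply: lt_le_trans (_ : f x / 2 * (b - a) <= _).
  by rewrite mulr_gt0 ?subr_gt0 ?divr_gt0.
rewrite -(Rintegral_cst_segment _ (ltW ab)); apply: le_Rintegral => //.
- by apply: segment_integrable; move=> y; exact: cst_continuous.
- apply: segment_integrable; apply: continuous_subspaceW cf.
  by apply: subset_itv; rewrite bnd_simp.
- move=> y; rewrite /= in_itv /= => /andP[ay yb].
  have [y1 y2] : x - r / 2 <= y /\ y <= x + r / 2.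
    by split; [apply: le_trans ay; rewrite /a le_max lexx orbT|apply: (le_trans yb); rewrite /b ge_min lexx orbT].
  have := rH y; rewrite /= in_itv /= (le_trans a0 ay) (le_trans yb b1) /=.
  have -> : `|x - y| < r by rewrite ltr_norml; apply/andP; split; lra.
  move=> /(_ isT isT); rewrite ler_norml => /andP[_ fxy].
  by have : f x - f y <= f x / 2 := fxy; lra.
Qed.

Lemma torus_int_eq0 n (f : 'rV[R]_n -> R) : cube_continuous f ->
  (forall x, cube x -> 0 <= f x) -> torus_int f = 0 ->
  forall x, cube x -> f x = 0.
Proof.
elim: n f => [|m IH] f cf f0.
  by move=> /= E x _; rewrite -E; congr f; apply/rowP => -[].
move=> /= E x cx.
have x01 : 0 <= x 0 0 <= 1 := cx 0.
have G0 := Rintegral_eq0 (within_continuous_slice (torus_int_basicP R m) cf) _ E.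
have xE : x = row_mx ((x 0 0)%:M : 'rV[R]_1) (@rsubmx R 1 1 m x).
  have -> : (x 0 0)%:M = @lsubmx R 1 1 m x.
    by apply/matrixP => i j; rewrite !ord1 !mxE eqxx mulr1n; congr (x _ _); exact/val_inj.
  by rewrite hsubmxK.
have cx' : cube (@rsubmx R 1 1 m x) by move=> j; rewrite mxE; exact: cx.
rewrite xE.
apply: (IH (fun y => f (row_mx ((x 0 0)%:M : 'rV[R]_1) y))) => //.
- exact: cube_continuous_slice.
- by move=> y cy; apply: f0; exact: cube_row_mx.
- apply: G0 => // s s01; apply: torus_int_ge0; first exact: cube_continuous_slice.
  by move=> y cy; apply: f0; exact: cube_row_mx.
Qed.

Lemma torus_eint_EFin n (f : 'rV[R]_n -> R) : cube_continuous f ->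
  torus_eint (EFin \o f) = (torus_int f)%:E.
Proof.
elim: n f => [//|m IH] f cf /=.
rewrite /Rintegral fineK; last first.
  apply: integrable_fin_num => //.
  by apply: segment_integrable; exact: (within_continuous_slice (torus_int_basicP R m) cf).
apply: eq_integral => s; rewrite inE /= in_itv /= => s01.
by rewrite -IH//; exact: cube_continuous_slice.
Qed.

Lemma torus_eint_ge0 n (f : 'rV[R]_n -> \bar R) :
  (forall x, cube x -> 0 <= f x)%E -> (0 <= torus_eint f)%E.
Proof.
elim: n f => [|m IH] f f0 /=; first by apply: f0 => -[].
apply: integral_ge0 => s; rewrite /= in_itv /= => s01.
by apply: IH => x cx; apply: f0; exact: cube_row_mx.
Qed.

Lemma torus_eint_le n (f g : 'rV[R]_n -> \bar R) :
  (forall x, cube x -> 0 <= f x <= g x)%E -> (torus_eint f <= torus_eint g)%E.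
Proof.
elim: n f g => [|m IH] f g fg /=; first by have /andP[] : (0 <= f 0%R <= g 0%R)%E by apply: fg => -[].
apply: ge0_integral_mono => // s; rewrite /= in_itv /= => s01.
  apply/andP; split; last by apply: IH => x cx; apply: fg; exact: cube_row_mx.
  by apply: torus_eint_ge0 => x cx; have /andP[] := fg _ (cube_row_mx s01 cx).
apply: torus_eint_ge0 => x cx; have /andP[] := fg _ (cube_row_mx s01 cx).
exact: le_trans.
Qed.

Lemma cube_continuous_Rintegral n (k : R -> 'rV[R]_n -> R) (a b : R) : a <= b ->
  (forall z x, a <= z <= b -> {for (z, x), continuous (fun p => k p.1 p.2)}) ->
  cube_continuous (fun x => \int[mu]_(z in `[a, b]) k z x).
Proof.
move=> ab ck x _; apply/continuous_at_distP => e e0.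
(* The [+ 1] keeps the denominator positive when [a = b]. *)
have e1 : 0 < e / (b - a + 1) by rewrite divr_gt0// ltr_wpDl// subr_ge0.
have ckz y z : a <= z <= b -> {for z, continuous (k^~ y)}.
  move=> zab; apply: (@cvg_comp_at _ (nbhs z) _ _ (fun z => (z, y)) (fun p => k p.1 p.2) (z, y)); last exact: ck.
  exact: (cvg_pair cvg_id (cvg_cst _)).
have cw y : {within `[a, b], continuous (k^~ y)}.
  by apply: continuous_within_segment => z; exact: ckz.
have /compact_near_coveringP H := @segment_compact R a b.
have {}H : \forall y \near x, `[a, b]%classic `<=` (fun z => `|k z x - k z y| <= e / (b - a + 1)).
  apply: (H _ (nbhs x) (fun y z => `|k z x - k z y| <= e / (b - a + 1))).
  move=> z; rewrite /= in_itv /= => zab.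
  have e2 : 0 < e / (b - a + 1) / 2 by rewrite divr_gt0.
  have /cvgrPdist_le/(_ _ e2) [[A B] /= [zA xB] AB] := ck z x zab.
  exists (A, B) => //= -[z' y] /= [Az By].
  have := AB (z', y) (conj Az By).
  have := AB (z', x) (conj Az (nbhs_singleton xB)).
  by rewrite /= !ler_norml => /andP[? ?] /andP[? ?]; apply/andP; split; lra.
apply: (@filterS _ (nbhs x)) H => y H.
apply: le_trans (Rintegral_dist ab (cw x) (cw y) (e := e / (b - a + 1)) _) _.
  by move=> z zab; apply: H; rewrite /= in_itv.
rewrite mulrAC ler_pdivrMr; last by rewrite ltr_wpDl// subr_ge0.
by rewrite ler_pM2l// lerDl.
Qed.

(* Stands in for Fubini: if [k xi] were larger than [C / (b - a)] for all [xi], the double integral would exceed [C]. *)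
Lemma torus_int_mean n (k : R -> 'rV[R]_n -> R) (a0 a b c0 C : R) :
  a0 < a -> a < b -> b < c0 ->
  (forall z x, a0 <= z <= c0 -> {for (z, x), continuous (fun p => k p.1 p.2)}) ->
  (forall z x, a0 <= z <= c0 -> 0 <= k z x) ->
  torus_int (fun x => \int[mu]_(z in `[a0, c0]) k z x) <= C ->
  exists2 xi, a < xi < b & torus_int (k xi) * (b - a) <= C.
Proof.
move=> a0a ab bc ck k0 kC.
have ckz y z : a0 <= z <= c0 -> {for z, continuous (k^~ y)}.
  move=> zab; apply: (@cvg_comp_at _ (nbhs z) _ _ (fun z => (z, y)) (fun p => k p.1 p.2) (z, y)); last exact: ck.
  exact: (cvg_pair cvg_id (cvg_cst _)).
have ck' z : a0 <= z <= c0 -> cube_continuous (fun x => \int[mu]_(z in `[a0, z]) k z x).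
  move=> /andP[z1 z2]; apply: cube_continuous_Rintegral => // t x /andP[t1 t2].
  by apply: ck; rewrite t1 (le_trans t2).
(* Integration starts at [a0], strictly before [a], and [b] is strictly before [c0]; hence [B] is
   differentiable on the closed interval from [a] to [b], with derivative [torus_int (k z)]. *)
pose B z := torus_int (fun x => \int[mu]_(z in `[a0, z]) k z x).
have dB z : a0 < z < c0 -> is_derive z 1 B (torus_int (k z)).
  move=> zac; have znear : \forall t \near z, a0 < t < c0.
    by have := near_in_itvoo (_ : z \in `]a0, c0[); rewrite in_itv /= => /(_ zac); apply: filterS => t; rewrite in_itv.
  have ltle t : a0 < t < c0 -> a0 <= t <= c0 by move=> /andP[? ?]; rewrite !ltW.
  apply: torus_int_is_derive.
  - move=> x cx; exists ([set t | a0 < t < c0], setT) => /=; first by split=> //; exact: filterT.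
    move=> [t y] /= [tac _].
    have [||||d1 d2] := @continuous_FTC1_closed R (k^~ y) a0 t c0.
    + by have /andP[] := tac.
    + by apply: segment_integrable; apply: continuous_within_segment => s; exact: ckz.
    + by have /andP[] := tac.
    + by apply: ckz; exact: ltle.
    + by apply: DeriveDef; [exact: d1|rewrite -derive1E; exact: d2].
  - by apply: filterS znear => t tac; apply: ck'; exact: ltle.
  - by move=> x cx; apply: ck; exact: ltle.
have [||xi] := @MVT R B (fun z => torus_int (k z)) a b ab.
- by move=> z; rewrite in_itv /= => /andP[z1 z2]; apply: dB; apply/andP; split; lra.
- apply: continuous_within_segment => z /andP[z1 z2].
  have zac : a0 < z < c0 by apply/andP; split; lra.
  by have H := dB z zac; apply/differentiable_continuous/derivable1_diffP.
rewrite in_itv /= => xiab E; exists xi => //; rewrite -E.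
have Rge0 z y : a0 <= z <= c0 -> 0 <= \int[mu]_(z in `[a0, z]) k z y.
  move=> /andP[z1 z2]; apply: Rintegral_ge0 => t; rewrite /= in_itv /= => /andP[t1 t2].
  by apply: k0; rewrite t1 (le_trans t2).
have aac : a0 <= a <= c0 by apply/andP; split; lra.
have bac : a0 <= b <= c0 by apply/andP; split; lra.
have cac : a0 <= c0 <= c0 by apply/andP; split; lra.
have Ba : 0 <= B a.
  by apply: torus_int_ge0 => [|x cx]; [exact: ck'|exact: Rge0].
have Bb : B b <= C.
  apply: le_trans kC; apply: torus_int_le; [exact: ck'|exact: ck'|] => x cx.
  apply: Rintegral_subset_le => //; first exact: ltW.
    by apply: continuous_within_segment => s; exact: ckz.
  by move=> z zac; exact: k0.
by rewrite lerBlDr (le_trans Bb)// lerDl.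
Qed.

Lemma Rintegral_shift (f : R -> R) (a b c : R) : a <= b ->
  {within `[c + a, c + b], continuous f} ->
  \int[mu]_(z in `[a, b]) f (c + z) = \int[mu]_(y in `[c + a, c + b]) f y.
Proof.
move=> ab cf; rewrite /Rintegral; congr fine.
have dF (x : R) : is_derive x 1 (fun z => c + z) 1.
  rewrite (_ : (fun z => c + z) = shift c); first exact: is_derive_shift.
  by apply/funext => z; rewrite /= addrC.
have dF1 : (fun z : R => c + z)^`()%classic = cst 1.
  by apply/funext => x; rewrite derive1E (@derive_val _ _ _ _ _ _ _ (dF x)).
have cF : continuous (fun z : R => c + z).
  by move=> x; apply: continuousD; [exact: cst_continuous|exact: cvg_id].
rewrite (@integration_by_substitution_increasing R (fun z => c + z) f a b) //=.
- by apply: eq_integral => x _; rewrite dF1 /= mulr1.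
- by move=> x y _ _ xy; rewrite ltrD2l.
- by move=> x _; rewrite dF1; exact: cst_continuous.
- by rewrite dF1; exact: is_cvg_cst.
- by rewrite dF1; exact: is_cvg_cst.
- split; first by move=> x _; exact: ex_derive.
  + exact/cvg_at_right_filter/cF.
  + exact/cvg_at_left_filter/cF.
Qed.

(** The band between the graphs of [g + a] and [g + b] lies below the graph of [h], so its energy is
    part of the total. The extended-real energy thereby becomes a bound, uniform in the band, on
    integrals of continuous functions. *)
Lemma torus_int_energy_le n (h g : 'rV[R]_n -> R) (e : 'rV[R]_n * R -> R) (a b : R) :
  a < b -> b < 0 -> continuous g -> (forall x, cube x -> g x <= h x) ->
  (forall p, 0 <= e p) ->
  (forall x y, y < g x -> {for (x, y), continuous e}) ->
  (torus_eint (fun x => \int[mu]_(y in `]-oo, h x[) (e (x, y))%:E) < +oo)%E ->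
  torus_int (fun x => \int[mu]_(z in `[a, b]) e (x, g x + z)) <=
  fine (torus_eint (fun x => \int[mu]_(y in `]-oo, h x[) (e (x, y))%:E))%E.
Proof.
move=> ab b0 cg gh e0 ce Efin.
have cez z x : a <= z <= b -> {for (z, x), continuous (fun p : R * 'rV[R]_n => e (p.2, g p.2 + p.1))}.
  move=> /andP[az zb].
  apply: (@cont_comp _ _ _ _ (fun p : R * 'rV[R]_n => (p.2, g p.2 + p.1)) e); last by apply: ce => /=; lra.
  apply: cont_pair; first exact: cont_snd.
  apply: contD; last exact: cont_fst.
  by apply: cont_comp; [exact: cont_snd|exact: cg].
have ck : cube_continuous (fun x => \int[mu]_(z in `[a, b]) e (x, g x + z)).
  by apply: (@cube_continuous_Rintegral n (fun z x => e (x, g x + z)) a b (ltW ab)).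
have E0 : (0 <= torus_eint (fun x => \int[mu]_(y in `]-oo, h x[) (e (x, y))%:E))%E.
  by apply: torus_eint_ge0 => x _; apply: integral_ge0 => y _; rewrite lee_fin.
rewrite -lee_fin fineK ?ge0_fin_numE// -torus_eint_EFin//.
apply: torus_eint_le => x cx.
rewrite /= lee_fin Rintegral_ge0 //=.
have cex : {within `[g x + a, g x + b], continuous (fun y => e (x, y))}.
  apply: continuous_within_segment => y /andP[_ yb].
  apply: (@cont_comp _ _ _ _ (fun y => (x, y)) e); last by apply: ce; lra.
  by apply: cont_pair; [exact: cont_cst|exact: cont_id].
rewrite (@Rintegral_shift (fun y => e (x, y)) a b (g x) (ltW ab))//.
rewrite /Rintegral fineK; last by apply: integrable_fin_num => //; exact: segment_integrable.
apply: ge0_integral_mono.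
- move=> y; rewrite /= !in_itv /= => /andP[_ yb].
  by have := gh x cx; lra.
- by move=> y _; rewrite lexx lee_fin e0.
- by move=> y _; rewrite lee_fin.
Qed.

End Energy.

(** * Continuously differentiable functions *)

Section StrictDifferentiability.
Variable R : realType.

(** A finite spanning family with bounded linear coordinates. It holds for the line and for row
    vectors and is stable under products, so that one proof covers functions of [r], of [(x, y)] and
    of [(t, x)]. *)
Definition finite_coords (V : normedModType R) :=
  exists (I : finType) (b : I -> V) (c : I -> V -> R^o) (C : R),
  [/\ forall v, v = \sum_i c i v *: b i, forall i, linear (c i), 0 <= C &
      forall i v, `|c i v| <= C * `|v|].

Lemma finite_coords_R : finite_coords R^o.
Proof.
exists 'I_1, (fun=> 1), (fun _ v => v), 1; split => //.
- by move=> v; rewrite big_ord1 [RHS]mulr1.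
- by move=> _ v; rewrite mul1r.
Qed.

Lemma finite_coords_rV n : finite_coords 'rV[R]_n.
Proof.
exists 'I_n, (fun i => e_ R i), (fun i (v : 'rV[R]_n) => v 0 i), 1; split => //.
- exact: row_sum_delta.
- by move=> i a u v; rewrite !mxE.
- move=> i v; rewrite mul1r [leRHS]/Num.Def.normr/= mx_normrE.
  exact: (le_bigmax _ (fun ij : 'I_1 * 'I_n => `|v ij.1 ij.2|) (0, i)).
Qed.

Lemma finite_coords_prod (V W : normedModType R) :
  finite_coords V -> finite_coords W -> finite_coords (V * W)%type.
Proof.
move=> [I [b [c [C [vE cL C0 cC]]]]] [J [b' [c' [C' [wE cL' C0' cC']]]]].
exists (I + J)%type, (fun k => match k with inl i => (b i, 0) | inr j => (0, b' j) end),
  (fun k v => match k with inl i => c i v.1 | inr j => c' j v.2 end), (C + C').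
split.
- move=> [v w]; rewrite big_sumType /=.
  have -> : \sum_i c i v *: ((b i, 0) : V * W) = (v, 0).
    rewrite [in RHS](vE v); elim/big_rec2 : _ => // i y1 y2 _ ->.
    by apply/pair_equal_spec; split => //=; rewrite scaler0 addr0.
  have -> : \sum_i c' i w *: ((0, b' i) : V * W) = (0, w).
    rewrite [in RHS](wE w); elim/big_rec2 : _ => // i y1 y2 _ ->.
    by apply/pair_equal_spec; split => //=; rewrite scaler0 addr0.
  by apply/pair_equal_spec; split => /=; rewrite ?addr0 ?add0r.
- by move=> [i|j] a u v /=; [exact: cL|exact: cL'].
- exact: addr_ge0.
- move=> [i|j] [v w] /=; rewrite prod_normE /=.
    apply: le_trans (cC i v) _; apply: ler_pM => //; first by rewrite lerDl.
    by rewrite le_max lexx.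
  apply: le_trans (cC' j w) _; apply: ler_pM => //; first by rewrite lerDr.
  by rewrite le_max lexx orbT.
Qed.

Variable V : normedModType R.
Implicit Types (f : V -> R) (U : set V) (p v w : V).

Lemma is_derive_line f p w (s : R) : derivable f (p + s *: w) w ->
  is_derive s 1 (fun s : R => f (p + s *: w)) ('D_w f (p + s *: w)).
Proof.
have E : (fun h : R => h^-1 *: (f (p + (h *: 1 + s) *: w) - f (p + s *: w))) =
    (fun h : R => h^-1 *: (f (h *: w + (p + s *: w)) - f (p + s *: w))).
  by apply/funext => h; rewrite [h *: 1]mulr1 scalerDl addrCA.
by move=> df; apply: DeriveDef; rewrite /derivable /derive /= E.
Qed.

(** The mean value theorem along the segment from [p] to [p + a *: w], with continuity of ['D_w f]
    at [p0]. The estimate is uniform in the base point [p], which both the telescoping below and the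
    limits with moving base points rely on. *)
Lemma Ck_on1_step U f p0 w : open U -> Ck_on 1 U f -> U p0 ->
  forall e, 0 < e -> exists2 d, 0 < d & forall p (a : R), `|p - p0| < d -> `|a| < d ->
  `|f (p + a *: w) - f p - a * 'D_w f p0| <= e * `|a|.
Proof.
move=> oU [df cf] Up0 e e0.
have := cf [:: w] p0 isT Up0; rewrite /= => /continuous_at_distP/(_ _ e0) H1.
have H2 : nbhs p0 (U `&` [set q | `|'D_w f p0 - 'D_w f q| <= e]).
  exact: filterI (open_nbhs_nbhs (conj oU Up0)) H1.
have /nbhs_ballP[r /= r0 rH] := H2.
pose d := r / (2 * (1 + `|w|)).
have w1 : 0 < 1 + `|w| by rewrite ltr_wpDr.
have d0 : 0 < d by rewrite divr_gt0// mulr_gt0.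
have dr : d * (1 + `|w|) = r / 2 by rewrite /d; field; rewrite gt_eqF.
exists d => // p a pd ad.
have near z : `|z - 0| < d -> U (p + z *: w) /\ `|'D_w f p0 - 'D_w f (p + z *: w)| <= e.
  rewrite subr0 => zd; apply: rH; rewrite -ball_normE /ball_ /= distrC addrAC.
  apply: le_lt_trans (ler_normD _ _) _; rewrite normrZ.
  apply: lt_le_trans (_ : d + d * `|w| <= _).
    by rewrite ltr_leD// ler_wpM2r// ltW.
  by rewrite -[X in X + _]mulr1 -mulrDr dr ler_pdivrMr// ler_pMr// ler1n.
have [|||c cd] := @MVT_ball R (fun s : R => f (p + s *: w)) (fun s => 'D_w f (p + s *: w)) 0 d 0 a.
- move=> z zd; apply: is_derive_line; apply: (df [::]) => //.
  by have [] := near z zd.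
- by rewrite subrr normr0.
- by rewrite subr0.
rewrite scale0r addr0 subr0 => ->; rewrite mulrC -mulrBr normrM mulrC ler_wpM2r//.
by rewrite distrC; have [] := near c cd.
Qed.

(** The increment is made along one vector at a time. Each step starts from a displaced base point,
    which the uniformity of [Ck_on1_step] allows. *)
Lemma Ck_on1_telescope U f p0 (I : eqType) (b : I -> V) (r : seq I) :
  open U -> Ck_on 1 U f -> U p0 ->
  forall e, 0 < e -> exists2 d, 0 < d & forall p (a : I -> R), `|p - p0| < d ->
    (forall i, `|a i| < d) ->
  `|f (p + \sum_(i <- r) a i *: b i) - f p - \sum_(i <- r) a i * 'D_(b i) f p0|
    <= e * \sum_(i <- r) `|a i|.
Proof.
move=> oU cf Up0 e e0; elim: r => [|j r [d1 d10 IH]].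
  by exists 1 => // p a _ _; rewrite !big_nil addr0 subrr subr0 normr0 mulr0.
have [d2 d20 H2] := Ck_on1_step (b j) oU cf Up0 e0.
pose d := Num.min (Num.min d1 d2) (d1 / (2 * (1 + `|b j|))).
have w1 : 0 < 1 + `|b j| by rewrite ltr_wpDr.
have d0 : 0 < d by rewrite !lt_min d10 d20 divr_gt0// mulr_gt0.
have dd1 : d <= d1 by rewrite !ge_min lexx.
have dd2 : d <= d2 by rewrite !ge_min lexx orbT.
have ddb : d * (1 + `|b j|) < d1.
  apply: le_lt_trans (_ : d1 / 2 < _); last by rewrite ltr_pdivrMr// ltr_pMr// ltr1n.
  rewrite -ler_pdivlMr//; apply: le_trans (_ : d1 / (2 * (1 + `|b j|)) <= _); first by rewrite ge_min lexx orbT.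
  by rewrite invfM mulrA.
exists d => // p a pd ad; rewrite !big_cons addrA.
set S := \sum_(_ <- _) _ *: _.
have -> : f (p + a j *: b j + S) - f p - (a j * 'D_(b j) f p0 + \sum_(i <- r) a i * 'D_(b i) f p0) =
  (f (p + a j *: b j) - f p - a j * 'D_(b j) f p0) +
  (f (p + a j *: b j + S) - f (p + a j *: b j) - \sum_(i <- r) a i * 'D_(b i) f p0) by ring.
apply: le_trans (ler_normD _ _) _; rewrite mulrDr; apply: lerD.
  by apply: H2; [exact: lt_le_trans dd2|exact: lt_le_trans (ad j) dd2].
apply: IH; last by move=> i; exact: lt_le_trans (ad i) dd1.
rewrite addrAC; apply: le_lt_trans (ler_normD _ _) _; rewrite normrZ.
apply: le_lt_trans ddb; rewrite mulrDr mulr1; apply: lerD; first exact: ltW.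
by rewrite ler_wpM2r// ltW.
Qed.

(** Expanding [q - p] in coordinates reduces the estimate to the telescoped one. The candidate
    differential [L] is the linear form built from the derivatives along the family [b]; the case
    [p = p0] is Frechet differentiability. *)
Lemma Ck_on1_strict U f p0 : finite_coords V -> open U -> Ck_on 1 U f -> U p0 ->
  differentiable f p0 /\
  forall e, 0 < e -> exists2 d, 0 < d & forall p q, `|p - p0| < d -> `|q - p0| < d ->
    `|f q - f p - 'D_(q - p) f p0| <= e * `|q - p|.
Proof.
move=> [I [b [c [C [vE cL C0 cC]]]]] oU cf Up0.
pose L v := \sum_i c i v * 'D_(b i) f p0 : R^o.
have LL : linear L.
  move=> a u v; rewrite /L scaler_sumr -big_split /=; apply: eq_bigr => i _.
  by rewrite (cL i a u v) /GRing.scale /=; ring.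
pose LM := GRing.isLinear.Build _ _ _ _ L LL.
pose LP : {linear V -> R^o} := HB.pack L LM.
pose K := C * #|I|%:R.
have K0 : 0 <= K by rewrite mulr_ge0.
have strict : forall e, 0 < e -> exists2 d, 0 < d & forall p q, `|p - p0| < d -> `|q - p0| < d ->
    `|f q - f p - L (q - p)| <= e * `|q - p|.
  move=> e e0.
  have e1 : 0 < e / (K + 1) by rewrite divr_gt0// ltr_wpDl.
  have [d d0 H] := Ck_on1_telescope b (index_enum I) oU cf Up0 e1.
  pose d' := Num.min d (d / (2 * (C + 1))).
  have C1 : 0 < C + 1 by rewrite ltr_wpDl.
  exists d'; first by rewrite lt_min d0 divr_gt0// mulr_gt0.
  move=> p q; rewrite !lt_min => /andP[pd pd2] /andP[qd qd2].
  have qp : `|q - p| < d / (C + 1).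
    rewrite (_ : q - p = (q - p0) - (p - p0)); last by rewrite opprB addrA subrK.
    apply: le_lt_trans (ler_normB _ _) _.
    rewrite (_ : d / (C + 1) = d / (2 * (C + 1)) + d / (2 * (C + 1))); first exact: ltrD.
    by field; rewrite gt_eqF.
  have aC i : `|c i (q - p)| < d.
    apply: le_lt_trans (cC _ _) _.
    apply: le_lt_trans (_ : (C + 1) * `|q - p| < _); first by rewrite ler_wpM2r// lerDl.
    by rewrite mulrC -ltr_pdivlMr.
  have := H p (fun i => c i (q - p)) pd aC.
  rewrite -vE subrKC => H'; apply: le_trans H' _.
  apply: le_trans (_ : e / (K + 1) * (K * `|q - p|) <= _).
    rewrite ler_wpM2l ?(ltW e1)//.
    apply: le_trans (ler_sum _ (fun i _ => cC i (q - p))) _.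
    by rewrite sumr_const /K cardT mulr_natr mulrnAl -cardE.
  rewrite mulrA ler_wpM2r// mulrAC ler_pdivrMr ?ltr_wpDl//.
  by rewrite ler_wpM2l ?(ltW e0)// lerDl.
have LC : continuous LP.
  apply: bounded_linear_continuous.
  pose D := \sum_i C * `|'D_(b i) f p0|.
  have D0 : 0 <= D by apply: sumr_ge0 => i _; rewrite mulr_ge0.
  exists D; split; first exact: num_real.
  move=> M DM; apply/nbhs_ballP; exists 1 => //= v; rewrite -ball_normE /ball_ /= sub0r normrN => v1.
  apply: le_trans (ltW DM); apply: le_trans (ler_norm_sum _ _ _) _.
  apply: ler_sum => i _; rewrite normrM ler_wpM2r//.
  by apply: le_trans (cC _ _) _; rewrite ler_piMr// ltW.
have LE : f \o shift p0 = cst (f p0) + LP +o_ 0 id.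
  apply/eqaddoP => e e0; have [d d0 H] := strict e e0.
  apply/nbhs_ballP; exists d => //= q /=; rewrite -ball_normE /ball_ /= sub0r normrN => qd.
  have := H p0 (q + p0); rewrite subrr normr0 addrK => /(_ d0 qd).
  by rewrite [X in _ -> X <= _]/Num.Def.normr /= /shift /= opprD addrA.
have dE := diff_unique LC LE.
have fd : differentiable f p0.
  by apply/diff_locallyP; rewrite dE.
split=> // e e0; have [d d0 H] := strict e e0.
by exists d => // p q pd qd; rewrite deriveE// dE; exact: H.
Qed.

End StrictDifferentiability.

(** The working notion of regularity: [Ck_on] speaks only of directional derivatives, while the
    chain rule needs a differential. *)
Definition C1 (R : realType) (V : normedModType R) (U : set V) (f : V -> R) :=
  forall p, U p ->
    differentiable f p /\ forall v, {for p, continuous (fun q => 'D_v f q)}.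

Section C1Theory.
Variables (R : realType) (V : normedModType R).
Implicit Types (f : V -> R) (U : set V).

Lemma C1_subset U U' f : U' `<=` U -> C1 U f -> C1 U' f.
Proof. by move=> UU' cf p /UU'; exact: cf. Qed.

Lemma C1_cont U f p : C1 U f -> U p -> {for p, continuous f}.
Proof. by move=> cf /cf[df _]; exact: differentiable_continuous. Qed.

Lemma C1_derivable U f p v : C1 U f -> U p -> derivable f p v.
Proof. by move=> cf /cf[df _]; exact: diff_derivable. Qed.

Lemma Ck_on1_C1 U f : finite_coords V -> open U -> Ck_on 1 U f -> C1 U f.
Proof.
move=> fV oU cf p Up; split; first by have [] := Ck_on1_strict fV oU cf Up.
by move=> v; exact: (cf.2 [:: v]).
Qed.

Lemma Ck_on_le k l U f : (k <= l)%N -> Ck_on l U f -> Ck_on k U f.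
Proof.
move=> kl [df cf]; split => [vs v x s Ux|vs x s Ux].
  by apply: df => //; exact: leq_trans kl.
by apply: cf => //; exact: leq_trans kl.
Qed.

Lemma Ck_on_derive k U f v : Ck_on k.+1 U f -> Ck_on k U (fun p => 'D_v f p).
Proof.
move=> [df cf].
(* [iter_D] applies the last vector of the list first. *)
have E vs : iter_D (fun p => 'D_v f p) vs = iter_D f (rcons vs v).
  by rewrite /iter_D foldr_rcons.
split => [vs w x s Ux|vs x s Ux]; rewrite E.
  by apply: df => //; rewrite size_rcons.
by apply: cf => //; rewrite size_rcons.
Qed.

Lemma deriveDl f p u v : differentiable f p -> 'D_(u + v) f p = 'D_u f p + 'D_v f p.
Proof. by move=> df; rewrite !deriveE// linearD. Qed.

Lemma deriveZl f p (a : R) v : differentiable f p -> 'D_(a *: v) f p = a * 'D_v f p.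
Proof. by move=> df; rewrite !deriveE// linearZ. Qed.

End C1Theory.

Section C1Calculus.
Variables (R : realType) (V : normedModType R).
Implicit Types (f : V -> R) (U : set V).

Lemma derive_comp_diff (W : normedModType R) (G : V -> W) (f : W -> R) x v :
  differentiable G x -> differentiable f (G x) ->
  is_derive x v (fun y => f (G y)) ('D_('D_v G x) f (G x)).
Proof.
move=> dG df; have dfG : differentiable (f \o G) x by exact: differentiable_comp.
apply: DeriveDef; first exact: diff_derivable.
by rewrite deriveE// diff_comp//= [in RHS]deriveE// [in RHS]deriveE.
Qed.

Lemma C1_comp (F : R -> R) U f : open U -> @C1 R R^o setT F -> C1 U f ->
  C1 U (fun p => F (f p)) /\
  forall p v, U p -> 'D_v (fun p => F (f p)) p = 'D_1 F (f p) * 'D_v f p.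
Proof.
move=> oU cF cf.
have E p v : U p -> 'D_v (fun p => F (f p)) p = 'D_1 F (f p) * 'D_v f p.
  move=> Up; have [df _] := cf p Up; have [dF _] := cF (f p) I.
  rewrite (@derive_val _ _ _ _ _ _ _ (derive_comp_diff v df dF)).
  have := @deriveZl R R^o F (f p) ('D_v f p) 1 dF.
  by rewrite [_ *: 1]mulr1 => ->; exact: mulrC.
split=> // p Up; have [df cdf] := cf p Up; have [dF cdF] := cF (f p) I.
split; first exact: (differentiable_comp df dF).
move=> v.
have : {for p, continuous (fun p => 'D_1 F (f p) * 'D_v f p)}.
  apply: contM => //; apply: (@cont_comp _ _ _ _ f (fun r => 'D_1 F r)); last exact: cdF.
  exact: differentiable_continuous.
rewrite /prop_for /continuous_at E// => H.
apply: cvg_trans H; apply: near_eq_cvg.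
by have := open_nbhs_nbhs (conj oU Up); apply: filterS => q Uq; rewrite E.
Qed.

End C1Calculus.

Section C1Algebra.
Variables (R : realType) (V : normedModType R).
Implicit Types (f g : V -> R) (U : set V).

Lemma C1_intro U f (D : V -> V -> R) : open U ->
  (forall p, U p -> differentiable f p) ->
  (forall p v, U p -> 'D_v f p = D v p) ->
  (forall p v, U p -> {for p, continuous (D v)}) -> C1 U f.
Proof.
move=> oU df E cD p Up; split; first exact: df.
move=> v; have := cD p v Up; rewrite /prop_for /continuous_at E// => H.
apply: cvg_trans H; apply: near_eq_cvg.
by have := open_nbhs_nbhs (conj oU Up); apply: filterS => q Uq; rewrite E.
Qed.

Lemma C1_cst U (c : R) : C1 U (fun _ : V => c).
Proof.
move=> p _; split; first exact: differentiable_cst.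
move=> v; have -> : (fun q : V => 'D_v (fun=> c) q) = fun=> 0.
  by apply/funext => q; exact: derive_cst.
exact: cont_cst.
Qed.

Lemma C1D U f g : open U -> C1 U f -> C1 U g -> C1 U (fun p => f p + g p).
Proof.
move=> oU cf cg; apply: (C1_intro (D := fun v p => 'D_v f p + 'D_v g p)) => // p.
- by move=> /[dup]/cf[df _] /cg[dg _]; exact: differentiableD.
- move=> v Up; rewrite (@deriveD _ _ _ f g)//; [exact: C1_derivable Up|exact: C1_derivable Up].
- by move=> v /[dup]/cf[_ df] /cg[_ dg]; exact: contD.
Qed.

Lemma C1M U f g : open U -> C1 U f -> C1 U g -> C1 U (fun p => f p * g p).
Proof.
move=> oU cf cg; apply: (C1_intro (D := fun v p => f p * 'D_v g p + g p * 'D_v f p)) => // p.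
- by move=> /[dup]/cf[df _] /cg[dg _]; exact: differentiableM.
- move=> v Up; rewrite (@deriveM _ _ f g)//; [exact: C1_derivable Up|exact: C1_derivable Up].
- by move=> v Up; apply: contD; apply: contM; [exact: C1_cont Up|have [_] := cg _ Up|exact: C1_cont Up|have [_] := cf _ Up]; exact.
Qed.

Lemma C1Z U f (a : R) : open U -> C1 U f -> C1 U (fun p => a * f p).
Proof. by move=> oU cf; exact: C1M oU (@C1_cst U a) cf. Qed.

Lemma C1B U f g : open U -> C1 U f -> C1 U g -> C1 U (fun p => f p - g p).
Proof.
move=> oU cf cg; have := C1D oU cf (C1Z (-1) oU cg).
by under eq_fun do rewrite mulN1r.
Qed.

Lemma derive_add U f g p v : C1 U f -> C1 U g -> U p ->
  'D_v (fun p => f p + g p) p = 'D_v f p + 'D_v g p.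
Proof. by move=> cf cg Up; rewrite (@deriveD _ _ _ f g)//; exact: C1_derivable Up. Qed.

Lemma derive_mul U f g p v : C1 U f -> C1 U g -> U p ->
  'D_v (fun p => f p * g p) p = f p * 'D_v g p + g p * 'D_v f p.
Proof. by move=> cf cg Up; rewrite (@deriveM _ _ f g)//; exact: C1_derivable Up. Qed.

Lemma derive_scale U f (a : R) p v : C1 U f -> U p ->
  'D_v (fun p => a * f p) p = a * 'D_v f p.
Proof. by move=> cf Up; rewrite (@deriveZ _ _ _ f)//; exact: C1_derivable Up. Qed.

End C1Algebra.

Section DeriveReparam.
Variables (R : realType) (V W : normedModType R).

(** A directional derivative sees only the restriction to a line. Agreement of two such restrictions
    therefore identifies the derivatives, so periods, translations, slices and projections are
    handled without chain rule or differentiability. *)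
Lemma eq_growth (f : V -> R) (g : W -> R) a v b w :
  (forall h : R, f (h *: v + a) = g (h *: w + b)) ->
  (fun h : R => h^-1 *: ((f \o shift a) (h *: v) - f a)) =
  (fun h : R => h^-1 *: ((g \o shift b) (h *: w) - g b)).
Proof.
move=> H; have H0 := H 0; rewrite !scale0r !add0r in H0.
by apply/funext => h /=; rewrite H H0.
Qed.

Lemma eq_derive_reparam (f : V -> R) (g : W -> R) a v b w :
  (forall h : R, f (h *: v + a) = g (h *: w + b)) -> 'D_v f a = 'D_w g b.
Proof. by move=> /eq_growth H; rewrite /derive H. Qed.

Lemma eq_derivable_reparam (f : V -> R) (g : W -> R) a v b w :
  (forall h : R, f (h *: v + a) = g (h *: w + b)) -> derivable f a v -> derivable g b w.
Proof. by move=> /eq_growth H; rewrite /derivable H. Qed.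

End DeriveReparam.

(** * Fluxes through graphs *)

Section PeriodicDivergence.
Variable R : realType.
Local Notation mu := (@lebesgue_measure R).

Lemma continuous_cube n (f : 'rV[R]_n -> R) : continuous f -> cube_continuous f.
Proof. by move=> cf x _; exact: cf. Qed.

Lemma row_mx_line m (s : R) (x : 'rV[R]_m) :
  row_mx (s%:M : 'rV[R]_1) x = row_mx (0%:M : 'rV[R]_1) x + s *: e_ R (ord0 : 'I_m.+1).
Proof.
apply/rowP => j; rewrite !mxE.
case: (@splitP 1 m j) => k jk.
  have -> : j = ord0 by apply/val_inj; rewrite /= jk ord1.
  by rewrite !ord1 !mxE !eqxx !mulr1n add0r mulr1.
have jn0 : ((j : 'I_m.+1) == ord0) = false by apply/eqP => j0; move: jk; rewrite j0.
rewrite [X in nat_of_bool X](_ : _ = false) ?mulr0 ?addr0//.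
Qed.

Lemma row_mx_e m (s : R) (x : 'rV[R]_m) (j : 'I_m) (a : R) :
  row_mx (s%:M : 'rV[R]_1) (a *: e_ R j + x) =
  a *: e_ R (lift ord0 j) + row_mx (s%:M : 'rV[R]_1) x.
Proof.
have liftE (k : 'I_m) : lift ord0 k = @rshift 1 m k by apply/val_inj.
rewrite liftE; apply/rowP => i; rewrite !mxE.
case: (@splitP 1 m i) => k ik.
  rewrite (_ : i == rshift 1 j = false) ?andbF ?mulr0 ?add0r//.
  by apply/eqP => ij; move: ik; rewrite ij ord1.
have -> : i = @rshift 1 m k by apply/val_inj.
rewrite !mxE; congr (_ * (nat_of_bool (_ && _))%:R + _).
Qed.

(** Induction on the dimension. A derivative in an inner coordinate is killed by the inner integral;
    one in the outermost coordinate is the derivative of the slice integral [G], and [G 1 = G 0] by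
    periodicity. *)
Lemma torus_int_derive_periodic n (i : 'I_n) (f : 'rV[R]_n -> R) :
  continuous f -> (forall x, derivable f x (e_ R i)) ->
  continuous (fun x => 'D_(e_ R i) f x) -> (forall x, f (x + e_ R i) = f x) ->
  torus_int (fun x => 'D_(e_ R i) f x) = 0.
Proof.
elim: n i f => [[]//|m IH] i f cf df cdf pf /=.
have crow s : continuous (fun x : 'rV[R]_m => row_mx (s%:M : 'rV[R]_1) x).
  by move=> x; apply: (@cvg_row_mx R _ (nbhs x) m (fun=> s) id); [exact: cvg_cst|exact: cvg_id].
have cslice s (F : 'rV[R]_m.+1 -> R) : continuous F ->
    continuous (fun x : 'rV[R]_m => F (row_mx (s%:M : 'rV[R]_1) x)).
  by move=> cF x; exact: (cont_comp (crow s x) (cF _)).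
have [j ij|ij] := unliftP ord0 i.
  rewrite /= in j ij; rewrite ij in df cdf pf *.
  have E s : (fun x : 'rV[R]_m => 'D_(e_ R (lift ord0 j)) f (row_mx (s%:M : 'rV[R]_1) x)) =
      fun x => 'D_(e_ R j) (fun x => f (row_mx (s%:M : 'rV[R]_1) x)) x.
    by apply/funext => x; apply: eq_derive_reparam => h; rewrite row_mx_e.
  have Hs s : torus_int (fun x : 'rV[R]_m => 'D_(e_ R (lift ord0 j)) f (row_mx (s%:M : 'rV[R]_1) x)) = 0.
    rewrite E IH//.
    - exact: cslice.
    - move=> x; apply: eq_derivable_reparam (df (row_mx (s%:M : 'rV[R]_1) x)) => h.
      by rewrite row_mx_e.
    - by rewrite -E; exact: (cslice s _ cdf).
    - move=> x; have := row_mx_e s x j 1; rewrite !scale1r addrC => ->.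
      by rewrite addrC pf.
  under eq_Rintegral do rewrite Hs.
  by rewrite Rintegral_cst// mul0r.
pose G (s : R) := torus_int (fun x : 'rV[R]_m => f (row_mx (s%:M : 'rV[R]_1) x)).
pose g (s : R) := torus_int (fun x : 'rV[R]_m => 'D_(e_ R (ord0 : 'I_m.+1)) f (row_mx (s%:M : 'rV[R]_1) x)).
rewrite ij in df cdf pf *.
have crow2 (p : R * 'rV[R]_m) : {for p, continuous (fun p => row_mx (p.1%:M : 'rV[R]_1) p.2)}.
  by apply: (@cvg_row_mx R _ (nbhs p) m fst snd); [exact: cont_fst|exact: cont_snd].
have dG (s : R) : is_derive s 1 G (g s).
  apply: (@torus_int_is_derive R m (fun s x => f (row_mx (s%:M : 'rV[R]_1) x))
    (fun s x => 'D_(e_ R (ord0 : 'I_m.+1)) f (row_mx (s%:M : 'rV[R]_1) x))).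
  - move=> x _; exists (setT, setT); first by split; exact: filterT.
    move=> [t y] _ /=; rewrite row_mx_line.
    have -> : (fun s : R => f (row_mx (s%:M : 'rV[R]_1) y)) =
        fun s : R => f (row_mx (0%:M : 'rV[R]_1) y + s *: e_ R (ord0 : 'I_m.+1)).
      by apply/funext => r; rewrite row_mx_line.
    exact: is_derive_line.
  - near=> t; apply: continuous_cube; exact: cslice.
  - move=> x _.
    exact: (@cont_comp _ _ _ _ _ _ (crow2 (s, x)) (cdf _)).
have cg : {within `[0, 1], continuous g}.
  apply: (@within_continuous_slice R m (fun x => 'D_(e_ R (ord0 : 'I_m.+1)) f x)); first exact: torus_int_basicP.
  exact: continuous_cube.
have cG (s : R) : {for s, continuous G} by apply/differentiable_continuous/derivable1_diffP.
have E : (\int[mu]_(s in `[0%R, 1%R]) (g s)%:E = (G 1)%:E - (G 0)%:E)%E.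
  apply: continuous_FTC2 => //.
    by split; [move=> s _; exact: ex_derive|exact/cvg_at_right_filter/cG|exact/cvg_at_left_filter/cG].
  by move=> s _; rewrite derive1E; exact: derive_val.
rewrite /Rintegral E (_ : G 1 = G 0) ?subee//=.
apply: eq_torus_int => x _.
by rewrite [in LHS]row_mx_line scale1r; exact: pf.
Unshelve. all: by end_near. Qed.

End PeriodicDivergence.

Section GraphFlux.
Variables (R : realType) (n : nat).
Local Notation X := ('rV[R]_n * R)%type.
Local Notation e_ := (e_ R).
Local Notation dx := (dx R).
Local Notation dy := (dy R n).
Implicit Types (f : X -> R) (g q : 'rV[R]_n -> R) (U : set X).

Definition periodic2 f := forall (i : 'I_n) x y, f (x + e_ i, y) = f (x, y).

(** Deformation of a graph along vertical segments. The choice [q = 1] gives the levels of a graph;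
    a difference quotient in time for [q] joins the solution at two times. *)
Definition graph_family g q (s : R) : 'rV[R]_n -> R := fun x => g x + s * q x.

Lemma derive_periodic2 f v : periodic2 f -> periodic2 (fun p => 'D_v f p).
Proof.
move=> pf i x y; apply: eq_derive_reparam => h.
have E (z : 'rV[R]_n) : (h *: v + (z, y) : X) = (h *: v.1 + z, h *: v.2 + y) by case: v.
by rewrite !E addrA pf.
Qed.

Lemma derive_periodic g v : Defs.periodic g -> Defs.periodic (fun x => 'D_v g x).
Proof. by move=> pg i x; apply: eq_derive_reparam => h; rewrite addrA pg. Qed.

Lemma derive_graph f g x v : differentiable f (x, g x) -> differentiable g x ->
  is_derive x v (fun x => f (x, g x))
    ('D_(v, 0) f (x, g x) + 'D_v g x * 'D_dy f (x, g x)).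
Proof.
move=> df dg.
have dG : differentiable (fun x => (x, g x)) x by apply: differentiable_pair.
apply: (is_derive_eq (@derive_comp_diff R _ _ (fun x => (x, g x)) f x v dG df)).
have -> : 'D_v (fun x => (x, g x)) x = (v, 'D_v g x).
  rewrite [in RHS]deriveE//; have dg' := differentiableP dg.
  rewrite deriveE//; exact: (congr1 (@^~ v) (@diff_val _ _ _ _ _ _ _ (is_diff_pair (is_diff_id x) dg'))).
rewrite -(deriveZl ('D_v g x) dy df) -(deriveDl (v, 0) ('D_v g x *: dy) df); congr ('D__ f _).
by rewrite /Defs.dy; apply/pair_equal_spec; split => /=; rewrite ?scaler0 ?addr0 ?add0r// /GRing.scale /= mulr1.
Qed.

Lemma derive_vertical f g q x (s : R) : differentiable f (x, graph_family g q s x) ->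
  is_derive s 1 (fun s : R => f (x, graph_family g q s x))
    (q x * 'D_dy f (x, graph_family g q s x)).
Proof.
move=> df.
have E : (fun s : R => f (x, graph_family g q s x)) = (fun s : R => f ((x, g x) + s *: (0, q x))).
  apply/funext => r; congr f; apply/pair_equal_spec; split => /=; first by rewrite scaler0 addr0.
  by rewrite /graph_family.
have E' : (x, graph_family g q s x) = (x, g x) + s *: (0, q x).
  by apply/pair_equal_spec; split => /=; rewrite ?scaler0 ?addr0.
have D : derivable f ((x, g x) + s *: (0, q x)) (0, q x) by rewrite -E'; exact: diff_derivable.
rewrite E; apply: (is_derive_eq (is_derive_line D)); rewrite -E'.
have -> : (0, q x) = q x *: dy.
  by apply/pair_equal_spec; split => /=; rewrite ?scaler0// /GRing.scale /= mulr1.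
exact: deriveZl.
Qed.

Lemma C1_setT_continuous (V : normedModType R) (g : V -> R) : C1 setT g -> continuous g.
Proof. by move=> cg x; exact: (C1_cont cg). Qed.

Lemma C1_setT_derive_continuous (V : normedModType R) (g : V -> R) v :
  C1 setT g -> continuous (fun x => 'D_v g x).
Proof. by move=> cg x; have [_] := cg x I; exact. Qed.

Lemma cont_comp_snd (w : 'rV[R]_n -> R) (p : R * 'rV[R]_n) : continuous w ->
  {for p, continuous (fun p => w p.2)}.
Proof.
move=> cw; apply: (@cont_comp _ _ _ _ (fun p : R * 'rV[R]_n => p.2) w); last exact: cw.
exact: cont_snd.
Qed.

Lemma cont_graph_family g q (p : R * 'rV[R]_n) : C1 setT g -> C1 setT q ->
  {for p, continuous (fun p => (p.2, graph_family g q p.1 p.2))}.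
Proof.
move=> cg cq; apply: cont_pair; first exact: cont_snd.
rewrite /graph_family; apply: contD; first by apply: cont_comp_snd; exact: C1_setT_continuous.
apply: contM; first exact: cont_fst.
by apply: cont_comp_snd; exact: C1_setT_continuous.
Qed.

Lemma near_graph_family g q U (s : R) x : C1 setT g -> C1 setT q -> open U ->
  U (x, graph_family g q s x) ->
  \forall p \near (s, x), U (p.2, graph_family g q p.1 p.2).
Proof.
move=> cg cq oU Ux; have := @cont_graph_family g q (s, x) cg cq; apply.
exact: open_nbhs_nbhs.
Qed.

Lemma near_cube (P : R -> 'rV[R]_n -> Prop) (s0 : R) :
  (forall x, cube x -> \forall p \near (s0, x), P p.1 p.2) ->
  \forall s \near s0, forall x, cube x -> P s x.
Proof.
move=> H; have /compact_near_coveringP K := @compact_cube R n.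
apply: (K _ (nbhs s0) (fun s x => P s x)) => x cx.
have [[A B] /= [As Bx] AB] := H x cx.
by exists (B, A) => //= -[y s] /= [By As']; exact: (AB (s, y)).
Qed.

Lemma derive_graph_family g q (s : R) x v : C1 setT g -> C1 setT q ->
  'D_v (graph_family g q s) x = 'D_v g x + s * 'D_v q x.
Proof.
move=> cg cq; have cZ := @C1Z R _ setT q s openT cq.
by rewrite (derive_add (U := setT) v cg cZ I) (derive_scale s v cq I).
Qed.

Lemma C1_graph_family g q (s : R) : C1 setT g -> C1 setT q -> C1 setT (graph_family g q s).
Proof. by move=> cg cq; exact: (C1D openT cg (@C1Z R _ setT q s openT cq)). Qed.

Lemma is_derive_affine (a b s : R) : is_derive s 1 (fun r : R => a + r * b) b.
Proof.
have := @is_derive_line R R^o (fun z : R => z) a b s (@derivable_id _ _ _ _).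
by rewrite (@derive_id _ R^o).
Qed.

Lemma is_derive_bigsum (I : finType) (h : I -> R -> R) (dh : I -> R) (s : R) :
  (forall i, is_derive s 1 (h i) (dh i)) ->
  is_derive s 1 (fun r => \sum_i h i r) (\sum_i dh i).
Proof.
move=> H; elim: (index_enum I) => [|i r IH].
  rewrite big_nil (_ : (fun r => _) = cst 0); last by apply/funext => r; rewrite big_nil.
  exact: is_derive_cst.
rewrite big_cons (_ : (fun _ => _) = h i + (fun s => \sum_(j <- r) h j s)).
  exact: is_deriveD.
by apply/funext => z; rewrite big_cons.
Qed.

Lemma C1_graph U f g : open U -> C1 U f -> C1 setT g -> (forall x, U (x, g x)) ->
  C1 setT (fun x => f (x, g x)).
Proof.
move=> oU cf cg Ug.
have cG (x : 'rV[R]_n) : {for x, continuous (fun x => (x, g x))}.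
  by apply: cont_pair; [exact: cont_id|exact: C1_setT_continuous].
have cfG (w : X -> R) (x : 'rV[R]_n) : {for (x, g x), continuous w} -> {for x, continuous (fun x => w (x, g x))}.
  by move=> cw; apply: (@cont_comp _ _ _ _ (fun x => (x, g x)) w).
have d x v := derive_graph v (cf _ (Ug x)).1 (cg x I).1.
apply: (C1_intro (D := fun v x => 'D_(v, 0) f (x, g x) + 'D_v g x * 'D_dy f (x, g x))).
- exact: openT.
- move=> x _; apply: (@differentiable_comp _ _ _ _ (fun x => (x, g x)) f); last exact: (cf _ (Ug x)).1.
  by apply: differentiable_pair => //; exact: (cg x I).1.
- by move=> x v _; exact: (@derive_val _ _ _ _ _ _ _ (d x v)).
- move=> x v _; apply: contD; first exact: (cfG (fun p => 'D_(v, 0) f p) _ ((cf _ (Ug x)).2 _)).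
  apply: contM; first exact: (cg x I).2.
  exact: (cfG (fun p => 'D_dy f p) _ ((cf _ (Ug x)).2 _)).
Qed.

Lemma torus_int_derive_C1 g i : C1 setT g -> Defs.periodic g ->
  torus_int (fun x => 'D_(e_ i) g x) = 0.
Proof.
move=> cg pg; apply: torus_int_derive_periodic.
- exact: C1_setT_continuous.
- by move=> x; apply: diff_derivable; exact: (cg x I).1.
- exact: C1_setT_derive_continuous.
- by move=> x; exact: pg.
Qed.

(** The flux of the field with horizontal part [F] and vertical part [G]: its product with the
    upward normal [(- grad g, 1)], which already contains the area element. *)
Definition graph_flux (F : 'I_n -> X -> R) (G : X -> R) g :=
  torus_int (fun x => G (x, g x) - \sum_i 'D_(e_ i) g x * F i (x, g x)).

(** The divergence theorem in differential form: moving the graph with vertical speed [q] changes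
    the flux by the integral of the divergence times [q]. No integral over a region is needed. *)
Lemma graph_flux_is_derive U (F : 'I_n -> X -> R) (G : X -> R) g q (s0 : R) :
  open U -> (forall i, C1 U (F i)) -> C1 U G ->
  (forall i, periodic2 (F i)) ->
  C1 setT g -> C1 setT q -> Defs.periodic g -> Defs.periodic q ->
  (forall x, U (x, graph_family g q s0 x)) ->
  is_derive s0 1 (fun s => graph_flux F G (graph_family g q s))
   (torus_int (fun x => (\sum_i 'D_(dx i) (F i) (x, graph_family g q s0 x)
      + 'D_dy G (x, graph_family g q s0 x)) * q x)).
Proof.
move=> oU cF cG pF cg cq pg pq Ug.
pose k s x := G (x, graph_family g q s x) -
  \sum_i ('D_(e_ i) g x + s * 'D_(e_ i) q x) * F i (x, graph_family g q s x).
pose k' s x := q x * 'D_dy G (x, graph_family g q s x) -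
  \sum_i ('D_(e_ i) q x * F i (x, graph_family g q s x) +
    ('D_(e_ i) g x + s * 'D_(e_ i) q x) * (q x * 'D_dy (F i) (x, graph_family g q s x))).
have nearU (x : 'rV[R]_n) : \forall p \near (s0, x), U (p.2, graph_family g q p.1 p.2).
  exact: (near_graph_family cg cq oU (Ug x)).
have cgf (w : X -> R) (p : R * 'rV[R]_n) : {for (p.2, graph_family g q p.1 p.2), continuous w} ->
    {for p, continuous (fun p => w (p.2, graph_family g q p.1 p.2))}.
  by move=> cw; apply: (@cont_comp _ _ _ _ (fun p : R * 'rV[R]_n => (p.2, graph_family g q p.1 p.2)) w) => //; exact: cont_graph_family.
have cD (w : 'rV[R]_n -> R) v : C1 setT w -> continuous (fun x => 'D_v w x).
  exact: C1_setT_derive_continuous.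
have ccoef i (p : R * 'rV[R]_n) : {for p, continuous (fun p : R * 'rV[R]_n => 'D_(e_ i) g p.2 + p.1 * 'D_(e_ i) q p.2)}.
  apply: contD; first exact: (@cont_comp_snd (fun x => 'D_(e_ i) g x) p (cD g (e_ i) cg)).
  by apply: contM; [exact: cont_fst|exact: (@cont_comp_snd (fun x => 'D_(e_ i) q x) p (cD q (e_ i) cq))].
have ck (p : R * 'rV[R]_n) : U (p.2, graph_family g q p.1 p.2) ->
    {for p, continuous (fun p : R * 'rV[R]_n => k p.1 p.2)}.
  move=> Up; apply: contB; first exact: (cgf G p (C1_cont cG Up)).
  apply: cont_sum => i; apply: contM; first exact: ccoef.
  exact: (cgf (F i) p (C1_cont (cF i) Up)).
have ck' (p : R * 'rV[R]_n) : U (p.2, graph_family g q p.1 p.2) ->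
    {for p, continuous (fun p : R * 'rV[R]_n => k' p.1 p.2)}.
  have cq2 := @cont_comp_snd q p (C1_setT_continuous cq).
  move=> Up; apply: contB.
    by apply: contM => //; apply: (cgf (fun p => 'D_dy G p)); have [_] := cG _ Up; exact.
  apply: cont_sum => i; apply: contD; apply: contM.
  - exact: (@cont_comp_snd (fun x => 'D_(e_ i) q x) p (cD q (e_ i) cq)).
  - exact: (cgf (F i) p (C1_cont (cF i) Up)).
  - exact: ccoef.
  - apply: contM => //; apply: (cgf (fun p => 'D_dy (F i) p)).
    by have [_] := cF i _ Up; exact.
have cslice s (w : R -> 'rV[R]_n -> R) x : {for (s, x), continuous (fun p => w p.1 p.2)} -> {for x, continuous (w s)}.
  move=> cw; apply: (@cont_comp _ _ _ _ (fun x => (s, x)) (fun p => w p.1 p.2)) => //.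
  by apply: cont_pair; [exact: cont_cst|exact: cont_id].
have kE : (fun s => graph_flux F G (graph_family g q s)) = (fun s => torus_int (k s)).
  apply/funext => s; congr torus_int; apply/funext => x; congr (_ - _).
  by apply: eq_bigr => i _; rewrite derive_graph_family.
have dk : is_derive s0 1 (fun s => torus_int (k s)) (torus_int (k' s0)).
  apply: torus_int_is_derive.
  - move=> x cx; have := nearU x; apply: filterS => -[s y] /= Uy.
    have dG := derive_vertical (cG _ Uy).1.
    have dF i := derive_vertical (cF i _ Uy).1.
    have dterm i : is_derive s 1
        (fun s => ('D_(e_ i) g y + s * 'D_(e_ i) q y) * F i (y, graph_family g q s y))
        ('D_(e_ i) q y * F i (y, graph_family g q s y) +
          ('D_(e_ i) g y + s * 'D_(e_ i) q y) * (q y * 'D_dy (F i) (y, graph_family g q s y))).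
      apply: (is_derive_eq (is_deriveM (is_derive_affine _ _ s) (dF i))).
      by rewrite addrC; congr (_ + _); exact: mulrC.
    exact: (is_deriveB dG (is_derive_bigsum dterm)).
  - have := @near_cube (fun s x => U (x, graph_family g q s x)) s0 (fun x _ => nearU x); apply: filterS => s Us x cx.
    by apply: cslice; apply: ck => /=; exact: Us.
  - by move=> x cx; apply: ck'; exact: Ug.
rewrite kE; apply: (is_derive_eq dk).
have cgs := C1_graph_family s0 cg cq.
have cFg i := C1_graph oU (cF i) cgs Ug.
(* The horizontal divergence of [q F] along the graph has zero integral by periodicity; added to
   [k' s0], it cancels every derivative of [g] and [q] and leaves the divergence of the field times
   [q]. *)
pose P i x := q x * F i (x, graph_family g q s0 x).
have cP i : C1 setT (P i) by exact: C1M openT cq (cFg i).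
have pP i : Defs.periodic (P i).
  by move=> j x; rewrite /P /graph_family pg pq pF.
have DP i x : 'D_(e_ i) (P i) x = q x * ('D_(dx i) (F i) (x, graph_family g q s0 x) +
    ('D_(e_ i) g x + s0 * 'D_(e_ i) q x) * 'D_dy (F i) (x, graph_family g q s0 x)) +
    F i (x, graph_family g q s0 x) * 'D_(e_ i) q x.
  rewrite (derive_mul (e_ i) cq (cFg i) I); congr (_ * _ + _).
  have := derive_graph (e_ i) (cF i _ (Ug x)).1 (cgs x I).1.
  by move=> /(@derive_val _ _ _ _ _ _ _) ->; rewrite derive_graph_family.
have cDP i : cube_continuous (fun x => 'D_(e_ i) (P i) x).
  exact: (continuous_cube (@C1_setT_derive_continuous _ (P i) (e_ i) (cP i))).
have ck'0 : cube_continuous (k' s0) by move=> x cx; apply: cslice; exact: ck'.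
have -> : torus_int (k' s0) = torus_int (fun x => k' s0 x + \sum_i 'D_(e_ i) (P i) x).
  have cS := @cube_continuous_sum R n _ (fun i x => 'D_(e_ i) (P i) x) cDP.
  have E : torus_int (fun x => \sum_i 'D_(e_ i) (P i) x) = 0.
    apply: etrans (@torus_int_sum R n _ (fun i x => 'D_(e_ i) (P i) x) cDP) _.
    by apply: big1 => i _; exact: (torus_int_derive_C1 _ (cP i) (pP i)).
  apply/esym; apply: etrans (torus_intD ck'0 cS) _.
  by rewrite -[RHS]addr0; congr (_ + _); exact: E.
congr torus_int; apply/funext => x; rewrite /k' -addrA -sumrN -big_split /=.
rewrite mulrDl addrC mulr_suml; congr (_ + _); last exact: mulrC.
by apply: eq_bigr => i _; rewrite DP; ring.
Qed.

End GraphFlux.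

(** * A cutoff function of class C^1 *)

Section Cutoff.
Variable R : realType.
Implicit Types (f df : R -> R) (r : R).

(** A quadratic error bound yields the derivative even where the formula for [f] changes, as it does
    for [pos_sq] at [0]. *)
Lemma is_derive_quadratic f r d C :
  (forall h, `|f (r + h) - f r - d * h| <= C * h ^+ 2) -> is_derive r 1 f d.
Proof.
move=> H.
have C0 : 0 <= C by have H1 := H 1; rewrite expr1n !mulr1 in H1; exact: le_trans (normr_ge0 _) H1.
have L : h^-1 *: (f (h *: 1 + r) - f r) @[h --> 0^'] --> d.
  apply/cvgrPdist_le => e e0.
  have C1 : 0 < C + 1 by rewrite ltr_wpDl.
  exists (e / (C + 1)) => /=; first by rewrite divr_gt0.
  move=> h /=; rewrite sub0r normrN => he h0.
  have hn0 : 0 < `|h| by rewrite normr_gt0.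
  rewrite [h *: 1]mulr1 [h + r]addrC; have := H h.
  rewrite (_ : d - h^-1 *: (f (r + h) - f r) = - (h^-1 * (f (r + h) - f r - d * h))); last first.
    by rewrite /GRing.scale /=; field.
  rewrite normrN normrM normfV => H'.
  rewrite ler_pdivrMl//; apply: le_trans H' _.
  rewrite -(ger0_norm (sqr_ge0 h)) normrX expr2 mulrA mulrC ler_wpM2l ?(ltW hn0)//.
  move: he; rewrite ltr_pdivlMr// => he.
  by apply: ltW; apply: le_lt_trans he; rewrite mulrC ler_wpM2l// lerDl.
apply: DeriveDef; first by apply/cvg_ex; exists d.
exact: cvg_lim L.
Qed.

Lemma C1_of_is_derive f df : (forall r, is_derive r 1 f (df r)) -> continuous df ->
  @C1 R R^o setT f.
Proof.
move=> dfd cdf.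
have dif r : differentiable (f : R^o -> R^o) r by apply/derivable1_diffP; have := dfd r.
apply: (C1_intro (D := fun v r => v * df r)) => //.
- exact: openT.
- move=> r v _; have := @deriveZl R R^o f r v 1 (dif r).
  by rewrite [v *: 1]mulr1 => ->; rewrite (@derive_val _ _ _ _ _ _ _ (dfd r)).
- by move=> r v _; apply: contM; [exact: cont_cst|exact: cdf].
Qed.

Definition pos_sq r : R := (Num.max r 0) ^+ 2.

Lemma is_derive_pos_sq r : is_derive r 1 pos_sq (2 * Num.max r 0).
Proof.
apply: (@is_derive_quadratic _ _ _ 1) => h; rewrite mul1r /pos_sq.
have [r0|r0] := leP r 0; have [rh0|rh0] := leP (r + h) 0.
- by rewrite expr0n /= subrr mulr0 mul0r subrr normr0 sqr_ge0.
- by rewrite expr0n /= subr0 mulr0 mul0r subr0 ger0_norm ?sqr_ge0//; nra.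
- by rewrite expr0n /= ler_norml; apply/andP; split; nra.
- by rewrite (_ : _ - _ - _ = h ^+ 2) ?ger0_norm ?sqr_ge0//; ring.
Qed.

(** Chosen to be of class C^1, nondecreasing, zero exactly on the nonpositive half-line, and bounded
    by 1. The bound is what lets its fluxes decay under a finite energy. *)
Definition cutoff r : R := 1 - (1 + pos_sq r)^-1.

Lemma pos_sq_ge0 r : 0 <= pos_sq r. Proof. exact: sqr_ge0. Qed.

Lemma is_derive_cutoff r :
  is_derive r 1 cutoff (2 * Num.max r 0 * ((1 + pos_sq r) ^+ 2)^-1).
Proof.
have n0 : 1 + pos_sq r != 0 by rewrite gt_eqF// ltr_wpDr// pos_sq_ge0.
have d1 : is_derive r 1 (cst 1 + pos_sq) (0 + 2 * Num.max r 0).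
  by apply: is_deriveD; exact: is_derive_pos_sq.
have dd1 : derivable (cst 1 + pos_sq) r 1 by exact: (@ex_derive _ _ _ _ _ _ _ d1).
have d2 : is_derive r 1 (fun y => (1 + pos_sq y)^-1) (- (1 + pos_sq r) ^- 2 *: (2 * Num.max r 0)).
  apply: DeriveDef; first exact: (@derivableV _ _ (cst 1 + pos_sq) r 1 n0 dd1).
  apply: etrans (@deriveV _ _ (cst 1 + pos_sq) r 1 n0 dd1) _.
  by rewrite (@derive_val _ _ _ _ _ _ _ d1) add0r.
apply: (is_derive_eq (is_deriveB (is_derive_cst (1 : R) r 1) d2)).
by rewrite sub0r /GRing.scale /= mulNr opprK mulrC.
Qed.

Lemma continuous_max0 : continuous (fun r : R => Num.max r 0).
Proof. by move=> r; apply: continuous_max; [exact: cvg_id|exact: cst_continuous]. Qed.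

Lemma continuous_pos_sq : continuous pos_sq.
Proof.
by move=> r; apply/differentiable_continuous/derivable1_diffP; have := is_derive_pos_sq r.
Qed.

Lemma C1_cutoff : @C1 R R^o setT cutoff.
Proof.
apply: (C1_of_is_derive is_derive_cutoff) => r.
have n0 : 1 + pos_sq r != 0 by rewrite gt_eqF// ltr_wpDr// pos_sq_ge0.
apply: (@contM _ _ r (fun r => 2 * Num.max r 0) (fun r => ((1 + pos_sq r) ^+ 2)^-1)).
  by apply: contM; [exact: cont_cst|exact: continuous_max0].
apply: (@continuousV _ _ (fun r => (1 + pos_sq r) ^+ 2)); first by rewrite expf_eq0.
have c1 : {for r, continuous (fun r => 1 + pos_sq r)}.
  by apply: contD; [exact: cont_cst|exact: continuous_pos_sq].
exact: (@contM _ _ r _ _ c1 c1).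
Qed.

Lemma cutoff_derive_ge0 r : 0 <= 'D_1 cutoff r.
Proof.
rewrite (@derive_val _ _ _ _ _ _ _ (is_derive_cutoff r)) mulr_ge0//.
  by rewrite mulr_ge0// le_max lexx orbT.
by rewrite invr_ge0 sqr_ge0.
Qed.

Lemma cutoff_npos r : r <= 0 -> cutoff r = 0.
Proof. by move=> r0; rewrite /cutoff /pos_sq max_r// expr0n addr0 invr1 subrr. Qed.

Lemma cutoff_pos r : 0 < r -> 0 < cutoff r.
Proof.
move=> r0; rewrite /cutoff /pos_sq max_l ?(ltW r0)// subr_gt0.
have r2 : 0 < r ^+ 2 by rewrite exprn_gt0.
by rewrite invf_lt1 ?ltrDl// (lt_trans r2)// ltrDr.
Qed.

Lemma cutoff_ge0 r : 0 <= cutoff r.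
Proof. by have [/cutoff_npos ->//|/cutoff_pos/ltW] := leP r 0. Qed.

Lemma cutoff_le1 r : cutoff r <= 1.
Proof. by rewrite gerDl oppr_le0 invr_ge0 addr_ge0// pos_sq_ge0. Qed.

End Cutoff.

(** * Fluxes of weighted gradients and the maximum principle *)

Section Flux.
Variables (R : realType) (n : nat).
Local Notation X := ('rV[R]_n * R)%type.
Local Notation e_ := (e_ R).
Local Notation dx := (dx R).
Local Notation dy := (dy R n).
Implicit Types (a w : X -> R) (g q : 'rV[R]_n -> R) (U : set X).

Definition grad_dot a w (p : X) : R :=
  \sum_i 'D_(dx i) a p * 'D_(dx i) w p + 'D_dy a p * 'D_dy w p.

Lemma grad_dotE w p : grad_dot w w p = grad_sq w p.
Proof. by rewrite /grad_dot /grad_sq; under eq_bigr do rewrite -expr2; rewrite -expr2. Qed.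

Lemma grad_sq_ge0 w p : 0 <= grad_sq w p.
Proof. by rewrite addr_ge0 ?sqr_ge0// sumr_ge0// => i _; exact: sqr_ge0. Qed.

(** The flux of [a grad w] through the graph of [g]. Here [DtN g w] is only the normal component of
    [grad w] on that graph, which may lie strictly inside the domain of [w]. *)
Definition flux a w g := torus_int (fun x => a (x, g x) * DtN g w x).

(** As [w] is harmonic, the divergence of [a grad w] reduces to [grad a . grad w]. *)
Lemma flux_is_derive U a w g q (s0 : R) : open U -> C1 U a ->
  (forall v, C1 U (fun p => 'D_v w p)) -> (forall p, U p -> laplacian w p = 0) ->
  periodic2 a -> periodic2 w ->
  C1 setT g -> C1 setT q -> Defs.periodic g -> Defs.periodic q ->
  (forall x, U (x, graph_family g q s0 x)) ->
  is_derive s0 1 (fun s => flux a w (graph_family g q s))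
    (torus_int (fun x => grad_dot a w (x, graph_family g q s0 x) * q x)).
Proof.
move=> oU ca cw lw pa pw cg cq pg pq Ug.
pose F i p := a p * 'D_(dx i) w p; pose G p := a p * 'D_dy w p.
have cF i : C1 U (F i) by exact: C1M oU ca (cw _).
have cG : C1 U G by exact: C1M oU ca (cw _).
have pF i : periodic2 (F i) by move=> j x y; rewrite /F pa derive_periodic2.
have := graph_flux_is_derive oU cF cG pF cg cq pg pq Ug.
have -> : (fun s => graph_flux F G (graph_family g q s)) = (fun s => flux a w (graph_family g q s)).
  apply/funext => s; congr torus_int; apply/funext => x; rewrite /DtN mulrBr mulr_sumr.
  by congr (_ - _); apply: eq_bigr => i _; rewrite /F mulrCA.
have -> // : (fun x => (\sum_i 'D_(dx i) (F i) (x, graph_family g q s0 x) + 'D_dy G (x, graph_family g q s0 x)) * q x)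
  = (fun x => grad_dot a w (x, graph_family g q s0 x) * q x).
apply/funext => x; congr (_ * _); set p := (x, _).
have Up : U p := Ug x.
have lp := lw p Up; rewrite /laplacian /= in lp.
have -> : 'D_dy G p = a p * 'D_dy (fun p => 'D_dy w p) p + 'D_dy w p * 'D_dy a p.
  exact: (derive_mul dy ca (cw dy) Up).
under eq_bigr do rewrite (derive_mul _ ca (cw _) Up).
rewrite big_split /= -mulr_sumr /grad_dot.
have -> : \sum_i 'D_(dx i) (fun p => 'D_(dx i) w p) p = - 'D_dy (fun p => 'D_dy w p) p.
  by apply/eqP; rewrite -addr_eq0; apply/eqP; exact: lp.
under eq_bigr do rewrite mulrC.
by ring.
Qed.

(** Only first derivatives of [w] enter, so this applies up to the boundary graph, where
    [flux_is_derive] lacks second derivatives. *)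
Lemma flux_continuous U a w g q (s0 : R) : open U ->
  (forall p, U p -> {for p, continuous a}) ->
  (forall p v, U p -> {for p, continuous (fun p => 'D_v w p)}) ->
  C1 setT g -> C1 setT q -> (forall x, U (x, graph_family g q s0 x)) ->
  {for s0, continuous (fun s => flux a w (graph_family g q s))}.
Proof.
move=> oU ca cw cg cq Ug.
have cgf (f : X -> R) (p : R * 'rV[R]_n) : {for (p.2, graph_family g q p.1 p.2), continuous f} ->
    {for p, continuous (fun p : R * 'rV[R]_n => f (p.2, graph_family g q p.1 p.2))}.
  by move=> cf; apply: (@cont_comp _ _ _ _ (fun p : R * 'rV[R]_n => (p.2, graph_family g q p.1 p.2)) f); [exact: cont_graph_family|exact: cf].
pose k (s : R) x := a (x, graph_family g q s x) * ('D_dy w (x, graph_family g q s x) -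
   \sum_i ('D_(e_ i) g x + s * 'D_(e_ i) q x) * 'D_(dx i) w (x, graph_family g q s x)).
have kE s : (fun x => a (x, graph_family g q s x) * DtN (graph_family g q s) w x) = k s.
  apply/funext => x; congr (_ * (_ - _)); apply: eq_bigr => i _; congr (_ * _).
  exact: derive_graph_family.
have ck (p : R * 'rV[R]_n) : U (p.2, graph_family g q p.1 p.2) ->
    {for p, continuous (fun p : R * 'rV[R]_n => k p.1 p.2)}.
  move=> Up; apply: contM; first exact: (cgf a p (ca _ Up)).
  apply: contB; first exact: (cgf (fun p => 'D_dy w p) p (cw _ _ Up)).
  apply: cont_sum => i; apply: contM.
    apply: contD.
      by apply: (@cont_comp_snd R n (fun x => 'D_(e_ i) g x) p); exact: C1_setT_derive_continuous.
    apply: contM; first exact: cont_fst.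
    by apply: (@cont_comp_snd R n (fun x => 'D_(e_ i) q x) p); exact: C1_setT_derive_continuous.
  exact: (cgf (fun p => 'D_(dx i) w p) p (cw _ _ Up)).
have cslice s x : U (x, graph_family g q s x) -> {for x, continuous (k s)}.
  move=> Ux; apply: (@cont_comp _ _ _ _ (fun x => (s, x)) (fun p : R * 'rV[R]_n => k p.1 p.2)); last exact: ck.
  by apply: cont_pair; [exact: cont_cst|exact: cont_id].
have nearU (x : 'rV[R]_n) : \forall p \near (s0, x), U (p.2, graph_family g q p.1 p.2).
  exact: (near_graph_family cg cq oU (Ug x)).
have E : (fun s => flux a w (graph_family g q s)) = (fun s => torus_int (k s)).
  by apply/funext => s; rewrite /flux kE.
rewrite E; apply: torus_int_cvg.
- have := @near_cube _ _ (fun s x => U (x, graph_family g q s x)) s0 (fun x _ => nearU x).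
  by apply: filterS => s Us x cx; apply: cslice; exact: Us.
- by move=> x cx; exact: cslice.
- by move=> x cx; exact: (ck (s0, x) (Ug x)).
Qed.

Lemma cube_continuous_flux U a w g : open U ->
  (forall p, U p -> {for p, continuous a}) ->
  (forall p v, U p -> {for p, continuous (fun p => 'D_v w p)}) ->
  C1 setT g -> (forall x, U (x, g x)) ->
  cube_continuous (fun x => a (x, g x) * DtN g w x).
Proof.
move=> oU ca cw cg Ug x cx.
have cgf (f : X -> R) : {for (x, g x), continuous f} -> {for x, continuous (fun x => f (x, g x))}.
  move=> cf; apply: (@cont_comp _ _ _ _ (fun x => (x, g x)) f); last exact: cf.
  by apply: cont_pair; [exact: cont_id|exact: C1_setT_continuous].
apply: contM; first exact: (cgf a (ca _ (Ug x))).
apply: contB; first exact: (cgf (fun p => 'D_dy w p) (cw _ _ (Ug x))).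
apply: cont_sum => i; apply: contM; first exact: C1_setT_derive_continuous.
exact: (cgf (fun p => 'D_(dx i) w p) (cw _ _ (Ug x))).
Qed.

(** What remains of [harmonic_ext] without boundary values and energy. Unlike the latter it contains
    [y] and the constants, and it is stable under lowering the graph, linear combinations and
    vertical shifts. *)
Definition harmonic_below g w :=
  [/\ periodic2 w, exists U, [/\ open U, Omega_closure g `<=` U & C1 U w],
      forall v, C1 (Omega g) (fun p => 'D_v w p) &
      forall p, Omega g p -> laplacian w p = 0].

Definition level g (z : R) : 'rV[R]_n -> R := graph_family g (fun=> 1) z.

Lemma levelE g z x : level g z x = g x + z.
Proof. by rewrite /level /graph_family mulr1. Qed.

Lemma open_Omega g : continuous g -> open (Omega g).
Proof.
move=> cg; pose d (p : X) := g p.1 - p.2.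
have cd : continuous d.
  move=> p; apply: (@contB _ _ p (fun p => g p.1) (fun p => p.2)); last exact: cont_snd.
  by apply: (@cont_comp _ _ _ _ (fun p => p.1) g); [exact: cont_fst|exact: cg].
rewrite (_ : Omega g = d @^-1` [set r | 0 < r]); last first.
  by apply/seteqP; split => p /=; rewrite /Omega /d /= subr_gt0.
by apply: open_comp => //; exact: open_gt.
Qed.

Lemma C1_1 : @C1 R 'rV[R]_n setT (fun=> 1).
Proof. exact: C1_cst. Qed.

Lemma periodic1 : Defs.periodic (fun _ : 'rV[R]_n => 1 : R).
Proof. by []. Qed.

Lemma flux_level_is_derive a w g (z : R) : C1 setT g -> Defs.periodic g ->
  C1 (Omega g) a -> periodic2 a -> harmonic_below g w -> z < 0 ->
  is_derive z 1 (fun z => flux a w (level g z))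
    (torus_int (fun x => grad_dot a w (x, level g z x))).
Proof.
move=> cg pg ca pa [pw _ cw lw] z0.
have oO := open_Omega (C1_setT_continuous cg).
have Ug x : Omega g (x, level g z x) by rewrite /Omega /= levelE gtrDl.
have := flux_is_derive oO ca cw lw pa pw cg C1_1 pg periodic1 Ug.
by under [X in torus_int X]eq_fun do rewrite mulr1.
Qed.

Lemma nondecreasing_npos (f df : R -> R) :
  (forall z : R, z < 0 -> is_derive z 1 f (df z)) -> (forall z, z < 0 -> 0 <= df z) ->
  {for 0, continuous f} -> forall y z, y <= z -> z <= 0 -> f y <= f z.
Proof.
move=> fdf df0 cf y z; rewrite le_eqVlt => /predU1P[->//|yz] z0.
have [||c] := @MVT R f df y z yz.
- by move=> t; rewrite in_itv /= => /andP[_ tz]; apply: fdf; exact: lt_le_trans z0.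
- apply: continuous_within_segment => t /andP[_ tz].
  have := le_trans tz z0; rewrite le_eqVlt => /predU1P[->//|t0].
  by have := fdf t t0 => ?; apply/differentiable_continuous/derivable1_diffP.
rewrite in_itv /= => /andP[_ cz] E.
by rewrite -subr_ge0 E mulr_ge0 ?subr_ge0 ?(ltW yz)//; apply: df0; exact: lt_le_trans z0.
Qed.

Lemma harmonic_below_cont g w x : C1 setT g -> harmonic_below g w ->
  {for (x, g x), continuous w} /\ forall v, {for (x, g x), continuous (fun p => 'D_v w p)}.
Proof.
move=> cg [_ [U [oU gU cU]] _ _].
have Ux : U (x, g x) by apply: gU; rewrite /Omega_closure /=.
by split; [exact: C1_cont cU Ux|exact: (cU _ Ux).2].
Qed.

Lemma flux_level_continuous0 a w g U : C1 setT g -> harmonic_below g w ->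
  open U -> Omega_closure g `<=` U -> (forall p, U p -> {for p, continuous a}) ->
  {for 0, continuous (fun z => flux a w (level g z))}.
Proof.
move=> cg [_ [U' [oU' gU' cU']] _ _] oU gU ca.
apply: (@flux_continuous (U `&` U')).
- exact: openI.
- by move=> p [/ca].
- by move=> p v [_ Up]; exact: (cU' _ Up).2.
- exact: cg.
- exact: C1_1.
- move=> x; have H : Omega_closure g (x, level g 0 x) by rewrite /Omega_closure /= levelE addr0.
  by split; [exact: gU|exact: gU'].
Qed.

Lemma is_derive_y (f : X -> R) x (t : R) : derivable f (x, t) dy ->
  is_derive t 1 (fun t => f (x, t)) ('D_dy f (x, t)).
Proof.
have E (s : R) : (x, s) = (x, 0) + s *: dy :> X.
  by apply/pair_equal_spec; split => /=; rewrite ?scaler0 ?addr0// add0r [_ *: _]mulr1.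
have -> : (fun t => f (x, t)) = (fun t => f ((x, 0) + t *: dy)).
  by apply/funext => s; rewrite -E.
by rewrite (E t); exact: is_derive_line.
Qed.

Lemma cont_vertical (f : X -> R) x (t : R) : {for (x, t), continuous f} ->
  {for t, continuous (fun t => f (x, t))}.
Proof.
move=> cf; apply: (@cont_comp _ _ _ _ (fun t : R => (x, t)) f); last exact: cf.
by apply: cont_pair; [exact: cont_cst|exact: cont_id].
Qed.

Lemma level0 g : level g 0 = g.
Proof. by apply/funext => x; rewrite levelE addr0. Qed.

Lemma harmonic_below_C1 g w : C1 setT g -> harmonic_below g w -> C1 (Omega g) w.
Proof.
move=> cg [_ [U [oU gU cU]] _ _]; apply: C1_subset cU.
by move=> p Op; apply: gU; exact: ltW.
Qed.

(* The flux of [cutoff (w) grad w] through the level sets is nondecreasing, so it vanishes; this kills [cutoff' (w) grad w]. *)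
Lemma maximum_principle g w : C1 setT g -> Defs.periodic g -> harmonic_below g w ->
  (forall x, cube x -> w (x, g x) <= 0) ->
  (forall e L, 0 < e -> exists2 z, z < L & `|flux (fun p => cutoff (w p)) w (level g z)| <= e) ->
  forall x y, cube x -> y <= g x -> w (x, y) <= 0.
Proof.
move=> cg pg hw w0 decay.
pose a (p : X) := cutoff (w p).
have cw := harmonic_below_C1 cg hw.
have [pw [U [oU gU cU]] cDw lw] := hw.
have oO := open_Omega (C1_setT_continuous cg).
have [ca Da] := C1_comp oO (@C1_cutoff R) cw.
have [caU _] := C1_comp oU (@C1_cutoff R) cU.
have pa : periodic2 a by move=> i x y; rewrite /a pw.
pose Fl z := flux a w (level g z).
pose dFl z := torus_int (fun x => grad_dot a w (x, level g z x)).
have Lev z x : z < 0 -> Omega g (x, level g z x) by move=> z0; rewrite /Omega /= levelE gtrDl.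
have gdE p : Omega g p -> grad_dot a w p = 'D_1 (@cutoff R) (w p) * grad_sq w p.
  move=> Op; rewrite -grad_dotE /grad_dot mulrDr mulr_sumr; congr (_ + _).
    by apply: eq_bigr => i _; rewrite Da// mulrA.
  by rewrite Da// mulrA.
have gd0 p : Omega g p -> 0 <= grad_dot a w p.
  by move=> Op; rewrite gdE// mulr_ge0 ?cutoff_derive_ge0 ?grad_sq_ge0.
have cgd z : z < 0 -> cube_continuous (fun x => grad_dot a w (x, level g z x)).
  move=> z0 x cx; apply: (@cont_comp _ _ _ _ (fun x => (x, level g z x)) (grad_dot a w)).
    apply: cont_pair; first exact: cont_id.
    exact: (C1_setT_continuous (C1_graph_family z cg C1_1)).
  have Op := Lev z x z0.
  apply: contD; last by apply: contM; [exact: (ca _ Op).2|exact: (C1_cont (cDw dy) Op)].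
  by apply: cont_sum => i; apply: contM; [exact: (ca _ Op).2|exact: (C1_cont (cDw (dx i)) Op)].
have dF (z : R) : z < 0 -> is_derive z 1 Fl (dFl z) by exact: flux_level_is_derive.
have dF0 z : z < 0 -> 0 <= dFl z.
  by move=> z0; apply: torus_int_ge0 => [|x cx]; [exact: cgd|apply: gd0; exact: Lev].
have cF0 : {for 0, continuous Fl}.
  by apply: (flux_level_continuous0 cg hw oU gU) => p Up; exact: C1_cont caU Up.
have mono := nondecreasing_npos dF dF0 cF0.
have F00 : Fl 0 = 0.
  rewrite /Fl level0 /flux -[RHS](torus_int_cst n); apply: eq_torus_int => x cx.
  by rewrite /a cutoff_npos ?mul0r//; exact: w0.
(* From above, [Fl z <= Fl 0 = 0]; from below, [Fl z] dominates the values at deeper levels, some of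
   which are arbitrarily close to zero. *)
have Fz z : z < 0 -> Fl z = 0.
  move=> z0; apply/eqP; rewrite eq_le -[X in _ <= X]F00 mono ?(ltW z0)//=.
  apply/ler_addgt0Pl => e e0; have [y yz Fy] := decay e z e0.
  have := mono y z (ltW yz) (ltW z0); move: Fy; rewrite -/(Fl y) ler_norml => /andP[H _].
  by move=> H2; rewrite -lerBlDl sub0r; exact: le_trans H H2.
have dFz z : z < 0 -> dFl z = 0.
  move=> z0; rewrite -(@derive_val _ _ _ _ _ _ _ (dF z z0)) -(derive_cst (0 : R) z 1).
  apply: near_eq_derive; have := lt_nbhsl z0; apply: filterS => t t0; exact: Fz.
(* Every point below the graph lies on a level, where a nonnegative continuous integrand has zero
   integral. Thus [cutoff' (w) |grad w|^2 = 0], so [cutoff (w)] is constant along vertical lines and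
   equals its boundary value zero. *)
have key x y : cube x -> y < g x -> 'D_1 (@cutoff R) (w (x, y)) * 'D_dy w (x, y) = 0.
  move=> cx yg; pose z := y - g x; have z0 : z < 0 by rewrite subr_lt0.
  have yE : level g z x = y by rewrite levelE /z addrC subrK.
  have := torus_int_eq0 (cgd z z0) (fun x _ => gd0 _ (Lev z x z0)) (dFz z z0) cx.
  rewrite yE gdE// => /eqP; rewrite mulf_eq0 => /orP[/eqP ->|]; first by rewrite mul0r.
  rewrite /grad_sq paddr_eq0 ?sqr_ge0//; last by rewrite sumr_ge0// => i _; exact: sqr_ge0.
  by rewrite sqrf_eq0 => /andP[_ /eqP ->]; rewrite mulr0.
move=> x y cx; rewrite le_eqVlt => /predU1P[->|yg]; first exact: w0.
rewrite leNgt; apply/negP => /cutoff_pos; suff -> : cutoff (w (x, y)) = 0 by rewrite ltxx.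
have [||c _ E] := @MVT R (fun t => cutoff (w (x, t))) (fun=> 0) y (g x) yg.
- move=> t; rewrite in_itv /= => /andP[_ tg].
  have Op : Omega g (x, t) by rewrite /Omega.
  have da : derivable a (x, t) dy by apply: diff_derivable; exact: (ca _ Op).1.
  have D0 : 'D_dy a (x, t) = 0 by rewrite (Da (x, t) dy Op); exact: key.
  exact: (is_derive_eq (is_derive_y da) D0).
- apply: continuous_within_segment => t /andP[_ tg].
  by apply: (@cont_vertical a); apply: (C1_cont caU); apply: gU.
have E0 : cutoff (w (x, g x)) = 0 by rewrite cutoff_npos// w0.
by move: E; rewrite E0 mul0r sub0r => /eqP; rewrite oppr_eq0 => /eqP.
Qed.

End Flux.

(** * Harmonic functions below a graph *)

Section HarmonicClosure.
Variables (R : realType) (n : nat).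
Local Notation X := ('rV[R]_n * R)%type.
Local Notation e_ := (e_ R).
Local Notation dx := (dx R).
Local Notation dy := (dy R n).
Implicit Types (a w : X -> R) (g q : 'rV[R]_n -> R) (U : set X).

Lemma C1_eq_on (V : normedModType R) (U : set V) (f g : V -> R) : open U ->
  (forall p, U p -> f p = g p) -> C1 U f -> C1 U g.
Proof.
move=> oU fg cf.
have nfg p : U p -> {near p, f =1 g}.
  by move=> Up; have := open_nbhs_nbhs (conj oU Up); apply: filterS => q Uq; exact: fg.
have Dfg p v : U p -> 'D_v g p = 'D_v f p.
  by move=> Up; apply/esym/near_eq_derive; exact: nfg.
apply: (C1_intro (D := fun v p => 'D_v f p)) => //.
- move=> p Up; have [df _] := cf p Up.
  have cdf : continuous ('d f p) by exact: diff_continuous.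
  have LE : g \o shift p = cst (g p) + 'd f p +o_ 0 id.
    have /diff_locally/eqaddoP H := df.
    apply/eqaddoP => e e0; have := H e e0.
    have /nbhs_ballP[r /= r0 rH] := nfg p Up.
    apply: filter_app; apply/nbhs_ballP; exists r => //= h; rewrite -ball_normE /ball_ /= sub0r normrN => hr.
    rewrite -(nbhs_singleton (nfg p Up)) !fctE /= /shift /= rH//.
    by rewrite -ball_normE /ball_ /= opprD addrCA subrr addr0 normrN.
  by apply/diff_locallyP; rewrite (diff_unique cdf LE).
- by move=> p v Up; exact: (cf p Up).2.
Qed.

Lemma C1_shift (V : normedModType R) (U : set V) (f : V -> R) (u : V) : C1 U f ->
  C1 [set p | U (p + u)] (fun p => f (p + u)).
Proof.
move=> cf p /= Up; have [df cD] := cf _ Up.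
have sh : differentiable (fun p : V => p + u) p by apply: differentiableD.
split; first by apply: (@differentiable_comp _ _ _ _ (fun p => p + u) f).
move=> v; have -> : (fun z => 'D_v (fun p => f (p + u)) z) = (fun z => 'D_v f (z + u)).
  by apply/funext => z; apply: eq_derive_reparam => h; rewrite addrA.
apply: (@cont_comp _ _ _ _ (fun p => p + u) (fun z => 'D_v f z)); last exact: cD.
exact: differentiable_continuous.
Qed.

Lemma near_eq_derive_on (V : normedModType R) (U : set V) (f g : V -> R) p v : open U ->
  (forall p, U p -> f p = g p) -> U p -> 'D_v f p = 'D_v g p.
Proof.
move=> oU fg Up; apply: near_eq_derive.
by have := open_nbhs_nbhs (conj oU Up); apply: filterS => z; exact: fg.
Qed.

Lemma harmonic_below_sub g g' w : (forall x, g' x <= g x) ->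
  harmonic_below g w -> harmonic_below g' w.
Proof.
move=> gg [pw [U [oU gU cU]] cw lw]; split => //.
- by exists U; split => // p /= pg; apply: gU; exact: le_trans (gg _).
- by move=> v; apply: C1_subset (cw v) => p /= pg; exact: lt_le_trans (gg _).
- by move=> p pg; apply: lw; exact: lt_le_trans (gg _).
Qed.

Lemma harmonic_below_lin g w1 w2 (c : R) : C1 setT g ->
  harmonic_below g w1 -> harmonic_below g w2 ->
  harmonic_below g (fun p => w1 p + c * w2 p) /\
  forall p v, Omega_closure g p ->
    'D_v (fun p => w1 p + c * w2 p) p = 'D_v w1 p + c * 'D_v w2 p.
Proof.
move=> cg hw1 hw2.
have [p1 [U1 [oU1 gU1 cU1]] cw1 lw1] := hw1.
have [p2 [U2 [oU2 gU2 cU2]] cw2 lw2] := hw2.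
have oO := open_Omega (C1_setT_continuous cg).
pose U := U1 `&` U2; have oU : open U by exact: openI.
have c1 : C1 U w1 by apply: C1_subset cU1 => p [].
have c2 : C1 U w2 by apply: C1_subset cU2 => p [].
have c2' : C1 U (fun p => c * w2 p) by exact: C1Z.
have gU : Omega_closure g `<=` U by move=> p pg; split; [exact: gU1|exact: gU2].
have OU : Omega g `<=` U by move=> p pg; apply: gU; exact: ltW.
have D p v : U p -> 'D_v (fun p => w1 p + c * w2 p) p = 'D_v w1 p + c * 'D_v w2 p.
  by move=> Up; rewrite (derive_add v c1 c2' Up) (derive_scale c v c2 Up).
split; last by move=> p v pg; apply: D; exact: gU.
have D' p v : Omega g p -> 'D_v w1 p + c * 'D_v w2 p = 'D_v (fun p => w1 p + c * w2 p) p.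
  by move=> /OU Up; rewrite D.
split.
- by move=> i x y; rewrite p1 p2.
- exists U; split; [exact: oU|exact: gU|exact: (C1D oU c1 c2')].
- move=> v; apply: (C1_eq_on oO (D'^~ v)).
  by apply: C1D => //; apply: C1Z.
- move=> p Op; have l1 := lw1 p Op; have l2 := lw2 p Op.
  have DD v : 'D_v (fun p => 'D_v (fun p => w1 p + c * w2 p) p) p =
      'D_v (fun p => 'D_v w1 p) p + c * 'D_v (fun p => 'D_v w2 p) p.
    rewrite -(near_eq_derive_on v oO (D'^~ v) Op).
    rewrite (derive_add v (cw1 v) (C1Z c oO (cw2 v)) Op).
    by rewrite (derive_scale c v (cw2 v) Op).
  have E (A B C D0 : R) : A + B = 0 -> C + D0 = 0 -> A + c * C + (B + c * D0) = 0.
    by move=> h1 h2; rewrite addrACA -mulrDr h1 h2 mulr0 addr0.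
  rewrite /laplacian /= in l1 l2 *; rewrite DD.
  under eq_bigr do rewrite DD.
  rewrite big_split /= -mulr_sumr; exact: E l1 l2.
Qed.

Lemma derive_cst_fun (V : normedModType R) (c : R) (v : V) :
  (fun p : V => 'D_v (fun=> c) p) = fun=> 0.
Proof. by apply/funext => z; exact: derive_cst. Qed.

Lemma harmonic_below_cst g (c : R) : harmonic_below g (fun=> c).
Proof.
split.
- by [].
- by exists setT; split => //; [exact: openT|exact: C1_cst].
- by move=> v; rewrite derive_cst_fun; exact: C1_cst.
- move=> p _; rewrite /laplacian /= derive_cst_fun derive_cst addr0 big1// => i _.
  exact: derive_cst.
Qed.

Lemma derive_snd v : (fun p : X => 'D_v (fun p : X => p.2) p) = fun=> v.2.
Proof.
apply/funext => p.
rewrite (@eq_derive_reparam R _ R^o (fun p : X => p.2) (fun r => r) p v p.2 v.2) ?derive_id//.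
Qed.

Lemma differentiable_snd (p : X) : differentiable (fun p : X => p.2) p.
Proof.
have L : linear (fun p : X => p.2 : R^o) by [].
pose LM := GRing.isLinear.Build _ _ _ _ (fun p : X => p.2 : R^o) L.
pose LP : {linear X -> R^o} := HB.pack (fun p : X => p.2 : R^o) LM.
by apply: (@linear_differentiable _ _ _ LP) => z; exact: cont_snd.
Qed.

(** The height [y] has infinite energy, hence is no harmonic extension in the variational sense; it
    is the comparison function for the bound [d_y phi <= 1]. *)
Lemma harmonic_below_y g : harmonic_below g (fun p => p.2).
Proof.
split.
- by [].
- exists setT; split => //; first exact: openT.
  move=> p _; split; first exact: differentiable_snd.
  by move=> v; rewrite derive_snd; exact: cont_cst.
- by move=> v; rewrite derive_snd; exact: C1_cst.
- move=> p _.
  have H v : 'D_v (fun p => 'D_v (fun p : X => p.2) p) p = 0.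
    by rewrite (derive_snd v); exact: derive_cst.
  rewrite /laplacian /= (H dy) addr0; apply: big1 => i _; exact: (H (dx i)).
Qed.

Definition vshift (c : R) w : X -> R := fun p => w (p + (0, c)).

Lemma vshiftE c w x y : vshift c w (x, y) = w (x, y + c).
Proof. by rewrite /vshift; congr w; apply/pair_equal_spec; split => //=; rewrite addr0. Qed.

Lemma derive_vshift c w v : (fun p => 'D_v (vshift c w) p) = vshift c (fun p => 'D_v w p).
Proof. by apply/funext => p; apply: eq_derive_reparam => h; rewrite /vshift addrA. Qed.

Lemma harmonic_below_vshift c g w : harmonic_below g w ->
  harmonic_below (fun x => g x - c) (vshift c w).
Proof.
move=> [pw [U [oU gU cU]] cw lw].
have OE p : Omega (fun x => g x - c) p -> Omega g (p + (0, c)).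
  by rewrite /Omega /= addr0 ltrBrDr.
have CE p : Omega_closure (fun x => g x - c) p -> Omega_closure g (p + (0, c)).
  by rewrite /Omega_closure /= addr0 lerBrDr.
split.
- by move=> i x y; rewrite !vshiftE pw.
- exists [set p | U (p + (0, c))]; split.
  + apply: open_comp => // p _; apply: cvgD; [exact: cvg_id|exact: cvg_cst].
  + by move=> p /CE /gU.
  + exact: C1_shift.
- by move=> v; rewrite (derive_vshift c w v); apply: C1_subset OE _; exact: C1_shift.
- move=> p /OE /lw H.
  have DD v : 'D_v (fun p => 'D_v (vshift c w) p) p = 'D_v (fun p => 'D_v w p) (p + (0, c)).
    by rewrite (derive_vshift c w v); apply: eq_derive_reparam => h; rewrite /vshift addrA.
  apply: etrans H; apply: (f_equal2 +%R _ (DD dy)).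
  by apply: eq_bigr => i _; exact: (DD (dx i)).
Qed.

End HarmonicClosure.

(** * Deep levels of small energy *)

Section Decay.
Variables (R : realType) (n : nat).
Local Notation X := ('rV[R]_n * R)%type.
Local Notation e_ := (e_ R).
Local Notation dx := (dx R).
Local Notation dy := (dy R n).
Local Notation mu := (@lebesgue_measure R).
Implicit Types (a w e : X -> R) (g h q : 'rV[R]_n -> R) (U : set X).

(** Subtracting the integer parts of the coordinates leads into the cube. Compactness gives bounds
    there, while one graph must lie below another over the whole space. *)
Lemma periodic_cube (P : 'rV[R]_n -> Prop) :
  (forall i x, P (x + e_ i) <-> P x) -> (forall x, cube x -> P x) -> forall x, P x.
Proof.
move=> Pp Pc x.
have Pn i (k : nat) y : P (y + k%:R *: e_ i) <-> P y.
  elim: k => [|k IH]; first by rewrite scale0r addr0.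
  by rewrite mulrSr scalerDl scale1r addrA Pp.
have Pz i (k : int) y : P (y + k%:~R *: e_ i) <-> P y.
  case: k => k; first by rewrite -pmulrn; exact: Pn.
  rewrite NegzE mulrNz -pmulrn scaleNr.
  by have := Pn i k.+1 (y - k.+1%:R *: e_ i); rewrite subrK => H; split => /H.
have Ps (r : seq 'I_n) (k : 'I_n -> int) y : P (y + \sum_(i <- r) (k i)%:~R *: e_ i) <-> P y.
  elim: r => [|i r IH]; first by rewrite big_nil addr0.
  by rewrite big_cons addrCA addrC Pz.
pose k i := - Num.floor (x 0 i).
rewrite -(Ps (index_enum 'I_n) k); apply: Pc => j.
have -> : (x + \sum_i (k i)%:~R *: e_ i) 0 j = x 0 j + (k j)%:~R.
  rewrite mxE; congr (_ + _); rewrite summxE (bigD1 j)//= !mxE !eqxx mulr1 big1 ?addr0// => i ij.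
  by rewrite !mxE eqxx /= eq_sym (negbTE ij) mulr0.
rewrite /k rmorphN /= subr_ge0 floor_le_tmp /= lerBlDr addrC.
by rewrite ltW// -intrD1 floorD1_gt.
Qed.

Lemma cube_bounded (f : 'rV[R]_n -> R) : cube_continuous f ->
  exists2 M, 0 < M & forall x, cube x -> `|f x| <= M.
Proof.
move=> cf.
have cw : {within @cube R n, continuous f}.
  by apply/continuous_in_subspaceT => x; rewrite inE; exact: cf.
have /compact_bounded[M [_ HM]] := continuous_compact cw (@compact_cube R n).
exists (`|M| + 1); first by rewrite ltr_wpDl.
move=> x cx; apply: HM; last by exists x.
by rewrite (le_lt_trans (ler_norm M))// ltrDl.
Qed.

(** The Cauchy-Schwarz inequality, from the sum of the squares of [B * a i - S * b i]. *)
Lemma sqr_sum_le (I : finType) (a b : I -> R) :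
  (\sum_i a i * b i) ^+ 2 <= (\sum_i a i ^+ 2) * (\sum_i b i ^+ 2).
Proof.
have [b0|b0] := eqVneq (\sum_i b i ^+ 2) 0.
  have bi i : b i = 0.
    move/eqP: b0; rewrite psumr_eq0 => [/allP/(_ i)|j _]; last exact: sqr_ge0.
    by rewrite mem_index_enum /= sqrf_eq0 => /(_ isT)/eqP.
  by rewrite b0 mulr0 big1 ?expr0n// => i _; rewrite bi mulr0.
set B := \sum_i b i ^+ 2 in b0 *; set S := \sum_i a i * b i; set A := \sum_i a i ^+ 2.
have B0 : 0 < B by rewrite lt_def b0 sumr_ge0// => i _; exact: sqr_ge0.
have : 0 <= \sum_i (B * a i - S * b i) ^+ 2 by apply: sumr_ge0 => i _; exact: sqr_ge0.
have -> : \sum_i (B * a i - S * b i) ^+ 2 = B * (A * B - S ^+ 2).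
  transitivity (B ^+ 2 * A - (2 * B * S) * S + S ^+ 2 * B); last by ring.
  have E1 : B ^+ 2 * A = \sum_i B ^+ 2 * a i ^+ 2 by rewrite -mulr_sumr.
  have E2 : (2 * B * S) * S = \sum_i (2 * B * S) * (a i * b i) by rewrite -mulr_sumr.
  have E3 : S ^+ 2 * B = \sum_i S ^+ 2 * b i ^+ 2 by rewrite -mulr_sumr.
  rewrite E1 E2 E3 -sumrB -big_split /=.
  by apply: eq_bigr => i _; ring.
by rewrite pmulr_rge0// subr_ge0.
Qed.

(** Cauchy-Schwarz for [grad w] and the normal [(- grad g, 1)]. *)
Lemma DtN_sqr_le g w x :
  DtN g w x ^+ 2 <= (1 + \sum_i ('D_(e_ i) g x) ^+ 2) * grad_sq w (x, g x).
Proof.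
rewrite /DtN /grad_sq; set Y := derive w _ _; set S := \sum_i _ * _.
set G := \sum_i _ ^+ 2; set W := \sum_i _ ^+ 2.
have SG : S ^+ 2 <= G * W by exact: sqr_sum_le.
have G0 : 0 <= G by apply: sumr_ge0 => i _; exact: sqr_ge0.
have W0 : 0 <= W by apply: sumr_ge0 => i _; exact: sqr_ge0.
have [/eqP G00|Gn0] := boolP (G == 0).
  rewrite G00 mul0r in SG; have /eqP : S ^+ 2 = 0 by apply/eqP; rewrite eq_le SG sqr_ge0.
  by rewrite sqrf_eq0 => /eqP ->; rewrite G00; nra.
have Gp : 0 < G by rewrite lt_def Gn0.
have : 0 <= G * ((1 + G) * (W + Y ^+ 2) - (Y - S) ^+ 2).
  rewrite (_ : _ * _ = (G * Y + S) ^+ 2 + (1 + G) * (G * W - S ^+ 2)); last by ring.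
  by rewrite addr_ge0 ?sqr_ge0// mulr_ge0 ?subr_ge0// addr_ge0.
by rewrite pmulr_rge0// subr_ge0.
Qed.

(** The energy is bounded on all bands below the graph by a single constant. The density [e] is
    arbitrary, so one density can dominate several functions at once and yield levels that are good
    for all of them. *)
Definition finite_energy e g :=
  [/\ forall p, 0 <= e p, forall p, Omega g p -> {for p, continuous e} &
      exists C, forall a b : R, a < b -> b < 0 ->
        torus_int (fun x => \int[mu]_(z in `[a, b]) e (x, g x + z)) <= C].

Lemma cont_below e g z x : C1 setT g -> (forall p, Omega g p -> {for p, continuous e}) ->
  z < 0 -> {for (z, x), continuous (fun p : R * 'rV[R]_n => e (p.2, g p.2 + p.1))}.
Proof.
move=> cg ce z0.
apply: (@cont_comp _ _ _ _ (fun p : R * 'rV[R]_n => (p.2, g p.2 + p.1)) e).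
  apply: cont_pair; first exact: cont_snd.
  apply: contD; last exact: cont_fst.
  by apply: (@cont_comp_snd R n g); exact: C1_setT_continuous.
by apply: ce; rewrite /Omega /= gtrDl.
Qed.

(** A tall enough band has a small mean energy per unit height, so one of its levels has small
    energy. *)
Lemma low_energy_level e g : C1 setT g -> finite_energy e g ->
  forall eps L, 0 < eps -> exists2 z, z < L /\ z < 0 &
    torus_int (fun x => e (x, level g z x)) <= eps.
Proof.
move=> cg [e0 ce [C HC]] eps L eps0.
(* The band from [L' - K] to [L'] has height [K = C' / eps], hence mean energy at most [eps]. Taking
   [L' <= -1] leaves the interval from [L'] to [L' / 2] as a margin still below the graph, and [C']
   is positive whatever the sign of [C]. *)
pose L' := Num.min L (-1); pose C' := `|C| + 1; pose K := C' / eps.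
have C'0 : 0 < C' by rewrite ltr_wpDl.
have K0 : 0 < K by rewrite divr_gt0.
have L1 : L' <= -1 by rewrite ge_min lexx orbT.
have LL : L' <= L by rewrite ge_min lexx.
have [||||||xi /andP[_ xiL]] := @torus_int_mean R n (fun z x => e (x, g x + z)) (L' - K - 1) (L' - K) L' (L' / 2) C.
- by lra.
- by lra.
- by lra.
- move=> z x /andP[_ zL]; have z0 : z < 0 by lra.
  exact: (@cont_below e g z x cg ce z0).
- by move=> z x _; exact: e0.
- by apply: HC; lra.
rewrite (_ : L' - (L' - K) = K); last by ring.
move=> H; exists xi; first by split; [exact: lt_le_trans LL|lra].
have -> : (fun x => e (x, level g xi x)) = (fun x => e (x, g x + xi)).
  by apply/funext => x; rewrite levelE.
rewrite -ler_pdivlMr// in H; apply: le_trans H _.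
rewrite ler_pdivrMr// /K mulrCA divff ?gt_eqF// mulr1 /C'.
by rewrite (le_trans (ler_norm C))// lerDl.
Qed.

(** The Cauchy-Schwarz inequality for integrals is replaced by the pointwise bound
    [+- k <= eps / 2 + k^2 / (2 eps)], integrated on a level of small energy. *)
Lemma small_integral_level e g (k : R -> 'rV[R]_n -> R) (C : R) : C1 setT g ->
  finite_energy e g -> 0 <= C -> (forall z, z < 0 -> cube_continuous (k z)) ->
  (forall z x, z < 0 -> cube x -> (k z x) ^+ 2 <= C * e (x, level g z x)) ->
  forall eps L, 0 < eps -> exists2 z, z < L & `|torus_int (k z)| <= eps.
Proof.
move=> cg fe C0 ck kC eps L eps0.
have [e0 ce _] := fe.
(* With energy at most [d], the quadratic term contributes at most [C d / (2 eps) <= eps / 2]. *)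
pose d := eps ^+ 2 / (C + 1).
have C1 : 0 < C + 1 by rewrite ltr_wpDl.
have d0 : 0 < d by rewrite divr_gt0// exprn_gt0.
have [z [zL z0] Hz] := low_energy_level cg fe L d0.
exists z => //.
have ce' : cube_continuous (fun x => e (x, level g z x)).
  have -> : (fun x => e (x, level g z x)) = (fun x => e (x, g x + z)).
    by apply/funext => x; rewrite levelE.
  move=> x _; apply: (@cont_comp _ _ _ _ (fun x => (z, x)) (fun p : R * 'rV[R]_n => e (p.2, g p.2 + p.1))).
    by apply: cont_pair; [exact: cont_cst|exact: cont_id].
  exact: (@cont_below e g z x cg ce z0).
have H s : `|s| = 1 -> s * torus_int (k z) <= eps.
  move=> s1.
  have cke : cube_continuous (fun x => eps / 2 + C / (2 * eps) * e (x, level g z x)).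
    apply: cube_continuousD; first exact: cube_continuous_cst.
    by apply: cube_continuousM => //; exact: cube_continuous_cst.
  rewrite -torus_intZ//; last exact: ck.
  apply: le_trans (_ : torus_int (fun x => eps / 2 + C / (2 * eps) * e (x, level g z x)) <= _).
    apply: torus_int_le => //.
      by apply: cube_continuousM; [exact: cube_continuous_cst|exact: ck].
    move=> x cx; have := kC z x z0 cx; set E := e _; set kk := k z x => Hk.
    have s2 : s ^+ 2 = 1 by rewrite -(ger0_norm (sqr_ge0 s)) normrX s1 expr1n.
    have : 0 <= (s * kk - eps) ^+ 2 by exact: sqr_ge0.
    rewrite sqrrB exprMn s2 mul1r => H1.
    have -> : eps / 2 + C / (2 * eps) * E = (eps ^+ 2 + C * E) / (2 * eps).
      by field; rewrite gt_eqF.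
    rewrite ler_pdivlMr ?mulr_gt0//.
    have -> : s * kk * (2 * eps) = s * kk * eps *+ 2 by rewrite mulr2n; ring.
    by lra.
  rewrite torus_intD; [|exact: cube_continuous_cst|]; last first.
    by apply: cube_continuousM => //; exact: cube_continuous_cst.
  rewrite torus_int_cst torus_intZ//.
  have CE : C / (2 * eps) * torus_int (fun x => e (x, level g z x)) <= eps / 2.
    apply: le_trans (_ : C / (2 * eps) * d <= _).
      by rewrite ler_wpM2l// divr_ge0// mulr_ge0// ltW.
    rewrite /d; have -> : C / (2 * eps) * (eps ^+ 2 / (C + 1)) = (C / (C + 1)) * (eps / 2).
      by field; rewrite !gt_eqF.
    by rewrite ler_piMl ?divr_ge0 ?(ltW eps0)// ler_pdivrMr// mul1r lerDl.
  by lra.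
rewrite ler_norml; apply/andP; split.
  by have := H (-1); rewrite normrN1 mulN1r => /(_ erefl); lra.
by have := H 1; rewrite normr1 mul1r => /(_ erefl).
Qed.

End Decay.

(** * Harmonic extensions *)

Section HarmonicExtension.
Variables (R : realType) (n : nat).
Local Notation X := ('rV[R]_n * R)%type.
Local Notation e_ := (e_ R).
Local Notation dx := (dx R).
Local Notation dy := (dy R n).
Local Notation mu := (@lebesgue_measure R).
Implicit Types (w e phi : X -> R) (g h q : 'rV[R]_n -> R) (U : set X).

Lemma harmonic_ext_below h psi phi : C1 setT h -> harmonic_ext h psi phi ->
  harmonic_below h phi.
Proof.
move=> ch [pp [[U [oU hU cU]] c2] lp _ _].
have fX : finite_coords X := finite_coords_prod (finite_coords_rV R n) (finite_coords_R R).
have oO := open_Omega (C1_setT_continuous ch).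
split => //.
- by exists U; split => //; exact: Ck_on1_C1.
- by move=> v; apply: (Ck_on1_C1 fX oO); exact: Ck_on_derive.
Qed.

Lemma cont_grad_sq U w p : (forall v, C1 U (fun p => 'D_v w p)) -> U p ->
  {for p, continuous (grad_sq w)}.
Proof.
move=> cw Up; have c v : {for p, continuous (fun p => 'D_v w p ^+ 2)}.
  by have cv := C1_cont (cw v) Up; exact: (@contM _ _ p _ _ cv cv).
by apply: contD => //; apply: cont_sum => i.
Qed.

Lemma harmonic_ext_energy h psi phi g : C1 setT h -> C1 setT g ->
  (forall x, g x <= h x) -> harmonic_ext h psi phi -> finite_energy (grad_sq phi) g.
Proof.
move=> ch cg gh hphi; have [_ _ cw _] := harmonic_ext_below ch hphi.
have [_ _ _ Efin _] := hphi.
have cO p : Omega g p -> {for p, continuous (grad_sq phi)}.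
  move=> Op; apply: (cont_grad_sq cw); exact: lt_le_trans (gh _).
split => //; first by move=> p; exact: grad_sq_ge0.
exists (fine (dirichlet_energy h phi)) => a b ab b0.
apply: torus_int_energy_le => //.
- exact: C1_setT_continuous.
- by move=> p; exact: grad_sq_ge0.
- by move=> x y yg; exact: cO.
Qed.

Lemma finite_energy_vshift c w g :
  finite_energy (grad_sq w) (fun x => g x + c) -> finite_energy (grad_sq (vshift c w)) g.
Proof.
have E : grad_sq (vshift c w) = vshift c (grad_sq w).
  apply/funext => p; have D v : derive (vshift c w) p v = derive w (p + (0, c)) v.
    by apply: eq_derive_reparam => h; rewrite /vshift addrA.
  by rewrite /vshift /grad_sq D; under eq_bigr do rewrite D.
rewrite E => -[e0 ce [C HC]]; split.
- by move=> p; exact: e0.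
- move=> p Op.
  have Op' : Omega (fun x => g x + c) (p + (0, c)) by rewrite /Omega /= addr0 ltrD2r.
  rewrite /vshift; apply: (@cont_comp _ _ _ _ (fun p : X => p + (0, c)) (grad_sq w)).
    by apply: (@cvgD _ _ _ (nbhs p) _ (fun p => p) (fun=> (0, c))); [exact: cvg_id|exact: cvg_cst].
  exact: ce Op'.
exists C => a b ab b0; apply: le_trans (HC a b ab b0).
rewrite le_eqVlt; apply/orP; left; apply/eqP.
apply: eq_torus_int => x cx; apply: eq_Rintegral => z _.
by rewrite vshiftE addrAC.
Qed.

Lemma finite_energyD e1 e2 g : C1 setT g -> finite_energy e1 g -> finite_energy e2 g ->
  finite_energy (fun p => e1 p + e2 p) g.
Proof.
move=> cg [e10 ce1 [C1 H1]] [e20 ce2 [C2 H2]]; split.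
- by move=> p; rewrite addr_ge0.
- by move=> p Op; apply: contD; [exact: ce1|exact: ce2].
exists (C1 + C2) => a b ab b0.
have czx e z x : (forall p, Omega g p -> {for p, continuous e}) -> a <= z <= b ->
    {for (z, x), continuous (fun p : R * 'rV[R]_n => e (p.2, g p.2 + p.1))}.
  by move=> ce /andP[_ zb]; apply: (@cont_below _ _ e g z x cg ce); exact: le_lt_trans b0.
have cI e : (forall p, Omega g p -> {for p, continuous e}) ->
    cube_continuous (fun x => \int[mu]_(z in `[a, b]) e (x, g x + z)).
  by move=> ce; apply: (@cube_continuous_Rintegral R n (fun z x => e (x, g x + z)) a b (ltW ab)) => z x; exact: czx.
have iI e x : (forall p, Omega g p -> {for p, continuous e}) ->
    mu.-integrable `[a, b] (EFin \o (fun z => e (x, g x + z))).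
  move=> ce; apply: segment_integrable; apply: continuous_within_segment => z zab.
  apply: (@cont_comp _ _ _ _ (fun z : R => (z, x)) (fun p : R * 'rV[R]_n => e (p.2, g p.2 + p.1))).
    by apply: cont_pair; [exact: cont_id|exact: cont_cst].
  exact: czx.
have -> : torus_int (fun x => \int[mu]_(z in `[a, b]) (e1 (x, g x + z) + e2 (x, g x + z))) =
  torus_int (fun x => \int[mu]_(z in `[a, b]) e1 (x, g x + z)) +
  torus_int (fun x => \int[mu]_(z in `[a, b]) e2 (x, g x + z)).
  rewrite -torus_intD; [|exact: cI|exact: cI].
  apply: eq_torus_int => x _; apply: RintegralD => //; exact: iI.
by apply: lerD; [exact: H1|exact: H2].
Qed.

Lemma derive_level g z x v : C1 setT g -> 'D_v (level g z) x = 'D_v g x.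
Proof.
move=> cg; rewrite (derive_graph_family z x v cg (@C1_1 R n)).
by rewrite derive_cst mulr0 addr0.
Qed.

(** The comparison needs two fluxes to be close on the same level, hence a difference under one
    density [e]; a single flux is the case [a2 = 0]. With bounded weights, [DtN_sqr_le] bounds the
    squared flux densities by a multiple of [e]. *)
Lemma flux_decay (a1 a2 : X -> R) w1 w2 e g (A C : R) : C1 setT g ->
  harmonic_below g w1 -> harmonic_below g w2 -> finite_energy e g ->
  (forall p, Omega g p -> {for p, continuous a1}) ->
  (forall p, Omega g p -> {for p, continuous a2}) ->
  0 <= A -> 0 <= C ->
  (forall p, cube p.1 -> Omega g p -> `|a1 p| <= A /\ `|a2 p| <= A) ->
  (forall p, Omega g p -> grad_sq w1 p <= C * e p /\ grad_sq w2 p <= C * e p) ->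
  forall eps L, 0 < eps -> exists2 z, z < L &
    `|flux a1 w1 (level g z) - flux a2 w2 (level g z)| <= eps.
Proof.
move=> cg hw1 hw2 fe ca1 ca2 A0 C0 aA wC.
(* [M] bounds the squared slope of [g], which all its levels share. *)
have [M M0 HM] : exists2 M, 0 < M & forall x, cube x -> `|\sum_i ('D_(e_ i) g x) ^+ 2| <= M.
  apply: cube_bounded; apply: continuous_cube => x; apply: cont_sum => i.
  by have cv := @C1_setT_derive_continuous R _ g (e_ i) cg x; exact: (@contM _ _ x _ _ cv cv).
have oO := open_Omega (C1_setT_continuous cg).
have LO z x : z < 0 -> Omega g (x, level g z x) by move=> z0; rewrite /Omega /= levelE gtrDl.
have cD w p v : harmonic_below g w -> Omega g p -> {for p, continuous (fun p => 'D_v w p)}.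
  by move=> [_ _ cw _] Op; exact: (C1_cont (cw v) Op).
have cf (a : X -> R) w z : z < 0 -> harmonic_below g w -> (forall p, Omega g p -> {for p, continuous a}) ->
    cube_continuous (fun x => a (x, level g z x) * DtN (level g z) w x).
  move=> z0 hw ca; apply: (cube_continuous_flux oO ca _ (C1_graph_family z cg (@C1_1 R n))).
    by move=> p v Op; exact: cD.
  by move=> x; exact: LO.
have bnd (a : X -> R) w z x : z < 0 -> cube x -> `|a (x, level g z x)| <= A ->
    grad_sq w (x, level g z x) <= C * e (x, level g z x) ->
    (a (x, level g z x) * DtN (level g z) w x) ^+ 2 <= A ^+ 2 * (1 + M) * (C * e (x, level g z x)).
  move=> z0 cx aA' wC'; rewrite exprMn -mulrA; apply: ler_pM; rewrite ?sqr_ge0//.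
    by rewrite -(ger0_norm (sqr_ge0 (a _))) normrX lerXn2r// ?nnegrE.
  apply: le_trans (DtN_sqr_le _ _ _) _; apply: ler_pM => //.
  - by rewrite addr_ge0// sumr_ge0// => i _; exact: sqr_ge0.
  - exact: grad_sq_ge0.
  - rewrite lerD2l (eq_bigr (fun i => ('D_(e_ i) g x) ^+ 2)).
      by apply: le_trans (HM x cx); exact: ler_norm.
    by move=> i _; rewrite derive_level.
pose k z x := a1 (x, level g z x) * DtN (level g z) w1 x - a2 (x, level g z x) * DtN (level g z) w2 x.
have ck z : z < 0 -> cube_continuous (k z).
  by move=> z0; apply: cube_continuousD; [exact: cf|apply: cube_continuousN; exact: cf].
have M1 : 0 <= 1 + M by rewrite addr_ge0// ltW.
have [e0 _ _] := fe.
have kC z x : z < 0 -> cube x -> k z x ^+ 2 <= 4 * (A ^+ 2 * (1 + M) * C) * e (x, level g z x).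
  move=> z0 cx; have Op := LO z x z0.
  have [A1 A2] := aA (x, level g z x) cx Op; have [W1 W2] := wC _ Op.
  have B1 := bnd a1 w1 z x z0 cx A1 W1; have B2 := bnd a2 w2 z x z0 cx A2 W2.
  rewrite /k; move: B1 B2; set p1 := a1 _ * _; set p2 := a2 _ * _; set E := e _ => B1 B2.
  have : 0 <= (p1 + p2) ^+ 2 by exact: sqr_ge0.
  rewrite sqrrD sqrrB => H.
  rewrite (_ : 4 * _ * E = 2 * (A ^+ 2 * (1 + M) * (C * E)) + 2 * (A ^+ 2 * (1 + M) * (C * E))); last by ring.
  by lra.
have K0 : 0 <= 4 * (A ^+ 2 * (1 + M) * C) by rewrite !mulr_ge0// sqr_ge0.
(* The minimum with [0] puts the level strictly below the graph, where the densities are continuous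
   and the integral of the difference splits. *)
move=> eps L eps0; have LL : Num.min L 0 <= L by rewrite ge_min lexx.
have [z zL Hz] := small_integral_level cg fe K0 ck kC (Num.min L 0) eps0.
have z0 : z < 0 by apply: lt_le_trans zL _; rewrite ge_min lexx orbT.
exists z; first exact: lt_le_trans LL.
by move: Hz; rewrite /k torus_intB//; exact: cf.
Qed.

End HarmonicExtension.

(** * Bounds on the extension and dissipation *)

Section Bounds.
Variables (R : realType) (n : nat).
Local Notation X := ('rV[R]_n * R)%type.
Local Notation e_ := (e_ R).
Local Notation dx := (dx R).
Local Notation dy := (dy R n).
Implicit Types (w e phi : X -> R) (g h q : 'rV[R]_n -> R) (U : set X).

Lemma flux0 w g : flux (fun=> 0) w g = 0.
Proof.
rewrite /flux -[RHS](torus_int_cst n); apply: eq_torus_int => x _.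
by rewrite mul0r.
Qed.

(** Energy supplies the decay asked for by [maximum_principle], because the weight [cutoff (w)] is
    at most 1. *)
Lemma maximum_principle_energy w e g (C : R) : C1 setT g -> Defs.periodic g ->
  harmonic_below g w -> finite_energy e g -> 0 <= C ->
  (forall p, Omega g p -> grad_sq w p <= C * e p) ->
  (forall x, cube x -> w (x, g x) <= 0) ->
  forall x y, cube x -> y <= g x -> w (x, y) <= 0.
Proof.
move=> cg pg hw fe C0 wC w0; apply: maximum_principle => // eps L eps0.
have cw := harmonic_below_C1 cg hw.
have oO := open_Omega (C1_setT_continuous cg).
have [ca _] := C1_comp oO (@C1_cutoff R) cw.
have [||||||z zL H] := @flux_decay R n (fun p => cutoff (w p)) (fun=> 0) w w e g 1 C cg hw hw fe _ _ _ _ _ _ eps L eps0.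
- by move=> p Op; exact: C1_cont ca Op.
- by move=> p Op; exact: cont_cst.
- exact: ler01.
- exact: C0.
- move=> p cp Op; rewrite normr0 ler01; split=> //.
  by rewrite ger0_norm ?cutoff_ge0// cutoff_le1.
- by move=> p Op; split; exact: wC.
by exists z => //; move: H; rewrite flux0 subr0.
Qed.

(** The maximum principle applied to [phi - M] and to [- M - phi], whose gradients have the same
    length as that of [phi]. *)
Lemma harmonic_ext_max h phi (M : R) : C1 setT h -> Defs.periodic h ->
  harmonic_ext h h phi -> (forall x, cube x -> `|h x| <= M) ->
  forall x y, cube x -> y <= h x -> `|phi (x, y)| <= M.
Proof.
move=> ch ph hphi hM x y cx yh.
have hb := harmonic_ext_below ch hphi.
have fe := harmonic_ext_energy ch ch (fun=> lexx _) hphi.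
have [_ _ _ _ phih] := hphi.
have gle w c : (forall p v, Omega_closure h p -> 'D_v w p = c * 'D_v phi p) ->
    c ^+ 2 = 1 -> forall p, Omega h p -> grad_sq w p <= 1 * grad_sq phi p.
  move=> Dw c1 p Op; have Cp : Omega_closure h p by exact: ltW.
  rewrite mul1r le_eqVlt; apply/orP; left; apply/eqP; rewrite /grad_sq.
  rewrite Dw// exprMn c1 mul1r; congr (_ + _).
  by apply: eq_bigr => i _; rewrite Dw// exprMn c1 mul1r.
have [hb1 D1] := harmonic_below_lin (- M) ch hb (harmonic_below_cst h 1).
have [hb2 D2] := harmonic_below_lin (-1) ch (harmonic_below_cst h (- M)) hb.
rewrite ler_norml; apply/andP; split.
- suff : - M + (-1) * phi (x, y) <= 0 by lra.
  apply: (maximum_principle_energy ch ph hb2 fe ler01 _ _ cx yh).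
    apply: (gle _ (-1)); last by rewrite sqrrN expr1n.
    by move=> p v Cp; rewrite D2// derive_cst add0r.
  by move=> z cz /=; rewrite phih; have := hM z cz; rewrite ler_norml => /andP[? ?]; lra.
- suff : phi (x, y) + (- M) * 1 <= 0 by lra.
  apply: (maximum_principle_energy ch ph hb1 fe ler01 _ _ cx yh).
    apply: (gle _ 1); last by rewrite expr1n.
    by move=> p v Cp; rewrite D1// derive_cst mulr0 addr0 mul1r.
  by move=> z cz /=; rewrite phih; have := hM z cz; rewrite ler_norml => /andP[? ?]; lra.
Qed.

Lemma is_derive_left_max (f : R -> R) (t d : R) : is_derive t 1 f d ->
  (forall y, y <= t -> f y <= f t) -> 0 <= d.
Proof.
move=> [df dE] ft; rewrite leNgt; apply/negP => d0.
have : (fun h : R => h^-1 *: ((f \o shift t) (h *: 1) - f t)) @ 0^' --> d by rewrite -dE; exact: df.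
move=> /cvgrPdist_le/(_ (- d / 2)) H.
have [|r /= r0 rH] := H; first by lra.
have := rH (- (r / 2)); rewrite /= sub0r opprK.
rewrite ger0_norm ?divr_ge0 ?(ltW r0)// => /(_ _ _).
have r2 : r / 2 < r by lra.
have rn0 : - (r / 2) != 0 by rewrite oppr_eq0 gt_eqF// divr_gt0.
move=> /(_ r2 rn0); rewrite ler_norml => /andP[+ _].
have Q : 0 <= (- (r / 2))^-1 *: (f (- (r / 2) *: 1 + t) - f t).
  rewrite invrN scaleNr oppr_ge0; apply: mulr_ge0_le0.
    by rewrite invr_ge0 divr_ge0// ltW.
  by rewrite subr_le0 ft// [_ *: 1]mulr1 gerDr; lra.
by rewrite /shift /=; lra.
Qed.

(** The harmonic function [y - phi] vanishes on the graph and is nonpositive below it, so its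
    vertical derivative at the graph is nonnegative. *)
Lemma derive_y_le1 h phi : C1 setT h -> Defs.periodic h -> harmonic_ext h h phi ->
  forall x, cube x -> 'D_dy phi (x, h x) <= 1.
Proof.
move=> ch ph hphi x cx.
have hb := harmonic_ext_below ch hphi.
have [_ _ _ _ phih] := hphi.
have [M M0 HM] := cube_bounded (continuous_cube (C1_setT_continuous ch)).
have phiM := harmonic_ext_max ch ph hphi HM.
have [hw Dw] := harmonic_below_lin (-1) ch (harmonic_below_y h) hb.
set w := (fun p => _) in hw Dw.
have w0 z : w (z, h z) = 0 by rewrite /w phih /=; lra.
have wle : forall x y, cube x -> y <= h x -> w (x, y) <= 0.
  apply: (maximum_principle ch ph hw) => [z _|eps L eps0]; first by rewrite w0.
  exists (Num.min L (- (2 * M)) - 1).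
    by rewrite (lt_le_trans (_ : _ < Num.min L (- (2 * M))))// ?ge_min ?lexx// gtrDl.
  rewrite (_ : flux _ _ _ = 0) ?normr0 ?(ltW eps0)//.
  rewrite /flux -[RHS](torus_int_cst n); apply: eq_torus_int => z cz.
  rewrite cutoff_npos ?mul0r// /w /= levelE.
  set L' := _ - 1; have L'M : L' <= - (2 * M).
    by apply: le_trans (_ : Num.min L (- (2 * M)) <= _); rewrite ?gerDl ?lerN10// ge_min lexx orbT.
  have L'0 : h z + L' <= h z by rewrite gerDl; lra.
  have := phiM z _ cz L'0; have := HM z cz; rewrite !ler_norml => /andP[? ?] /andP[? ?].
  by lra.
have [_ [U [oU gU cU]] _ _] := hw.
have Cx : Omega_closure h (x, h x) by rewrite /Omega_closure /=.
have dw : derivable w (x, h x) dy by apply: diff_derivable; exact: (cU _ (gU _ Cx)).1.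
have wmax y : y <= h x -> w (x, y) <= w (x, h x).
  by move=> yh; rewrite (w0 x); exact: (wle x y cx yh).
have := is_derive_left_max (is_derive_y dw) wmax.
have ds : 'D_dy (fun p : X => p.2) (x, h x) = 1 by exact: (congr1 (@^~ (x, h x)) (derive_snd dy)).
by rewrite Dw// ds; lra.
Qed.

(** Obtained by differentiating [phi (x, h x) = h x] in the direction [e_ i]. *)
Lemma boundary_gradient h phi x i : C1 setT h -> harmonic_ext h h phi ->
  'D_(dx i) phi (x, h x) = (1 - 'D_dy phi (x, h x)) * 'D_(e_ i) h x.
Proof.
move=> ch hphi; have [_ _ _ _ phih] := hphi.
have [_ [U [oU gU cU]] _ _] := harmonic_ext_below ch hphi.
have Cx : Omega_closure h (x, h x) by rewrite /Omega_closure /=.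
have := derive_graph (e_ i) (cU _ (gU _ Cx)).1 (ch x I).1.
have -> : (fun x => phi (x, h x)) = h by apply/funext => z; exact: phih.
move=> /(@derive_val _ _ _ _ _ _ _) E.
have {}E : 'D_(e_ i) h x = 'D_(dx i) phi (x, h x) + 'D_(e_ i) h x * 'D_dy phi (x, h x) := E.
by rewrite mulrBl mul1r {1}E; ring.
Qed.

(** Here [u] is [G(h)h], opposite in sign to the [u] of the overview. All three identities follow
    from [grad_x phi = (1 - B) grad h] on the graph; the last one gives [1 - u] the sign of
    [1 - B]. *)
Lemma boundary_DtN h phi x : C1 setT h -> harmonic_ext h h phi ->
  let B := 'D_dy phi (x, h x) in let u := DtN h phi x in
  [/\ \sum_i 'D_(e_ i) h x * 'D_(dx i) phi (x, h x) = B - u,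
      grad_sq phi (x, h x) = B - u + B * u &
      1 - u = (1 - B) * (1 + \sum_i 'D_(e_ i) h x ^+ 2)].
Proof.
move=> ch hphi B u.
have S1 : \sum_i 'D_(e_ i) h x * 'D_(dx i) phi (x, h x) = B - u.
  by rewrite /u /DtN opprB addrCA subrr addr0.
have S2 : \sum_i 'D_(e_ i) h x * 'D_(dx i) phi (x, h x) = (1 - B) * \sum_i 'D_(e_ i) h x ^+ 2.
  by rewrite mulr_sumr; apply: eq_bigr => i _; rewrite (boundary_gradient x i ch hphi) mulrCA expr2.
have S3 : \sum_i ('D_(dx i) phi (x, h x)) ^+ 2 = (1 - B) * (B - u).
  rewrite -S1 mulr_sumr; apply: eq_bigr => i _.
  by rewrite expr2 {1}(boundary_gradient x i ch hphi) -mulrA.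
split => //.
- by rewrite /grad_sq S3 -/B; ring.
- have -> : 1 - u = (1 - B) + (B - u) by ring.
  by rewrite -S1 S2; ring.
Qed.

Lemma DtN_le1 h phi x : C1 setT h -> Defs.periodic h -> harmonic_ext h h phi -> cube x ->
  DtN h phi x <= 1.
Proof.
move=> ch ph hphi cx; have [_ _ E] := boundary_DtN x ch hphi.
rewrite -subr_ge0 E mulr_ge0 ?subr_ge0 ?derive_y_le1//.
by rewrite addr_ge0// sumr_ge0// => i _; exact: sqr_ge0.
Qed.

Lemma C1_bounded (F : R -> R) (M : R) : @C1 R R^o setT F ->
  exists2 A, 0 <= A & forall r, `|r| <= M -> `|F r| <= A /\ `|'D_1 F r| <= A.
Proof.
move=> cF.
have bnd (f : R -> R) : continuous f -> exists2 A, 0 <= A & forall r, `|r| <= M -> `|f r| <= A.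
  move=> cf; have cw : {within `[- M, M], continuous f} by apply: continuous_within_segment => x _; exact: cf.
  have /compact_bounded[A [_ HA]] := continuous_compact cw (@segment_compact R (- M) M).
  exists (`|A| + 1) => [|r rM]; first by rewrite addr_ge0.
  apply: HA; first by rewrite (le_lt_trans (ler_norm A))// ltrDl.
  by exists r => //; rewrite /= in_itv /= -ler_norml.
have [A1 A10 H1] := bnd F (C1_setT_continuous cF).
have [A2 A20 H2] := bnd (fun r => 'D_1 F r) (@C1_setT_derive_continuous R R^o F 1 cF).
exists (A1 + A2) => [|r rM]; first exact: addr_ge0.
by split; [apply: le_trans (H1 r rM) _; rewrite lerDl|apply: le_trans (H2 r rM) _; rewrite lerDr].
Qed.

Lemma dissipation (F : R -> R) h phi : @C1 R R^o setT F -> (forall r, 0 <= 'D_1 F r) ->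
  C1 setT h -> Defs.periodic h -> harmonic_ext h h phi ->
  0 <= torus_int (fun x => F (h x) * DtN h phi x).
Proof.
move=> cF F0 ch ph hphi.
have hb := harmonic_ext_below ch hphi.
have fe := harmonic_ext_energy ch ch (fun=> lexx _) hphi.
have [_ _ _ _ phih] := hphi.
have [pp [U [oU gU cU]] cD lp] := hb.
have [M M0 HM] := cube_bounded (continuous_cube (C1_setT_continuous ch)).
have phiM := harmonic_ext_max ch ph hphi HM.
(* [F] may be unbounded, but [phi] stays between [- M] and [M], so the weight [F (phi)] is bounded
   as the decay requires. *)
have [A A0 FA] := C1_bounded M cF.
pose a (p : X) := F (phi p).
have cphi := harmonic_below_C1 ch hb.
have oO := open_Omega (C1_setT_continuous ch).
have [ca Da] := C1_comp oO cF cphi.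
have [caU _] := C1_comp oU cF cU.
have pa : periodic2 a by move=> i x y; rewrite /a pp.
pose Fl z := flux a phi (level h z).
pose dFl z := torus_int (fun x => grad_dot a phi (x, level h z x)).
have Lev z x : z < 0 -> Omega h (x, level h z x) by move=> z0; rewrite /Omega /= levelE gtrDl.
have dF (z : R) : z < 0 -> is_derive z 1 Fl (dFl z) by exact: flux_level_is_derive.
have gd0 p : Omega h p -> 0 <= grad_dot a phi p.
  move=> Op; have -> : grad_dot a phi p = 'D_1 F (phi p) * grad_sq phi p.
    rewrite -grad_dotE /grad_dot mulrDr mulr_sumr; congr (_ + _).
      by apply: eq_bigr => i _; rewrite Da// mulrA.
    by rewrite Da// mulrA.
  by rewrite mulr_ge0 ?grad_sq_ge0.
have cgd z : z < 0 -> cube_continuous (fun x => grad_dot a phi (x, level h z x)).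
  move=> z0 x cx; apply: (@cont_comp _ _ _ _ (fun x => (x, level h z x)) (grad_dot a phi)).
    apply: cont_pair; first exact: cont_id.
    exact: (C1_setT_continuous (C1_graph_family z ch (@C1_1 R n))).
  have Op := Lev z x z0.
  apply: contD; last by apply: contM; [exact: (ca _ Op).2|exact: (C1_cont (cD dy) Op)].
  by apply: cont_sum => i; apply: contM; [exact: (ca _ Op).2|exact: (C1_cont (cD (dx i)) Op)].
have dF0 z : z < 0 -> 0 <= dFl z.
  by move=> z0; apply: torus_int_ge0 => [|x cx]; [exact: cgd|apply: gd0; exact: Lev].
have cF0 : {for 0, continuous Fl}.
  by apply: (flux_level_continuous0 ch hb oU gU) => p Up; exact: C1_cont caU Up.
have mono := nondecreasing_npos dF dF0 cF0.
have -> : torus_int (fun x => F (h x) * DtN h phi x) = Fl 0.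
  by rewrite /Fl level0 /flux; apply: eq_torus_int => x _; rewrite /a phih.
apply/ler_addgt0Pl => e e0.
have [||||||z zL H] := @flux_decay R n a (fun=> 0) phi phi _ h A 1 ch hb hb fe _ _ _ _ _ _ e 0 e0.
- by move=> p Op; exact: C1_cont ca Op.
- by move=> p Op; exact: cont_cst.
- exact: A0.
- exact: ler01.
- move=> [x y] /= cp Op; rewrite normr0; split=> //.
  by have [] := FA (phi (x, y)) (phiM x y cp (ltW Op)).
- by move=> p Op; rewrite mul1r.
move: H; rewrite flux0 subr0 ler_norml => /andP[H _].
by have := mono z 0 (ltW zL) (lexx _); rewrite -/(Fl z) in H; lra.
Qed.

End Bounds.

(** * The comparison inequality *)

Section Comparison.
Variables (R : realType) (n : nat).
Local Notation X := ('rV[R]_n * R)%type.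
Local Notation e_ := (e_ R).
Local Notation dx := (dx R).
Local Notation dy := (dy R n).
Implicit Types (w e phi : X -> R) (g h q : 'rV[R]_n -> R) (U : set X).

Lemma derive_vshiftE c w x y v : 'D_v (vshift c w) (x, y) = 'D_v w (x, y + c).
Proof.
apply: eq_derive_reparam => h; rewrite /vshift; congr w; rewrite -addrA; congr (_ + _).
by apply/pair_equal_spec; split => //=; rewrite addr0.
Qed.

Lemma DtN_vshift g c w x : C1 setT g -> DtN g (vshift c w) x = DtN (level g c) w x.
Proof.
move=> cg; rewrite /DtN levelE derive_vshiftE; congr (_ - _).
by apply: eq_bigr => i _; rewrite derive_vshiftE derive_level.
Qed.

Lemma level_level g a b : level (level g a) b = level g (a + b).
Proof. by apply/funext => x; rewrite !levelE addrA. Qed.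

Lemma levelN g c : (fun x => g x - c) = level g (- c).
Proof. by apply/funext => x; rewrite levelE. Qed.

Lemma DtN_lin g w1 w2 (c : R) x : C1 setT g -> harmonic_below g w1 -> harmonic_below g w2 ->
  DtN g (fun p => w1 p + c * w2 p) x = DtN g w1 x + c * DtN g w2 x.
Proof.
move=> cg hw1 hw2; have [_ D] := harmonic_below_lin c cg hw1 hw2.
have Cx : Omega_closure g (x, g x) by rewrite /Omega_closure /=.
rewrite /DtN (D _ dy Cx).
have -> : \sum_i derive g x (e_ i) * derive (fun p => w1 p + c * w2 p) (x, g x) (dx i) =
  \sum_i derive g x (e_ i) * derive w1 (x, g x) (dx i) +
  c * \sum_i derive g x (e_ i) * derive w2 (x, g x) (dx i).
  by rewrite mulr_sumr -big_split /=; apply: eq_bigr => i _; rewrite (D _ (dx i) Cx); ring.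
by ring.
Qed.

Lemma grad_sq_lin3 (w w1 w2 w3 : X -> R) p :
  (forall v, 'D_v w p = 'D_v w1 p - 2 * 'D_v w2 p + 'D_v w3 p) ->
  grad_sq w p <= 12 * (grad_sq w1 p + grad_sq w2 p + grad_sq w3 p).
Proof.
move=> Dw.
(* The constant is [3 * 2 ^ 2]: three terms, the largest coefficient being 2. *)
have le3 (a b c : R) : (a - 2 * b + c) ^+ 2 <= 12 * (a ^+ 2 + b ^+ 2 + c ^+ 2).
  rewrite -subr_ge0 (_ : _ - _ = (a + 2 * b) ^+ 2 + (a - c) ^+ 2 + (2 * b + c) ^+ 2 + 9 * a ^+ 2 + 9 * c ^+ 2); last by ring.
  by rewrite !addr_ge0 ?sqr_ge0// mulr_ge0 ?sqr_ge0.
rewrite /grad_sq !Dw; apply: le_trans (_ : \sum_(i < n) 12 * ('D_(dx i) w1 p ^+ 2 + 'D_(dx i) w2 p ^+ 2 + 'D_(dx i) w3 p ^+ 2) +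
  12 * ('D_dy w1 p ^+ 2 + 'D_dy w2 p ^+ 2 + 'D_dy w3 p ^+ 2) <= _).
  by apply: lerD; [apply: ler_sum => i _; rewrite Dw; exact: le3|exact: le3].
rewrite -mulr_sumr !big_split /= -mulrDr ler_pM2l//.
set A := \sum_i _; set B := \sum_i _; set C := \sum_i _.
by rewrite le_eqVlt; apply/orP; left; apply/eqP; ring.
Qed.

(** Used with [c1 = d K] and [c2 = d (K - 1)]. With [W] the comparison function plus [eps], the
    field [W F'(w1) grad w1 - F(w1) grad W] has divergence [W F''(w1) |grad w1|^2], because the
    cross terms [F'(w1) grad w1 . grad W] cancel. Its flux is therefore nondecreasing in the level,
    comes close to zero at depth, and is nonnegative on the graph. *)
Lemma comparison h h' phi phi' (F : R -> R) (c1 c2 eps : R) :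
  C1 setT h -> Defs.periodic h -> harmonic_ext h h phi ->
  C1 setT h' -> Defs.periodic h' -> harmonic_ext h' h' phi' ->
  0 <= c2 -> (forall x, h' x - c1 <= h x) ->
  @C1 R R^o setT F -> @C1 R R^o setT (fun r => 'D_1 F r) ->
  (forall r, 0 <= 'D_1 (fun r => 'D_1 F r) r) -> 0 <= eps ->
  (forall x, cube x -> - eps <= h' x - 2 * phi (x, h' x - c1) + phi (x, h' x - c1 - c2)) ->
  torus_int (fun x => F (h' x) * (DtN h' phi' x - 2 * DtN (level h' (- c1)) phi x
      + DtN (level h' (- c1 - c2)) phi x)) <=
  torus_int (fun x => (h' x - 2 * phi (x, h' x - c1) + phi (x, h' x - c1 - c2) + eps)
      * 'D_1 F (h' x) * DtN h' phi' x).
Proof.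
move=> ch ph hphi ch' ph' hphi' c20 gh cF cF1 F2 eps0 beps.
(* The common graph: below it [phi' (x, y + c1)], [phi (x, y)] and [phi (x, y - c2)] are all
   evaluated inside their domains. *)
pose g := level h' (- c1).
have gE x : g x = h' x - c1 by rewrite /g levelE.
have cg : C1 setT g by exact: (C1_graph_family (- c1) ch' (@C1_1 R n)).
have pg : Defs.periodic g by move=> i x; rewrite !gE ph'.
have hb := harmonic_ext_below ch hphi.
have hb' := harmonic_ext_below ch' hphi'.
have [_ _ _ _ phih'] := hphi'.
pose w1 := vshift c1 phi'; pose w3 := vshift (- c2) phi.
have hw1 : harmonic_below g w1.
  by have := harmonic_below_vshift c1 hb'; rewrite levelN.
have hw2 : harmonic_below g phi by apply: harmonic_below_sub hb => x; rewrite gE.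
have hw3 : harmonic_below g w3.
  apply: harmonic_below_sub (harmonic_below_vshift (- c2) hb) => x.
  by rewrite opprK gE (le_trans (gh x))// lerDl.
have [h12 D12] := harmonic_below_lin (- 2) cg hw1 hw2.
have [h123 D123] := harmonic_below_lin 1 cg h12 hw3.
have [hW DW] := harmonic_below_lin eps cg h123 (harmonic_below_cst g 1).
have [hV DV] := harmonic_below_lin (-1) cg (harmonic_below_cst g 0) hW.
pose W p := w1 p + - 2 * phi p + 1 * w3 p + eps * 1.
have DWE v p : Omega_closure g p -> 'D_v W p = 'D_v w1 p - 2 * 'D_v phi p + 'D_v w3 p.
  by move=> Cp; rewrite /W DW// D123// D12// derive_cst mulr0 addr0 mul1r mulNr.
have C_O p : Omega g p -> Omega_closure g p by exact: ltW.
(* One density for the three functions, so that a deep level is good for [w1] and [W]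
   simultaneously. *)
pose e p := grad_sq w1 p + grad_sq phi p + grad_sq w3 p.
have fe : finite_energy e g.
  apply: finite_energyD => //; first apply: finite_energyD => //.
  - apply: finite_energy_vshift.
    rewrite (_ : (fun x => g x + c1) = h'); first exact: (harmonic_ext_energy ch' ch' (fun=> lexx _) hphi').
    by apply/funext => x; rewrite gE subrK.
  - by apply: (harmonic_ext_energy ch cg _ hphi) => x; rewrite gE.
  - apply: finite_energy_vshift.
    have cg2 : C1 setT (fun x => g x - c2).
      by rewrite levelN; exact: (C1_graph_family (- c2) cg (@C1_1 R n)).
    apply: (harmonic_ext_energy ch cg2 _ hphi) => x.
    by rewrite gE; have := gh x; lra.
have e_ge p : [/\ grad_sq w1 p <= e p, grad_sq phi p <= e p & grad_sq w3 p <= e p].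
  have := grad_sq_ge0 w1 p; have := grad_sq_ge0 phi p; have := grad_sq_ge0 w3 p.
  by rewrite /e => ? ? ?; split; lra.
have e0 p : 0 <= e p by rewrite /e; apply: addr_ge0; [apply: addr_ge0|]; exact: grad_sq_ge0.
have gW p : Omega g p -> grad_sq W p <= 12 * e p.
  by move=> Op; apply: grad_sq_lin3 => v; rewrite DWE//; exact: C_O.
have WE x y : W (x, y) = phi' (x, y + c1) - 2 * phi (x, y) + phi (x, y - c2) + eps.
  by rewrite /W /w1 /w3 !vshiftE mulr1 mul1r mulNr.
have WgE x : W (x, g x) = h' x - 2 * phi (x, h' x - c1) + phi (x, h' x - c1 - c2) + eps.
  by rewrite WE gE subrK phih'.
have W0 x y : cube x -> y <= g x -> 0 <= W (x, y).
  move=> cx yg; suff : 0 + (-1) * W (x, y) <= 0 by lra.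
  apply: (@maximum_principle_energy R n _ e g 12 cg pg hV fe _ _ _ x y cx yg) => //.
    move=> p Op; apply: le_trans (gW p Op); rewrite le_eqVlt; apply/orP; left; apply/eqP.
    have DVE v : 'D_v (fun p => 0 + (-1) * W p) p = - 'D_v W p.
      by rewrite DV ?derive_cst ?add0r ?mulN1r//; exact: C_O.
    rewrite /grad_sq DVE sqrrN; congr (_ + _).
    by apply: eq_bigr => i _; rewrite DVE sqrrN.
  by move=> z cz; rewrite -/(W _) WgE; have := beps z cz; lra.
pose al (p : X) := F (w1 p); pose be (p : X) := W p * 'D_1 F (w1 p).
have oO := open_Omega (C1_setT_continuous cg).
have {}hW : harmonic_below g W := hW.
have cw1 : C1 (Omega g) w1 := harmonic_below_C1 cg hw1.
have cW : C1 (Omega g) W := harmonic_below_C1 cg hW.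
have [cal Dal] := C1_comp oO cF cw1.
have [cF1w DF1w] := C1_comp oO cF1 cw1.
have cbe : C1 (Omega g) be by exact: (C1M oO cW cF1w).
have [pw1 [U1 [oU1 gU1 cU1]] cD1 l1] := hw1.
have [pW [UW [oUW gUW cUW]] cDW lW] := hW.
have pal : periodic2 al by move=> i x y; rewrite /al pw1.
have pbe : periodic2 be by move=> i x y; rewrite /be pw1; congr (_ * _); exact: pW.
pose U := U1 `&` UW; have oU : open U by exact: openI.
have gU : Omega_closure g `<=` U by move=> p pp; split; [exact: gU1|exact: gUW].
have c1U : C1 U w1 by apply: C1_subset cU1 => p [].
have cWU : C1 U W by apply: C1_subset cUW => p [].
have [calU _] := C1_comp oU cF c1U.
have cbeU : C1 U be by apply: (C1M oU cWU); have [] := C1_comp oU cF1 c1U.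
pose Fl z := flux be w1 (level g z) - flux al W (level g z).
pose dFl z := torus_int (fun x => grad_dot be w1 (x, level g z x)) -
  torus_int (fun x => grad_dot al W (x, level g z x)).
have Lev z x : z < 0 -> Omega g (x, level g z x) by move=> z0; rewrite /Omega /= levelE gtrDl.
have dF (z : R) : z < 0 -> is_derive z 1 Fl (dFl z).
  by move=> z0; apply: is_deriveB; exact: flux_level_is_derive.
have cgd (a w : X -> R) z : z < 0 -> C1 (Omega g) a -> (forall v, C1 (Omega g) (fun p => 'D_v w p)) ->
    cube_continuous (fun x => grad_dot a w (x, level g z x)).
  move=> z0 ca cw x cx; apply: (@cont_comp _ _ _ _ (fun x => (x, level g z x)) (grad_dot a w)).
    apply: cont_pair; first exact: cont_id.
    exact: (C1_setT_continuous (C1_graph_family z cg (@C1_1 R n))).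
  have Op := Lev z x z0.
  apply: contD; last by apply: contM; [exact: (ca _ Op).2|exact: (C1_cont (cw dy) Op)].
  by apply: cont_sum => i; apply: contM; [exact: (ca _ Op).2|exact: (C1_cont (cw (dx i)) Op)].
have key p : Omega g p -> grad_dot be w1 p - grad_dot al W p =
    W p * ('D_1 (fun r => 'D_1 F r) (w1 p)) * grad_sq w1 p.
  move=> Op.
  have Db v : 'D_v be p * 'D_v w1 p - 'D_v al p * 'D_v W p =
      W p * ('D_1 (fun r => 'D_1 F r) (w1 p)) * 'D_v w1 p ^+ 2.
    have -> : 'D_v be p = W p * ('D_1 (fun r => 'D_1 F r) (w1 p) * 'D_v w1 p) + 'D_1 F (w1 p) * 'D_v W p.
      by rewrite (derive_mul v cW cF1w Op) (DF1w p v Op).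
    by rewrite (Dal p v Op); ring.
  rewrite /grad_dot /grad_sq mulrDr mulr_sumr -Db opprD addrACA -sumrB; congr (_ + _).
  by apply: eq_bigr => i _; exact: Db.
have dF0 z : z < 0 -> 0 <= dFl z.
  move=> z0; have cg1 := cgd be w1 z z0 cbe cD1; have cg2 := cgd al W z z0 cal cDW.
  rewrite /dFl -(torus_intB cg1 cg2); apply: torus_int_ge0 => [|x cx].
    exact: (cube_continuousD cg1 (cube_continuousN cg2)).
  have Op := Lev z x z0; rewrite key// mulr_ge0 ?grad_sq_ge0// mulr_ge0//.
  by apply: W0 => //; exact: ltW.
have cF0 : {for 0, continuous Fl}.
  apply: contB.
    by apply: (flux_level_continuous0 cg hw1 oU gU) => p Up; exact: C1_cont cbeU Up.
  by apply: (flux_level_continuous0 cg hW oU gU) => p Up; exact: C1_cont calU Up.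
have mono := nondecreasing_npos dF dF0 cF0.
have [M M0 HM] := cube_bounded (continuous_cube (C1_setT_continuous ch)).
have [M' M'0 HM'] := cube_bounded (continuous_cube (C1_setT_continuous ch')).
have phiM := harmonic_ext_max ch ph hphi HM.
have phiM' := harmonic_ext_max ch' ph' hphi' HM'.
have [A A0 FA] := C1_bounded M' cF.
(* The bound on [|W|] given by the maximum principle for [phi'] and [phi]; then [A + WM * A] bounds
   both weights [al] and [be]. *)
pose WM := M' + 2 * M + M + eps.
have WM0 : 0 <= WM by rewrite /WM; lra.
have F0 : 0 <= Fl 0.
  apply/ler_addgt0Pl => d d0.
  have [||||||z zL H] := @flux_decay R n be al w1 W e g (A + WM * A) 12 cg hw1 hW fe _ _ _ _ _ _ d 0 d0.
  - by move=> p Op; exact: C1_cont cbe Op.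
  - by move=> p Op; exact: C1_cont cal Op.
  - by rewrite addr_ge0// mulr_ge0.
  - by [].
  - move=> [x y] /= cx Oy; have yg : y < g x := Oy; rewrite gE in yg.
    have y1 : y + c1 <= h' x by lra.
    have y2 : y <= h x by have := gh x; lra.
    have y3 : y - c2 <= h x by lra.
    have := phiM' x _ cx y1; have := phiM x _ cx y2; have := phiM x _ cx y3.
    rewrite /be /al WE /w1 vshiftE => P3 P2 P1; have [FA1 FA2] := FA _ P1.
    split; last by apply: le_trans FA1 _; rewrite lerDl mulr_ge0.
    rewrite normrM; apply: le_trans (_ : WM * A <= _); last by rewrite lerDr.
    apply: ler_pM => //; rewrite ler_norml in P1; rewrite ler_norml in P2; rewrite ler_norml in P3.
    by rewrite ler_norml /WM; case/andP: P1 => ? ?; case/andP: P2 => ? ?; case/andP: P3 => ? ?; apply/andP; split; lra.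
  - move=> p Op; split; last exact: gW.
    by have [H1 _ _] := e_ge p; apply: le_trans H1 _; rewrite ler_peMl// ler1n.
  move: H; rewrite ler_norml => /andP[H _].
  by have := mono z 0 (ltW zL) (lexx _); rewrite -/(Fl z) in H; lra.
move: F0; rewrite /Fl level0 subr_ge0 => F0.
have Dg1 x : DtN g w1 x = DtN h' phi' x.
  by rewrite (DtN_vshift _ _ _ cg) /g level_level addNr level0.
have Dg3 x : DtN g w3 x = DtN (level h' (- c1 - c2)) phi x.
  by rewrite (DtN_vshift _ _ _ cg) /g level_level.
have DgW x : DtN g W x = DtN h' phi' x - 2 * DtN g phi x + DtN (level h' (- c1 - c2)) phi x.
  rewrite /W (DtN_lin _ _ cg h123 (harmonic_below_cst g 1)) (DtN_lin _ _ cg h12 hw3) (DtN_lin _ _ cg hw1 hw2).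
  rewrite Dg1 Dg3 (_ : DtN g (fun=> 1) x = 0); last first.
    by rewrite /DtN derive_cst big1 ?subrr// => i _; rewrite derive_cst mulr0.
  by ring.
have w1g x : w1 (x, g x) = h' x by rewrite /w1 vshiftE gE subrK phih'.
move: F0; rewrite /flux.
rewrite (@eq_torus_int R n _ (fun x => F (h' x) * (DtN h' phi' x - 2 * DtN (level h' (- c1)) phi x
      + DtN (level h' (- c1 - c2)) phi x))); last by move=> x _; rewrite /al w1g DgW.
rewrite (@eq_torus_int R n (fun x => be (x, g x) * _) (fun x => (h' x - 2 * phi (x, h' x - c1) + phi (x, h' x - c1 - c2) + eps)
      * 'D_1 F (h' x) * DtN h' phi' x)) //.
by move=> x _; rewrite /be w1g Dg1 WgE.
Qed.

End Comparison.

(** * First-order expansion in time *)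

Section Quotients.
Variables (R : realType) (V : normedModType R).

Lemma C1_Ck_on1 (U : set V) (f : V -> R) : C1 U f -> Ck_on 1 U f.
Proof.
move=> cf; split=> [[|//] v x _ Ux|[|v [|//]] x _ Ux] /=.
- by apply: diff_derivable; exact: (cf x Ux).1.
- exact: C1_cont cf Ux.
- exact: (cf x Ux).2.
Qed.

(** The base point moves along with the step: uniform convergence on the cube requires difference
    quotients that converge jointly in the step and the point. *)
Lemma quotient_cvg (U : set V) (f : V -> R) (v p0 : V) (I : Type) (G : set_system I)
    (p : I -> V) (r : I -> R) {FG : Filter G} : open U -> C1 U f -> U p0 ->
  p @ G --> p0 -> r @ G --> 0 -> (\forall i \near G, r i != 0) ->
  (r i)^-1 * (f (p i + r i *: v) - f (p i)) @[i --> G] --> 'D_v f p0.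
Proof.
move=> oU cf Up0 pp0 r0 rn0; apply/cvgrPdist_le => e e0.
have [d d0 H] := Ck_on1_step v oU (C1_Ck_on1 cf) Up0 e0.
have /cvgrPdist_lt/(_ d d0) pd := pp0.
have /cvgrPdist_lt/(_ d d0) rd := r0.
near=> i.
have ri : r i != 0 by near: i.
have rp : 0 < `|r i| by rewrite normr_gt0.
have -> : 'D_v f p0 - (r i)^-1 * (f (p i + r i *: v) - f (p i)) =
   - ((r i)^-1 * (f (p i + r i *: v) - f (p i) - r i * 'D_v f p0)) by field.
rewrite normrN normrM normfV ler_pdivrMl// [leRHS]mulrC; apply: H.
  by rewrite distrC; near: i.
by rewrite -normrN -sub0r; near: i.
Unshelve. all: by end_near. Qed.

End Quotients.

Section NearCube.
Variables (R : realType) (n : nat) (I : Type) (F : set_system I).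
Context {FF : Filter F}.

Lemma near_cube_lt (k : I -> 'rV[R]_n -> R) (k0 : 'rV[R]_n -> R) (c : R) :
  (forall x, cube x -> (fun p : I * 'rV[R]_n => k p.1 p.2) @ filter_prod F (nbhs x) --> k0 x) ->
  (forall x, cube x -> k0 x < c) -> \forall i \near F, forall x, cube x -> k i x < c.
Proof.
move=> kk kc; have /compact_near_coveringP K := @compact_cube R n.
apply: (K _ F (fun i x => k i x < c)) => x cx.
have /cvgrPdist_lt/(_ (c - k0 x)) := kk x cx.
rewrite subr_gt0 kc// => /(_ isT) [[A B] /= [FA xB] AB].
exists (B, A) => //= -[y i] /= [By Ai].
by have := AB (i, y) (conj Ai By); rewrite /= ltr_norml => /andP[+ _]; lra.
Qed.

End NearCube.

Section SecondVariation.
Variables (R : realType) (n : nat).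
Local Notation X := ('rV[R]_n * R)%type.
Local Notation e_ := (e_ R).
Local Notation dx := (dx R).
Local Notation dy := (dy R n).
Local Notation dt := ((1, 0) : R * 'rV[R]_n).
Implicit Types (phi : X -> R) (g h q : 'rV[R]_n -> R) (f : R * 'rV[R]_n -> R).

Lemma C1_slice (O : set (R * 'rV[R]_n)) f t : open O -> C1 O f -> (forall x, O (t, x)) ->
  C1 setT (fun x => f (t, x)) /\ forall x v, 'D_v (fun x => f (t, x)) x = 'D_(0, v) f (t, x).
Proof.
move=> oO cf Ot.
have D x v : 'D_v (fun x => f (t, x)) x = 'D_(0, v) f (t, x).
  apply: eq_derive_reparam => r; congr f.
  by apply/pair_equal_spec; split => //=; rewrite scaler0 add0r.
have cp (x : 'rV[R]_n) : {for x, continuous (fun x => (t, x))}.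
  by apply: cont_pair; [exact: cont_cst|exact: cont_id].
split=> //; apply: (C1_intro (D := fun v x => 'D_(0, v) f (t, x))) => //.
- exact: openT.
- move=> x _; apply: (@differentiable_comp _ _ _ _ (fun x => (t, x)) f); last exact: (cf _ (Ot x)).1.
  by apply: differentiable_pair.
- move=> x v _; apply: (@cont_comp _ _ _ _ (fun x => (t, x)) (fun p => 'D_(0, v) f p)); first exact: cp.
  exact: (cf _ (Ot x)).2.
Qed.

Lemma cvg_le_cst (I : Type) (G : set_system I) (f : I -> R) (l b : R) {FG : ProperFilter G} :
  f @ G --> l -> (\forall i \near G, f i <= b) -> l <= b.
Proof.
move=> fl fb; apply/ler_addgt0Pr => e e0.
have /cvgrPdist_le/(_ e e0) H := fl.
have [i [/= H1 H2]] := filter_ex (filterI H fb).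
by move: H1; rewrite ler_norml => /andP[_]; lra.
Qed.

Lemma le0_of_small (x C : R) : (forall e, 0 < e -> x <= e * C) -> x <= 0.
Proof.
move=> H; rewrite leNgt; apply/negP => x0.
have C1 : 0 < `|C| + 1 by rewrite ltr_wpDl.
have := H (x / (2 * (`|C| + 1))) (divr_gt0 x0 (mulr_gt0 (ltr0n _ 2) C1)).
rewrite leNgt => /negP; apply.
apply: le_lt_trans (_ : x / (2 * (`|C| + 1)) * (`|C| + 1) < _).
  rewrite ler_wpM2l//; first by rewrite divr_ge0 ?(ltW x0)// mulr_ge0// ltW.
  by rewrite (le_trans (ler_norm C))// lerDl.
rewrite (_ : _ * _ = x / 2); last by field; rewrite gt_eqF.
by rewrite ltr_pdivrMr// ltr_pMr// ltr1n.
Qed.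

Lemma cvg_pair_at (I : Type) (F : set_system I) (T U : topologicalType)
    (f : I -> T) (g : I -> U) (a : T) (b : U) {FF : Filter F} :
  f @ F --> a -> g @ F --> b -> (fun i => (f i, g i)) @ F --> (a, b).
Proof. exact: cvg_pair. Qed.

(** * Joint limits in the time step and the base point *)

Section Limits.
Variables (O : set (R * 'rV[R]_n)) (H : R * 'rV[R]_n -> R) (s : R).
Hypotheses (oO : open O) (Os : forall x, O (s, x)) (cH : C1 O H)
  (cHt : C1 O (fun p => 'D_dt H p)).
Variables (x0 : 'rV[R]_n).
Local Notation G := (filter_prod (0 : R)^'+ (nbhs x0)).

Lemma cvg_shift_time : (fun p : R * 'rV[R]_n => (s + p.1, p.2)) @ G --> (s, x0).
Proof.
apply: (@cvg_pair_at _ G _ _ (fun p => s + p.1) snd); last exact: cvg_snd.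
rewrite -[X in _ --> X](addr0 s); apply: (@cvgD _ _ _ G _ (fun=> s) fst); first exact: cvg_cst.
by apply: (cvg_trans cvg_fst); exact: cvg_within.
Qed.

Lemma cvg_base_point : (fun p : R * 'rV[R]_n => (s, p.2)) @ G --> (s, x0).
Proof. by apply: (@cvg_pair_at _ G _ _ (fun=> s) snd); [exact: cvg_cst|exact: cvg_snd]. Qed.

Lemma cvg_time f : {for (s, x0), continuous f} ->
  (fun p : R * 'rV[R]_n => f (s + p.1, p.2)) @ G --> f (s, x0).
Proof.
move=> cf; apply: (@cvg_comp_at _ G _ _ (fun p : R * 'rV[R]_n => (s + p.1, p.2)) f) => //.
exact: cvg_shift_time.
Qed.

Lemma cvg_space f : {for (s, x0), continuous f} ->
  (fun p : R * 'rV[R]_n => f (s, p.2)) @ G --> f (s, x0).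
Proof.
move=> cf; apply: (@cvg_comp_at _ G _ _ (fun p : R * 'rV[R]_n => (s, p.2)) f) => //.
exact: cvg_base_point.
Qed.

Lemma near_fst_gt0 : \forall p \near G, 0 < p.1.
Proof.
exists ([set d | 0 < d], setT) => /=; last by move=> [d x] /= [].
by split; [exact: nbhs_right_gt|exact: filterT].
Qed.

Lemma cvg_fst_right : (fun p : R * 'rV[R]_n => p.1) @ G --> (0 : R).
Proof. by apply: (cvg_trans cvg_fst); exact: cvg_within. Qed.

Lemma cvg_time_quotient f : C1 O f ->
  (fun p : R * 'rV[R]_n => p.1^-1 * (f (s + p.1, p.2) - f (s, p.2))) @ G --> 'D_dt f (s, x0).
Proof.
move=> cf.
have E (p : R * 'rV[R]_n) : (s, p.2) + p.1 *: dt = (s + p.1, p.2).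
  by apply/pair_equal_spec; split => /=; rewrite ?scaler0 ?addr0// [_ *: 1]mulr1.
have -> : (fun p : R * 'rV[R]_n => p.1^-1 * (f (s + p.1, p.2) - f (s, p.2))) =
    (fun p => p.1^-1 * (f ((s, p.2) + p.1 *: dt) - f (s, p.2))).
  by apply/funext => p; rewrite E.
have p0 : \forall p \near G, p.1 != 0.
  by have := near_fst_gt0; apply: filterS => p p0; rewrite gt_eqF.
exact: (quotient_cvg oO cf (Os x0) cvg_base_point cvg_fst_right p0).
Qed.

(** The quotient by [d] is [k] times the quotient by the actual vertical step [d * k]; the condition
    [q0 != 0] keeps this step nonzero near the limit. *)
Lemma cvg_graph_quotient (U : set X) phi (q0 : R) (k : R -> 'rV[R]_n -> R) :
  open U -> C1 U phi -> U (x0, H (s, x0)) -> q0 != 0 ->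
  (fun p : R * 'rV[R]_n => k p.1 p.2) @ G --> q0 ->
  (fun p : R * 'rV[R]_n => p.1^-1 * (phi (p.2, H (s, p.2) + p.1 * k p.1 p.2) - phi (p.2, H (s, p.2)))) @ G
    --> q0 * 'D_dy phi (x0, H (s, x0)).
Proof.
move=> oU cphi Ux q00 kq.
have pp : (fun p : R * 'rV[R]_n => (p.2, H (s, p.2))) @ G --> (x0, H (s, x0)).
  apply: (@cvg_pair_at _ G _ _ snd (fun p => H (s, p.2))); first exact: cvg_snd.
  by apply: (@cvg_space H); exact: C1_cont cH (Os x0).
have rr : (fun p : R * 'rV[R]_n => p.1 * k p.1 p.2) @ G --> 0.
  by rewrite -[X in _ --> X](mul0r q0); apply: (@cvgM _ _ G _ fst (fun p => k p.1 p.2)) => //; exact: cvg_fst_right.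
have kn0 : \forall p \near G, k p.1 p.2 != 0 by exact: (cvgr_neq0 q0 kq q00).
have rn0 : \forall p \near G, p.1 * k p.1 p.2 != 0.
  have := near_fst_gt0; apply: filter_app; apply: filterS kn0 => p k0 p0.
  by rewrite mulf_neq0// gt_eqF.
have L := quotient_cvg (v := dy) oU cphi Ux pp rr rn0.
have LL : (fun p : R * 'rV[R]_n => k p.1 p.2 * ((p.1 * k p.1 p.2)^-1 *
    (phi ((p.2, H (s, p.2)) + (p.1 * k p.1 p.2) *: dy) - phi (p.2, H (s, p.2))))) @ G -->
    q0 * 'D_dy phi (x0, H (s, x0)).
  exact: (@cvgM _ _ G _ _ _ _ _ kq (L _)).
apply: cvg_trans LL; apply: near_eq_cvg.
have := near_fst_gt0; apply: filter_app; apply: filterS kn0 => p k0 p0 /=.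
have -> : (p.2, H (s, p.2)) + (p.1 * k p.1 p.2) *: dy = (p.2, H (s, p.2) + p.1 * k p.1 p.2).
  by apply/pair_equal_spec; split => /=; rewrite ?scaler0 ?addr0// [_ *: 1]mulr1.
by rewrite invfM mulrCA !mulrA; congr (_ * _); field; rewrite k0 gt_eqF.
Qed.

End Limits.

End SecondVariation.

(** * Transport of a flux between two graphs *)

Section FluxTransport.
Variables (R : realType) (n : nat).
Local Notation X := ('rV[R]_n * R)%type.
Local Notation e_ := (e_ R).
Local Notation dx := (dx R).
Local Notation dy := (dy R n).
Local Notation dt := ((1, 0) : R * 'rV[R]_n).
Implicit Types (phi : X -> R) (g h q : 'rV[R]_n -> R) (f : R * 'rV[R]_n -> R).

Lemma C1_fst h : C1 setT h ->
  C1 setT (fun p : X => h p.1) /\ forall (p v : X), 'D_v (fun p : X => h p.1) p = 'D_(v.1) h p.1.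
Proof.
move=> ch.
have D (p v : X) : 'D_v (fun p : X => h p.1) p = 'D_(v.1) h p.1 by exact: eq_derive_reparam.
have dfst (p : X) : differentiable (fun p : X => p.1) p.
  have L : linear (fun p : X => p.1) by [].
  pose LM := GRing.isLinear.Build _ _ _ _ (fun p : X => p.1) L.
  pose LP : {linear X -> 'rV[R]_n} := HB.pack (fun p : X => p.1) LM.
  by apply: (@linear_differentiable _ _ _ LP) => z; exact: cont_fst.
split=> //; apply: (C1_intro (D := fun v p => 'D_(v.1) h p.1)) => //.
- exact: openT.
- move=> p _; apply: (@differentiable_comp _ _ _ _ (fun p : X => p.1) h); first exact: dfst.
  exact: (ch _ I).1.
- move=> p v _; apply: (@cont_comp _ _ _ _ (fun p : X => p.1) (fun x => 'D_(v.1) h x)).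
    exact: cont_fst.
  exact: (ch _ I).2.
Qed.

Lemma cvg_bigsum (J : finType) (I : Type) (F : set_system I) (f : J -> I -> R) (l : J -> R)
    {FF : Filter F} : (forall j, f j @ F --> l j) ->
  (fun i => \sum_j f j i) @ F --> \sum_j l j.
Proof.
move=> fl; elim: (index_enum J) => [|j r IH].
  rewrite big_nil (_ : (fun i => _) = fun=> 0); first exact: cvg_cst.
  by apply/funext => i; rewrite big_nil.
rewrite big_cons (_ : (fun i => _) = (fun i => f j i + \sum_(k <- r) f k i)).
  exact: (@cvgD _ _ _ F _ _ _ _ _ (fl j) IH).
by apply/funext => i; rewrite big_cons.
Qed.

Variables (O : set (R * 'rV[R]_n)) (H : R * 'rV[R]_n -> R) (s c : R) (F : R -> R) (phi : X -> R).
Hypotheses (oO : open O) (Os : forall x, O (s, x)) (cH : C1 O H) (cF : @C1 R R^o setT F).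
Let hs x := H (s, x).
Let hd (d : R) x := H (s + d, x).
(** Chosen so that [graph_family hs (q d)] leads from [hs] at parameter [0] to the graph of
    [hd d - d * c] at parameter [d]. For [c] large, [q < 0] and the whole path stays below [hs]. *)
Let q (d : R) x := d^-1 * (hd d x - hs x) - c.
Hypotheses (ps : Defs.periodic hs) (hb : harmonic_below hs phi)
  (nearO : \forall d \near (0 : R)^'+, (forall x, O (s + d, x)) /\ Defs.periodic (hd d))
  (nearq : \forall d \near (0 : R)^'+, forall x, q d x < 0).

(** The rate, at parameter [xi] of this path, of the flux of [F(hd d) grad phi]: the scalar product
    of the gradients of weight and [phi], times the vertical speed. *)
Definition transport_integrand (d xi : R) x : R :=
  (\sum_i ('D_1 F (hd d x) * 'D_(0, e_ i) H (s + d, x)) * 'D_(dx i) phi (x, hs x + xi * q d x)) * q d x.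

Definition transport_limit : R :=
  torus_int (fun x => (\sum_i ('D_1 F (hs x) * 'D_(0, e_ i) H (s, x)) * 'D_(dx i) phi (x, hs x)) *
    ('D_dt H (s, x) - c)).

Let chs : C1 setT hs. Proof. exact: (C1_slice oO cH Os).1. Qed.

(** [d] and [xi] tend to zero independently, since the intermediate parameter delivered by the mean
    value theorem is known only to satisfy [0 < xi < d]. *)
Lemma cvg_transport_integrand x0 :
  (fun p : (R * R) * 'rV[R]_n => transport_integrand p.1.1 p.1.2 p.2) @
    filter_prod (filter_prod (0 : R)^'+ (0 : R)^'+) (nbhs x0) -->
  (\sum_i ('D_1 F (hs x0) * 'D_(0, e_ i) H (s, x0)) * 'D_(dx i) phi (x0, hs x0)) *
    ('D_dt H (s, x0) - c).
Proof.
set G2 := filter_prod _ _.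
have F2 : Filter G2 by exact: filter_prod_filter.
have pi : (fun p : (R * R) * 'rV[R]_n => (p.1.1, p.2)) @ G2 --> filter_prod (0 : R)^'+ (nbhs x0).
  move=> A [[B C] /= [B0 Cx] BC].
  exists ([set p | B p.1], C) => /=.
    split=> //; exists (B, setT) => /=; first by split => //; exact: filterT.
    by move=> [a b] /= [].
  by move=> [[a b] x] /= [Ba Cx']; exact: (BC (a, x)).
have xi0 : (fun p : (R * R) * 'rV[R]_n => p.1.2) @ G2 --> (0 : R).
  move=> A A0; exists ([set p | p.2 \in A], setT) => /=; last by move=> [[a b] x] /= [+ _]; rewrite inE.
  split; last exact: filterT.
  exists (setT, A) => /=; last by move=> [a b] /= [_ Ab]; rewrite inE.
  by split; [exact: filterT|exact: (cvg_within _ A0)].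
have lift (f : R * 'rV[R]_n -> R) (l : R) : f @ filter_prod (0 : R)^'+ (nbhs x0) --> l ->
    (fun p : (R * R) * 'rV[R]_n => f (p.1.1, p.2)) @ G2 --> l.
  by move=> fl; exact: (cvg_comp _ _ pi fl).
have Hx : {for (s, x0), continuous H} by exact: C1_cont cH (Os x0).
have qL : (fun p : (R * R) * 'rV[R]_n => q p.1.1 p.2) @ G2 --> 'D_dt H (s, x0) - c.
  apply: (lift (fun p => q p.1 p.2)).
  apply: (@cvgB _ _ _ _ _ (fun p : R * 'rV[R]_n => p.1^-1 * (H (s + p.1, p.2) - H (s, p.2))) (fun=> c)); last exact: cvg_cst.
  exact: (cvg_time_quotient oO Os cH).
have hdL : (fun p : (R * R) * 'rV[R]_n => hd p.1.1 p.2) @ G2 --> hs x0.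
  by apply: (lift (fun p => hd p.1 p.2)); exact: (cvg_time Hx).
have hsL : (fun p : (R * R) * 'rV[R]_n => hs p.2) @ G2 --> hs x0.
  by apply: (lift (fun p => hs p.2)); exact: (cvg_space Hx).
have xL : (fun p : (R * R) * 'rV[R]_n => p.2) @ G2 --> x0 by exact: cvg_snd.
have gL : (fun p : (R * R) * 'rV[R]_n => (p.2, hs p.2 + p.1.2 * q p.1.1 p.2)) @ G2 --> (x0, hs x0).
  apply: (@cvg_pair_at _ G2 _ _ snd (fun p => hs p.2 + p.1.2 * q p.1.1 p.2)) => //.
  rewrite -[X in _ --> X](addr0 (hs x0)); apply: (@cvgD _ _ _ G2 _ (fun p => hs p.2)) => //.
  rewrite -[X in _ --> X](mul0r ('D_dt H (s, x0) - c)).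
  exact: (@cvgM _ _ G2 _ (fun p => p.1.2) (fun p => q p.1.1 p.2)).
apply: (@cvgM _ _ G2 _ (fun p => \sum_i ('D_1 F (hd p.1.1 p.2) * 'D_(0, e_ i) H (s + p.1.1, p.2)) *
  'D_(dx i) phi (p.2, hs p.2 + p.1.2 * q p.1.1 p.2)) (fun p => q p.1.1 p.2)) => //.
apply: cvg_bigsum => i.
apply: (@cvgM _ _ G2 _ (fun p => 'D_1 F (hd p.1.1 p.2) * 'D_(0, e_ i) H (s + p.1.1, p.2))
  (fun p => 'D_(dx i) phi (p.2, hs p.2 + p.1.2 * q p.1.1 p.2))).
  apply: (@cvgM _ _ G2 _ (fun p => 'D_1 F (hd p.1.1 p.2)) (fun p => 'D_(0, e_ i) H (s + p.1.1, p.2))).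
    by apply: (@cvg_comp_at _ G2 _ _ _ (fun r => 'D_1 F r)); [exact: hdL|exact: (cF I).2].
  apply: (lift (fun p => 'D_(0, e_ i) H (s + p.1, p.2))).
  exact: (cvg_time ((cH (Os x0)).2 _)).
apply: (@cvg_comp_at _ G2 _ _ _ (fun p => 'D_(dx i) phi p)); first exact: gL.
exact: (harmonic_below_cont x0 chs hb).2.
Qed.

(** The mean value theorem on the path of graphs, followed by convergence of its rate. It is the
    extension [phi] at time [s] whose flux is transported, so no dependence of the extension on time
    is involved. *)
Lemma flux_transport eta : 0 < eta -> \forall d \near (0 : R)^'+,
  `|torus_int (fun x => F (hd d x) * DtN (level (hd d) (- (d * c))) phi x) -
    torus_int (fun x => F (hd d x) * DtN hs phi x) - d * transport_limit| <= eta * d.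
Proof.
move=> eta0.
have [pphi [U [oU hU cU]] cD lp] := hb.
have oOm := open_Omega (C1_setT_continuous chs).
have Om d xi x : 0 < xi -> (forall x, q d x < 0) -> Omega hs (x, hs x + xi * q d x).
  by move=> xi0 qd; rewrite /Omega /= gtrDl pmulr_rlt0.
have cdata d : (forall x, O (s + d, x)) -> [/\ C1 setT (hd d), C1 setT (q d) &
    forall x v, 'D_v (hd d) x = 'D_(0, v) H (s + d, x)].
  move=> Od; have [chd Dhd] := C1_slice oO cH Od; split; [exact: chd| |exact: Dhd].
  have c1 : C1 setT (fun x => d^-1 * (hd d x - hs x)).
    by apply: (C1Z _ openT); exact: (C1B openT chd chs).
  exact: (C1B openT c1 (@C1_cst R _ setT c)).
have cvgT : (fun i : R * R => torus_int (transport_integrand i.1 i.2)) @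
    filter_prod (0 : R)^'+ (0 : R)^'+ --> transport_limit.
  apply: torus_int_cvg.
  - exists ([set d | (forall x, O (s + d, x)) /\ (forall x, q d x < 0)], [set xi | 0 < xi]) => /=.
      split; last exact: nbhs_right_gt.
      by apply: filter_app nearq; apply: filterS nearO => d [Od _].
    move=> [d xi] /= [[Od qd] xi0]; have [chd cq Dhd] := cdata d Od.
    have cfg : C1 setT (graph_family hs (q d) xi) by exact: C1_graph_family.
    apply: cube_continuousM; last exact: (continuous_cube (C1_setT_continuous cq)).
    apply: (@cube_continuous_sum R n _ (fun i x => ('D_1 F (hd d x) * 'D_(0, e_ i) H (s + d, x)) * 'D_(dx i) phi (x, hs x + xi * q d x))) => i.
    apply: (@cube_continuousM R n (fun x => 'D_1 F (hd d x) * 'D_(0, e_ i) H (s + d, x)) (fun x => 'D_(dx i) phi (x, hs x + xi * q d x))).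
      apply: (@cube_continuousM R n (fun x => 'D_1 F (hd d x)) (fun x => 'D_(0, e_ i) H (s + d, x))).
        move=> x _; apply: (@cont_comp _ _ _ _ (hd d) (fun r => 'D_1 F r)); last exact: (cF I).2.
        exact: C1_setT_continuous.
      move=> x _; rewrite (_ : (fun x => _) = (fun x => 'D_(e_ i) (hd d) x)).
        exact: C1_setT_derive_continuous.
      by apply/funext => z; rewrite Dhd.
    move=> x _; apply: (@C1_setT_continuous R _ (fun x => 'D_(dx i) phi (x, hs x + xi * q d x))).
    apply: (C1_graph oOm (cD (dx i)) cfg) => z; exact: Om.
  - apply: cube_continuousM.
      apply: (@cube_continuous_sum R n _ (fun i x => ('D_1 F (hs x) * 'D_(0, e_ i) H (s, x)) * 'D_(dx i) phi (x, hs x))) => i x _.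
      apply: (@contM _ _ x (fun x => 'D_1 F (hs x) * 'D_(0, e_ i) H (s, x)) (fun x => 'D_(dx i) phi (x, hs x))).
        apply: (@contM _ _ x (fun x => 'D_1 F (hs x)) (fun x => 'D_(0, e_ i) H (s, x))).
          apply: (@cont_comp _ _ _ _ hs (fun r => 'D_1 F r)); last exact: (cF I).2.
          exact: C1_setT_continuous.
        rewrite (_ : (fun x => 'D_(0, e_ i) H (s, x)) = (fun x => 'D_(e_ i) hs x)).
          exact: C1_setT_derive_continuous.
        by apply/funext => z; rewrite (C1_slice oO cH Os).2.
      apply: (@cont_comp _ _ _ _ (fun x => (x, hs x)) (fun p => 'D_(dx i) phi p)).
        by apply: cont_pair; [exact: cont_id|exact: C1_setT_continuous].
      exact: (harmonic_below_cont x chs hb).2.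
    move=> x _; apply: contB; last exact: cont_cst.
    apply: (@cont_comp _ _ _ _ (fun x => (s, x)) (fun p => 'D_dt H p)).
      by apply: cont_pair; [exact: cont_cst|exact: cont_id].
    exact: (cH (Os x)).2.
  - by move=> x _; exact: cvg_transport_integrand.
have /cvgrPdist_le/(_ eta eta0) [[A B] /= [A0 B0] AB] := cvgT.
have [r /= r0 rB] := B0.
near=> d.
have [Od pd] : (forall x, O (s + d, x)) /\ Defs.periodic (hd d) by near: d; exact: nearO.
have qd : forall x, q d x < 0 by near: d; exact: nearq.
have d0 : 0 < d by near: d; exact: nbhs_right_gt.
have dr : d < r by near: d; exact: nbhs_right_lt.
have Ad : A d by near: d; exact: A0.
have [chd cq Dhd] := cdata d Od.
have pq : Defs.periodic (q d) by move=> i x; rewrite /q pd ps.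
have [cFh DFh] := C1_comp openT cF chd.
have [crho Drho] := C1_fst cFh.
(* The weight is extended constantly in [y]: it is the same on every graph of the path, and its
   gradient is horizontal. *)
pose rho (p : X) := F (hd d p.1).
have prho : periodic2 rho by move=> i x y; rewrite /rho /= pd.
pose Fl sg := flux rho phi (graph_family hs (q d) sg).
have dFl (sg : R) : 0 < sg -> is_derive sg 1 Fl (torus_int (transport_integrand d sg)).
  move=> sg0; have crO : C1 (Omega hs) rho by apply: C1_subset crho.
  have dfl := flux_is_derive oOm crO cD lp prho pphi chs cq ps pq (fun x => Om d sg x sg0 qd).
  apply: (is_derive_eq dfl); apply: eq_torus_int => x _; rewrite /transport_integrand; congr (_ * _).
  rewrite /grad_dot Drho /= derive0 mul0r addr0; apply: eq_bigr => i _.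
  by rewrite Drho /= DFh// Dhd.
have cFl0 : {for 0, continuous Fl}.
  apply: (@flux_continuous R n U) => //.
  - by move=> p _; exact: (C1_cont crho).
  - by move=> p v Up; exact: (cU _ Up).2.
  - by move=> x; apply: hU; rewrite /Omega_closure /graph_family /= mul0r addr0.
have [||xi] := @MVT R Fl (fun sg => torus_int (transport_integrand d sg)) 0 d d0.
- by move=> sg; rewrite in_itv /= => /andP[sg0 _]; exact: dFl.
- apply: continuous_within_segment => sg /andP[+ _]; rewrite le_eqVlt => /predU1P[<-//|sg0].
  by have := dFl sg sg0 => ?; apply/differentiable_continuous/derivable1_diffP.
rewrite in_itv /= subr0 => /andP[xi0 xid] E.
have -> : torus_int (fun x => F (hd d x) * DtN (level (hd d) (- (d * c))) phi x) = Fl d.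
  rewrite /Fl /flux; congr torus_int; apply/funext => x.
  have -> : level (hd d) (- (d * c)) = graph_family hs (q d) d; last by [].
  by apply/funext => z; rewrite levelE /graph_family /q; field; rewrite gt_eqF.
have -> : torus_int (fun x => F (hd d x) * DtN hs phi x) = Fl 0.
  rewrite /Fl /flux; congr torus_int; apply/funext => x.
  by have -> : graph_family hs (q d) 0 = hs by apply/funext => z; rewrite /graph_family mul0r addr0.
rewrite E [_ * d]mulrC -mulrBr normrM (gtr0_norm d0) mulrC ler_wpM2r ?(ltW d0)//.
rewrite distrC; apply: (AB (d, xi)); split => //=.
by apply: rB => //=; rewrite sub0r normrN gtr0_norm// (lt_trans xid).
Unshelve. all: by end_near. Qed.

End FluxTransport.

(** * The second variation *)

Section SecondVariationInequality.
Variables (R : realType) (n : nat).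
Local Notation X := ('rV[R]_n * R)%type.
Local Notation e_ := (e_ R).
Local Notation dx := (dx R).
Local Notation dy := (dy R n).
Local Notation dt := ((1, 0) : R * 'rV[R]_n).
Local Notation G x := (filter_prod (0 : R)^'+ (nbhs x)).

Lemma DtN_periodic i x (g : 'rV[R]_n -> R) (w : X -> R) : Defs.periodic g -> periodic2 w ->
  DtN g w (x + e_ i) = DtN g w x.
Proof.
move=> pg pw; rewrite /DtN pg; congr (_ - _); first exact: (derive_periodic2 _ pw).
apply: eq_bigr => j _; congr (_ * _); first exact: (derive_periodic _ pg).
exact: (derive_periodic2 _ pw).
Qed.

(** Here [P = d_t h], [Q = d_t d_t h], [f = F(h)] and [f1 = F'(h)]. Once [eta] is removed, the claim
    follows from [(B + P) - (B + P) P + P^2 = N], which leaves the integral of [f1 N (1 + P)] as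
    lower bound. *)
Lemma second_variation_arith (f Q f1 B P : 'rV[R]_n -> R) :
  let N x := B x + P x - B x * P x in
  cube_continuous f -> cube_continuous Q -> cube_continuous f1 -> cube_continuous B ->
  cube_continuous P -> (forall x, 0 <= f1 x) -> (forall x, 0 <= N x) ->
  (forall x, cube x -> 0 <= 1 + P x) ->
  (forall eta, 0 < eta -> - torus_int (fun x => f x * Q x) +
    torus_int (fun x => (N x + eta) * f1 x * P x) <=
    torus_int (fun x => f1 x * ((B x + P x) * P x)) - torus_int (fun x => f1 x * (B x + P x)) + 3 * eta) ->
  0 <= torus_int (fun x => f x * Q x + f1 x * P x ^+ 2).
Proof.
move=> N cf cQ cf1 cB cP f10 N0 P1 key.
have cBP : cube_continuous (fun x => B x + P x) by exact: cube_continuousD.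
have cN : cube_continuous N.
  apply: cube_continuousD; first exact: cBP.
  by apply: cube_continuousN; exact: (cube_continuousM cB cP).
have cA1 : cube_continuous (fun x => f1 x * ((B x + P x) * P x)).
  by apply: cube_continuousM; [exact: cf1|exact: (cube_continuousM cBP cP)].
have cA2 : cube_continuous (fun x => f1 x * (B x + P x)) by exact: (cube_continuousM cf1 cBP).
have c3 : cube_continuous (fun x => N x * f1 x * P x).
  exact: (cube_continuousM (cube_continuousM cN cf1) cP).
have c4 : cube_continuous (fun x => f1 x * P x) by exact: (cube_continuousM cf1 cP).
have c5 : cube_continuous (fun x => f x * Q x) by exact: (cube_continuousM cf cQ).
have c6 : cube_continuous (fun x => f1 x * P x ^+ 2).
  exact: (cube_continuousM cf1 (cube_continuousM cP cP)).
pose A1 := torus_int (fun x => f1 x * ((B x + P x) * P x)).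
pose A2 := torus_int (fun x => f1 x * (B x + P x)).
pose A3 := torus_int (fun x => N x * f1 x * P x).
pose A4 := torus_int (fun x => f1 x * P x).
have small : - torus_int (fun x => f x * Q x) + A3 - A1 + A2 <= 0.
  apply: (le0_of_small (C := 3 - A4)) => eta eta0; have := key eta eta0.
  have -> : torus_int (fun x => (N x + eta) * f1 x * P x) = A3 + eta * A4.
    rewrite /A3 /A4 -torus_intZ// -torus_intD//; last first.
      by apply: cube_continuousM => //; exact: cube_continuous_cst.
    by congr torus_int; apply/funext => x; ring.
  by rewrite -/A1 -/A2; lra.
have pos : 0 <= torus_int (fun x => f1 x * (N x * (1 + P x))).
  apply: torus_int_ge0 => [|x cx].
    apply: (cube_continuousM cf1); apply: (cube_continuousM cN).
    by apply: (cube_continuousD _ cP); exact: cube_continuous_cst.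
  by rewrite mulr_ge0// mulr_ge0// P1.
have c31 : cube_continuous (fun x => N x * f1 x * P x - f1 x * ((B x + P x) * P x)).
  by apply: (cube_continuousD c3); exact: cube_continuousN.
have E : torus_int (fun x => f1 x * (N x * (1 + P x))) =
    A3 - A1 + A2 + torus_int (fun x => f1 x * P x ^+ 2).
  rewrite /A3 /A1 /A2 -torus_intB// -torus_intD// -torus_intD//; last exact: cube_continuousD.
  by congr torus_int; apply/funext => x; rewrite /N; ring.
by rewrite torus_intD//; move: pos; rewrite E; move: small; lra.
Qed.

(** [P] and [W] are [d_t h] at times [s] and [s + d], [D1] and [D2] the flux densities of [phi]
    through the two lowered graphs, and [d b] the boundary value of the comparison function. At
    order zero [- W - 2 D1 + D2] leaves [- (W - P)]; at order one, [- 2 (A1 - K A2) + (A1 - (2 K -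
    1) A2) = A2 - A1], so [K] cancels. The two transport errors add up to [3 eta]. *)
Lemma comparison_arith (a f1 W P D1 D2 b : 'rV[R]_n -> R) (d eta K A1 A2 : R) :
  cube_continuous a -> cube_continuous f1 -> cube_continuous W -> cube_continuous P ->
  cube_continuous (fun x => a x * D1 x) -> cube_continuous (fun x => a x * D2 x) ->
  cube_continuous b -> 0 < d ->
  `|torus_int (fun x => a x * D1 x) - torus_int (fun x => a x * - P x) - d * (A1 - K * A2)| <= eta * d ->
  `|torus_int (fun x => a x * D2 x) - torus_int (fun x => a x * - P x) - d * (A1 - (K + (K - 1)) * A2)| <= eta * d ->
  torus_int (fun x => a x * (- W x - 2 * D1 x + D2 x)) <=
    torus_int (fun x => (d * b x + eta * d) * f1 x * - W x) ->
  - torus_int (fun x => a x * (d^-1 * (W x - P x))) + torus_int (fun x => (b x + eta) * f1 x * W x) <=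
    A1 - A2 + 3 * eta.
Proof.
move=> ca cf1 cW cP cL1 cL2 cb d0.
have cL0 : cube_continuous (fun x => a x * P x) by exact: (cube_continuousM ca cP).
have cL3 : cube_continuous (fun x => a x * W x) by exact: (cube_continuousM ca cW).
have cL1' : cube_continuous (fun x => - 2 * (a x * D1 x)).
  by apply: cube_continuousM => //; exact: cube_continuous_cst.
have cL3' : cube_continuous (fun x => - (a x * W x)) by exact: cube_continuousN.
pose L0 := torus_int (fun x => a x * P x); pose L3 := torus_int (fun x => a x * W x).
pose L1 := torus_int (fun x => a x * D1 x); pose L2 := torus_int (fun x => a x * D2 x).
have -> : torus_int (fun x => a x * - P x) = - L0.
  by rewrite /L0 -torus_intN//; congr torus_int; apply/funext => x; rewrite mulrN.
rewrite -/L1 -/L2.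
have -> : torus_int (fun x => a x * (- W x - 2 * D1 x + D2 x)) = - L3 + - 2 * L1 + L2.
  rewrite /L3 /L1 /L2 -torus_intN// -torus_intZ// -torus_intD// -torus_intD//; last exact: cube_continuousD.
  by congr torus_int; apply/funext => x; ring.
have -> : torus_int (fun x => a x * (d^-1 * (W x - P x))) = d^-1 * (L3 - L0).
  rewrite /L3 /L0 -torus_intB// -torus_intZ//; last by apply: (cube_continuousD cL3); exact: cube_continuousN.
  by congr torus_int; apply/funext => x; ring.
set Z := torus_int (fun x => (b x + eta) * _ * _).
have -> : torus_int (fun x => (d * b x + eta * d) * f1 x * - W x) = - d * Z.
  rewrite /Z -torus_intZ//; last first.
    apply: cube_continuousM => //; apply: cube_continuousM => //.
    by apply: cube_continuousD => //; exact: cube_continuous_cst.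
  by congr torus_int; apply/funext => x; ring.
have dn0 : d != 0 by rewrite gt_eqF.
rewrite !ler_norml mulNr => /andP[T1 T1'] /andP[T2 T2'] cmp.
by rewrite -(ler_pM2l d0) mulrDr mulrN mulVKf//; lra.
Qed.

Lemma cube_continuous_graph_quotient (h q : 'rV[R]_n -> R) (phi : X -> R) (d : R) : C1 setT h -> C1 setT q ->
  harmonic_below h phi -> 0 < d -> (forall x, q x < 0) ->
  cube_continuous (fun x => d^-1 * (phi (x, h x + d * q x) - phi (x, h x))).
Proof.
move=> ch cq hb d0 q0; have [_ [U [oU hU cU]] _ _] := hb.
have oOm := open_Omega (C1_setT_continuous ch).
have cphi : C1 (Omega h) phi.
  by apply: C1_subset cU => p; rewrite /Omega /= => pp; apply: hU; exact: ltW.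
apply: cube_continuousM; first exact: cube_continuous_cst.
apply: cube_continuousD.
  apply: (continuous_cube (@C1_setT_continuous R _ (fun x => phi (x, graph_family h q d x)) _)).
  have cg : C1 setT (graph_family h q d) by exact: C1_graph_family.
  apply: (C1_graph oOm cphi cg) => x.
  by rewrite /Omega /= gtrDl pmulr_rlt0.
apply: cube_continuousN; apply: (continuous_cube (@C1_setT_continuous R _ (fun x => phi (x, h x)) _)).
by apply: (C1_graph oU cU ch) => x; apply: hU; rewrite /Omega_closure /=.
Qed.

Variables (O : set (R * 'rV[R]_n)) (H : R * 'rV[R]_n -> R) (T : R).
Hypotheses (oO : open O) (OT : forall t x, 0 <= t <= T -> O (t, x))
  (cH : C1 O H) (cHt : C1 O (fun p => 'D_dt H p))
  (pH : forall t, 0 <= t <= T -> Defs.periodic (fun x => H (t, x)))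
  (sol : forall t, 0 <= t <= T -> exists phi,
    harmonic_ext (fun x => H (t, x)) (fun x => H (t, x)) phi /\
    forall x, 'D_dt H (t, x) + DtN (fun x => H (t, x)) phi x = 0).
Variable F : R -> R.
Hypotheses (cF : @C1 R R^o setT F) (cF1 : @C1 R R^o setT (fun r => 'D_1 F r))
  (F1 : forall r, 0 <= 'D_1 F r) (F2 : forall r, 0 <= 'D_1 (fun r => 'D_1 F r) r).

(** The comparison uses the solution at the later time [s + d], whence [s < T] and limits from the
    right only. *)
Lemma second_variation_ge0 s : 0 <= s -> s < T ->
  0 <= torus_int (fun x => F (H (s, x)) * 'D_dt (fun p => 'D_dt H p) (s, x) +
     'D_1 F (H (s, x)) * 'D_dt H (s, x) ^+ 2).
Proof.
move=> s0 sT.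
have sI : 0 <= s <= T by rewrite s0 ltW.
have Os x : O (s, x) := OT x sI.
have [phi [hphi uphi]] := sol sI.
pose hs x := H (s, x); pose P x := 'D_dt H (s, x).
pose Q x := 'D_dt (fun p => 'D_dt H p) (s, x).
pose B x := 'D_dy phi (x, hs x).
have [chs Dhs] := C1_slice oO cH Os.
have [cP _] := C1_slice oO cHt Os.
have ps : Defs.periodic hs := pH sI.
have hb := harmonic_ext_below chs hphi.
have [pphi [U [oU hU cU]] cD lp] := hb.
have oOm := open_Omega (C1_setT_continuous chs).
have [_ _ _ _ phih] := hphi.
have uE x : DtN hs phi x = - P x by have := uphi x; rewrite addrC => /eqP; rewrite addr_eq0 => /eqP.
have bd x := boundary_DtN x chs hphi.
have SE x : \sum_i 'D_(e_ i) hs x * 'D_(dx i) phi (x, hs x) = B x + P x.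
  by have [-> _ _] := bd x; rewrite -/hs uE opprK.
have NE x : grad_sq phi (x, hs x) = B x + P x - B x * P x.
  by have [_ -> _] := bd x; rewrite -/hs uE opprK mulrN.
have P1 x : cube x -> 0 <= 1 + P x.
  by move=> cx; have := DtN_le1 chs ps hphi cx; rewrite -/hs uE; lra.
have [M M0 HM] := cube_bounded (continuous_cube (C1_setT_continuous cP)).
(* [M] bounds [|d_t h|] on the cube. Exceeding it makes [h(s + d) - d K] lie below [h(s)] for small
   [d], and the second shift [K - 1] is nonnegative. *)
pose K := M + 2.
pose q c d x := d^-1 * (H (s + d, x) - H (s, x)) - c.
have nearI : \forall d \near (0 : R)^'+, 0 < d /\ 0 <= s + d <= T.
  near=> d; have d0 : 0 < d by near: d; exact: nbhs_right_gt.
  split=> //; rewrite addr_ge0 ?(ltW d0)//= -lerBrDl ltW//.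
  by near: d; apply: nbhs_right_lt; rewrite subr_gt0.
have nearO : \forall d \near (0 : R)^'+, (forall x, O (s + d, x)) /\ Defs.periodic (fun x => H (s + d, x)).
  by apply: filterS nearI => d [_ dI]; split => [x|]; [exact: OT|exact: pH].
have dqL x0 : (fun p : R * 'rV[R]_n => p.1^-1 * (H (s + p.1, p.2) - H (s, p.2))) @ G x0 --> P x0.
  exact: (cvg_time_quotient oO Os cH).
have nearqK : \forall d \near (0 : R)^'+, forall x, q K d x < 0.
  have : \forall d \near (0 : R)^'+, forall x, cube x -> d^-1 * (H (s + d, x) - H (s, x)) < K.
    apply: (@near_cube_lt R n _ _ _ (fun d x => d^-1 * (H (s + d, x) - H (s, x))) P) => [x _|x cx]; first exact: dqL.
    by have := HM x cx; rewrite -/(P x) ler_norml /K => /andP[_]; lra.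
  apply: filter_app; apply: filterS nearI => d [d0 dI] Hd.
  apply: periodic_cube => [i x|x cx]; last by rewrite /q subr_lt0; exact: Hd.
  have psx : H (s, x + e_ i) = H (s, x) := ps i x.
  have pdx : H (s + d, x + e_ i) = H (s + d, x) := pH dI i x.
  by rewrite /q pdx psx.
(* The total lowering for the third term of the comparison function. *)
pose K2 := K + (K - 1).
have K1 : 0 <= K - 1 by rewrite /K; lra.
have nearqK2 : \forall d \near (0 : R)^'+, forall x, q K2 d x < 0.
  by apply: filterS nearqK => d Hd x; have := Hd x; rewrite /q /K2; lra.
have PK x c : M < c -> P x - c != 0.
  move=> Mc; have : forall x, P x < c.
    apply: periodic_cube => [i y|y cy].
      (* Periodicity of [P] is read off the equation: that of [h] is assumed on [[0, T]], which is
         not a neighbourhood of [s = 0]. *)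
      by rewrite -(opprK (P (y + e_ i))) -(opprK (P y)) -!uE (DtN_periodic i y ps pphi).
    by have := HM y cy; rewrite -/(P y) ler_norml => /andP[_]; lra.
  by move=> /(_ x) Px; rewrite subr_eq0 lt_eqF.
have MK : M < K by rewrite /K; lra.
have MK2 : M < K2 by rewrite /K2; lra.
pose N x := B x + P x - B x * P x.
have N0 x : 0 <= N x by rewrite /N -NE grad_sq_ge0.
(* The boundary value of the comparison function divided by [d]. Since [phi = h(s)] on the graph and
   [1 - 2 + 1 = 0], the subtracted values cancel. *)
pose bq d x := d^-1 * (H (s + d, x) - H (s, x))
  + - 2 * (d^-1 * (phi (x, hs x + d * q K d x) - phi (x, hs x)))
  + d^-1 * (phi (x, hs x + d * q K2 d x) - phi (x, hs x)).
have bqL x0 : (fun p : R * 'rV[R]_n => bq p.1 p.2) @ G x0 --> N x0.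
  have qL c : (fun p : R * 'rV[R]_n => q c p.1 p.2) @ G x0 --> P x0 - c.
    apply: (@cvgB _ _ _ _ _ (fun p : R * 'rV[R]_n => p.1^-1 * (H (s + p.1, p.2) - H (s, p.2))) (fun=> c)); last exact: cvg_cst.
    exact: dqL.
  have Ux : U (x0, H (s, x0)) by apply: hU; rewrite /Omega_closure /=.
  have gq c : M < c -> (fun p : R * 'rV[R]_n => p.1^-1 * (phi (p.2, hs p.2 + p.1 * q c p.1 p.2) - phi (p.2, hs p.2)))
      @ G x0 --> (P x0 - c) * B x0.
    by move=> Mc; exact: (cvg_graph_quotient Os cH oU cU Ux (PK x0 c Mc) (qL c)).
  (* The coefficient of [B] is [2 K - K2 - P = 1 - P]. *)
  have -> : N x0 = P x0 + - 2 * ((P x0 - K) * B x0) + (P x0 - K2) * B x0 by rewrite /N /K2; ring.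
  apply: (@cvgD _ _ _ _ _ (fun p : R * 'rV[R]_n => p.1^-1 * (H (s + p.1, p.2) - H (s, p.2)) +
    - 2 * (p.1^-1 * (phi (p.2, hs p.2 + p.1 * q K p.1 p.2) - phi (p.2, hs p.2))))
    (fun p => p.1^-1 * (phi (p.2, hs p.2 + p.1 * q K2 p.1 p.2) - phi (p.2, hs p.2)))); last exact: gq.
  apply: (@cvgD _ _ _ _ _ (fun p : R * 'rV[R]_n => p.1^-1 * (H (s + p.1, p.2) - H (s, p.2)))
    (fun p => - 2 * (p.1^-1 * (phi (p.2, hs p.2 + p.1 * q K p.1 p.2) - phi (p.2, hs p.2))))); first exact: dqL.
  by apply: (@cvgM _ _ _ _ (fun=> - 2)); [exact: cvg_cst|exact: gq].
have cFhs : cube_continuous (fun x => F (hs x)).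
  move=> x _; apply: (@cont_comp _ _ _ _ hs F); first exact: C1_setT_continuous.
  exact: C1_setT_continuous.
have cF1h (h : 'rV[R]_n -> R) : C1 setT h -> cube_continuous (fun x => 'D_1 F (h x)).
  move=> ch x _; apply: (@cont_comp _ _ _ _ h (fun r => 'D_1 F r)); first exact: C1_setT_continuous.
  exact: (cF I).2.
have cPc : cube_continuous P by exact: (continuous_cube (C1_setT_continuous cP)).
have cQc : cube_continuous Q.
  move=> x _; apply: (@cont_comp _ _ _ _ (fun x => (s, x)) (fun p => 'D_dt (fun p => 'D_dt H p) p)).
    by apply: cont_pair; [exact: cont_cst|exact: cont_id].
  exact: (cHt (Os x)).2.
have cBc : cube_continuous B.
  move=> x _; apply: (@cont_comp _ _ _ _ (fun x => (x, hs x)) (fun p => 'D_dy phi p)).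
    by apply: cont_pair; [exact: cont_id|exact: C1_setT_continuous].
  exact: (harmonic_below_cont x chs hb).2.
have cNc : cube_continuous N.
  apply: cube_continuousD; first exact: cube_continuousD.
  by apply: cube_continuousN; exact: cube_continuousM.
pose A1 := torus_int (fun x => 'D_1 F (hs x) * ((B x + P x) * P x)).
pose A2 := torus_int (fun x => 'D_1 F (hs x) * (B x + P x)).
have cA1 : cube_continuous (fun x => 'D_1 F (hs x) * ((B x + P x) * P x)).
  apply: cube_continuousM; first exact: cF1h.
  by apply: cube_continuousM => //; exact: cube_continuousD.
have cA2 : cube_continuous (fun x => 'D_1 F (hs x) * (B x + P x)).
  by apply: cube_continuousM; [exact: cF1h|exact: cube_continuousD].
(* The boundary identity for the product of [grad h] and [grad_x phi] makes the transport rate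
   affine in [c]. *)
have LE c : transport_limit H s c F phi = A1 - c * A2.
  rewrite /A2 -torus_intZ// -torus_intB//; last first.
    by apply: cube_continuousM => //; exact: cube_continuous_cst.
  congr torus_int; apply/funext => x.
  have -> : \sum_i 'D_1 F (H (s, x)) * 'D_(0, e_ i) H (s, x) * 'D_(dx i) phi (x, H (s, x)) =
      'D_1 F (hs x) * (B x + P x).
    by rewrite -SE mulr_sumr; apply: eq_bigr => i _; rewrite Dhs mulrA.
  by rewrite -/(P x); ring.
have c5 : cube_continuous (fun x => F (hs x) * Q x) by exact: cube_continuousM.
have key eta : 0 < eta -> - torus_int (fun x => F (hs x) * Q x) +
    torus_int (fun x => (N x + eta) * 'D_1 F (hs x) * P x) <= A1 - A2 + 3 * eta.
  move=> eta0.
  (* As [N >= 0], the boundary values of the comparison function exceed [- eta d] for small [d];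
     [comparison] is thus applied with [eps = eta * d]. *)
  have pbq : \forall d \near (0 : R)^'+, forall x, cube x -> - bq d x < eta.
    apply: (@near_cube_lt R n _ _ _ (fun d x => - bq d x) (fun x => - N x)) => [x _|x _].
      exact: (@cvgN _ _ _ _ _ (fun p : R * 'rV[R]_n => bq p.1 p.2) _ (bqL x)).
    by have := N0 x; lra.
  have slice d : (forall x, O (s + d, x)) -> (forall x, q K d x < 0) -> (forall x, q K2 d x < 0) ->
      [/\ C1 setT (fun x => H (s + d, x)), cube_continuous (fun x => 'D_dt H (s + d, x)),
        cube_continuous (fun x => F (H (s + d, x))) & 0 < d -> cube_continuous (bq d)].
    move=> Od qd qd2; have [chd _] := C1_slice oO cH Od; have [cWd _] := C1_slice oO cHt Od.
    split=> [|||d0]; [exact: chd|exact: (continuous_cube (C1_setT_continuous cWd))| |].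
      by have [cFh _] := C1_comp openT cF chd; exact: (continuous_cube (C1_setT_continuous cFh)).
    have cq c : C1 setT (q c d).
      have c1 : C1 setT (fun x => d^-1 * (H (s + d, x) - hs x)).
        by apply: (C1Z _ openT); exact: (C1B openT chd chs).
      exact: (C1B openT c1 (@C1_cst R _ setT c)).
    have cg c : (forall x, q c d x < 0) -> cube_continuous (fun x => d^-1 * (phi (x, hs x + d * q c d x) - phi (x, hs x))).
      by move=> qc; exact: (cube_continuous_graph_quotient chs (cq c) hb d0 qc).
    apply: cube_continuousD; last exact: cg.
    apply: cube_continuousD; last by apply: cube_continuousM; [exact: cube_continuous_cst|exact: cg].
    apply: cube_continuousM; first exact: cube_continuous_cst.
    by apply: (continuous_cube (C1_setT_continuous _)); exact: (C1B openT chd chs).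
  have near_slice : \forall d \near (0 : R)^'+, [/\ C1 setT (fun x => H (s + d, x)),
      cube_continuous (fun x => 'D_dt H (s + d, x)),
      cube_continuous (fun x => F (H (s + d, x))) & cube_continuous (bq d)].
    near=> d.
    have [Od _] : (forall x, O (s + d, x)) /\ Defs.periodic (fun x => H (s + d, x)) by near: d; exact: nearO.
    have qd : forall x, q K d x < 0 by near: d; exact: nearqK.
    have qd2 : forall x, q K2 d x < 0 by near: d; exact: nearqK2.
    have d0 : 0 < d by near: d; exact: nbhs_right_gt.
    by have [? ? ? /(_ d0)] := slice d Od qd qd2.
  have FHL x0 (f : R -> R) : {for H (s, x0), continuous f} ->
      (fun p : R * 'rV[R]_n => f (H (s + p.1, p.2))) @ G x0 --> f (H (s, x0)).
    move=> cf; apply: (@cvg_comp_at _ _ _ _ (fun p : R * 'rV[R]_n => H (s + p.1, p.2)) f) => //.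
    by apply: (@cvg_time R n s x0 H); exact: C1_cont cH (Os x0).
  have WL x0 : (fun p : R * 'rV[R]_n => 'D_dt H (s + p.1, p.2)) @ G x0 --> P x0.
    by apply: (@cvg_time R n s x0 (fun p => 'D_dt H p)); exact: (cH (Os x0)).2.
  pose Z1 d := torus_int (fun x => F (H (s + d, x)) * (d^-1 * ('D_dt H (s + d, x) - P x))).
  pose Z2 d := torus_int (fun x => (bq d x + eta) * 'D_1 F (H (s + d, x)) * 'D_dt H (s + d, x)).
  have Z1L : Z1 d @[d --> (0 : R)^'+] --> torus_int (fun x => F (hs x) * Q x).
    apply: (@torus_int_cvg R n _ _ (fun d x => F (H (s + d, x)) * (d^-1 * ('D_dt H (s + d, x) - P x)))).
    - apply: filterS near_slice => d [_ cW cFh _]; apply: cube_continuousM => //.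
      apply: cube_continuousM; first exact: cube_continuous_cst.
      by apply: cube_continuousD => //; exact: cube_continuousN.
    - exact: c5.
    - move=> x0 _.
      apply: (@cvgM _ _ _ _ (fun p : R * 'rV[R]_n => F (H (s + p.1, p.2)))
        (fun p => p.1^-1 * ('D_dt H (s + p.1, p.2) - 'D_dt H (s, p.2)))).
        by apply: FHL; exact: (C1_cont cF).
      exact: (cvg_time_quotient oO Os cHt).
  have Z2L : Z2 d @[d --> (0 : R)^'+] --> torus_int (fun x => (N x + eta) * 'D_1 F (hs x) * P x).
    apply: (@torus_int_cvg R n _ _ (fun d x => (bq d x + eta) * 'D_1 F (H (s + d, x)) * 'D_dt H (s + d, x))).
    - apply: filterS near_slice => d [ch cW _ cb]; apply: cube_continuousM => //.
      apply: cube_continuousM; last exact: cF1h.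
      by apply: cube_continuousD => //; exact: cube_continuous_cst.
    - apply: cube_continuousM => //; apply: cube_continuousM; last exact: cF1h.
      by apply: cube_continuousD => //; exact: cube_continuous_cst.
    - move=> x0 _.
      apply: (@cvgM _ _ _ _ (fun p : R * 'rV[R]_n => (bq p.1 p.2 + eta) * 'D_1 F (H (s + p.1, p.2)))
        (fun p => 'D_dt H (s + p.1, p.2))); last exact: WL.
      apply: (@cvgM _ _ _ _ (fun p : R * 'rV[R]_n => bq p.1 p.2 + eta)
        (fun p => 'D_1 F (H (s + p.1, p.2)))).
        by apply: (@cvgD _ _ _ _ _ (fun p : R * 'rV[R]_n => bq p.1 p.2) (fun=> eta)); [exact: bqL|exact: cvg_cst].
      by apply: (FHL x0 (fun r => 'D_1 F r)); exact: (cF I).2.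
  have ZL : (fun d => - Z1 d + Z2 d) @ (0 : R)^'+ --> - torus_int (fun x => F (hs x) * Q x) +
      torus_int (fun x => (N x + eta) * 'D_1 F (hs x) * P x).
    by apply: (@cvgD _ _ _ _ _ (fun d => - Z1 d) Z2) => //; exact: (@cvgN _ _ _ _ _ Z1).
  apply: (cvg_le_cst ZL).
  have nearT1 := flux_transport oO Os cH cF ps hb nearO nearqK eta0.
  have nearT2 := flux_transport oO Os cH cF ps hb nearO nearqK2 eta0.
  near=> d.
  have [Od pd] : (forall x, O (s + d, x)) /\ Defs.periodic (fun x => H (s + d, x)) by near: d; exact: nearO.
  have [d0 dI] : 0 < d /\ 0 <= s + d <= T by near: d; exact: nearI.
  have qd : forall x, q K d x < 0 by near: d; exact: nearqK.
  have qd2 : forall x, q K2 d x < 0 by near: d; exact: nearqK2.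
  have bd0 : forall x, cube x -> - bq d x < eta by near: d; exact: pbq.
  have T1 : `|torus_int (fun x => F (H (s + d, x)) * DtN (level (fun x => H (s + d, x)) (- (d * K))) phi x) -
      torus_int (fun x => F (H (s + d, x)) * DtN hs phi x) - d * transport_limit H s K F phi| <= eta * d.
    by near: d; exact: nearT1.
  have T2 : `|torus_int (fun x => F (H (s + d, x)) * DtN (level (fun x => H (s + d, x)) (- (d * K2))) phi x) -
      torus_int (fun x => F (H (s + d, x)) * DtN hs phi x) - d * transport_limit H s K2 F phi| <= eta * d.
    by near: d; exact: nearT2.
  have [chd cW cFh cb] : [/\ C1 setT (fun x => H (s + d, x)), cube_continuous (fun x => 'D_dt H (s + d, x)),
      cube_continuous (fun x => F (H (s + d, x))) & cube_continuous (bq d)].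
    by near: d; exact: near_slice.
  have [phi' [hphi' uphi']] := sol dI.
  have uE' x : DtN (fun x => H (s + d, x)) phi' x = - 'D_dt H (s + d, x).
    by have := uphi' x; rewrite addrC => /eqP; rewrite addr_eq0 => /eqP.
  have dn0 : d != 0 by rewrite gt_eqF.
  have EK x : H (s + d, x) - d * K = hs x + d * q K d x by rewrite /q /hs; field.
  have EK2 x : H (s + d, x) - d * K - d * (K - 1) = hs x + d * q K2 d x by rewrite /q /hs /K2; field.
  have bE x : H (s + d, x) - 2 * phi (x, H (s + d, x) - d * K) +
      phi (x, H (s + d, x) - d * K - d * (K - 1)) = d * bq d x.
    by rewrite EK2 EK /bq phih /hs; set u1 := phi _; set u2 := phi _; field.
  have LEV : - (d * K) - d * (K - 1) = - (d * K2) by rewrite /K2; ring.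
  have hle z : H (s + d, z) - d * K <= hs z by rewrite EK gerDl pmulr_rle0// ltW.
  have ble z : cube z -> - (eta * d) <= H (s + d, z) - 2 * phi (z, H (s + d, z) - d * K) +
      phi (z, H (s + d, z) - d * K - d * (K - 1)).
    by move=> cz; rewrite bE mulrC -mulrN ler_pM2l// lerNl ltW// bd0.
  have cmp := comparison chs ps hphi chd pd hphi' (mulr_ge0 (ltW d0) K1) hle cF cF1 F2
    (mulr_ge0 (ltW eta0) (ltW d0)) ble.
  rewrite LEV in cmp.
  have cflux c : (forall x, q c d x < 0) ->
      cube_continuous (fun x => F (H (s + d, x)) * DtN (level (fun x => H (s + d, x)) (- (d * c))) phi x).
    move=> qc; have cl : C1 setT (level (fun x => H (s + d, x)) (- (d * c))).
      exact: (C1_graph_family (- (d * c)) chd (@C1_1 R n)).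
    apply: (@cube_continuous_flux R n U (fun p => F (H (s + d, p.1))) phi) => //.
    - move=> p _; apply: (@cont_comp _ _ _ _ (fun p : X => H (s + d, p.1)) F); last by exact: (C1_cont cF).
      exact: (C1_cont (C1_fst chd).1).
    - by move=> p v Up; exact: (cU _ Up).2.
    - move=> x; apply: hU; rewrite /Omega_closure /= levelE.
      rewrite (_ : _ + _ = hs x + d * q c d x); last by rewrite /q /hs; field.
      by rewrite gerDl pmulr_rle0// ltW.
  have cL1 := cflux K qd; have cL2 := cflux K2 qd2.
  rewrite !LE in T1 T2.
  have uhs : DtN hs phi = (fun x => - P x) by apply/funext => x; exact: uE.
  rewrite uhs in T1 T2.
  have uh' : DtN (fun x => H (s + d, x)) phi' = (fun x => - 'D_dt H (s + d, x)) by apply/funext => x; exact: uE'.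
  rewrite uh' in cmp.
  apply: (comparison_arith cFh (cF1h _ chd) cW cPc cL1 cL2 cb d0 T1 T2).
  apply: le_trans cmp _; rewrite le_eqVlt; apply/orP; left; apply/eqP.
  by congr torus_int; apply/funext => x; rewrite bE.
exact: (second_variation_arith cFhs cQc (cF1h _ chs) cBc cPc (fun x => F1 (hs x)) N0 P1 key).
Unshelve. all: by end_near.
Qed.

End SecondVariationInequality.

(** * Evolution of the functionals *)

Section Convex.
Variable R : realType.

Lemma convex_fun_slope (f : R -> R) (x y : R) : convex_fun f -> @C1 R R^o setT f ->
  (y - x) * 'D_1 f x <= f y - f x.
Proof.
move=> cvf cf; have dfx : differentiable (f : R^o -> R^o) x := (cf x I).1.
have DE : 'D_(y - x) (f : R^o -> R) x = (y - x) * 'D_1 f x.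
  by rewrite -(deriveZl _ _ dfx) /= [_ *: 1]mulr1.
rewrite -DE.
have id0 : (fun l : R => l) @ (0 : R)^'+ --> (0 : R) by exact: cvg_within.
have ln0 : \forall l \near (0 : R)^'+, l != 0.
  by near=> l; rewrite gt_eqF//; near: l; exact: nbhs_right_gt.
have L : (fun l : R => l^-1 * (f (x + l *: (y - x)) - f x)) @ (0 : R)^'+ --> 'D_(y - x) (f : R^o -> R) x.
  exact: (@quotient_cvg R R^o setT f (y - x) x R (0 : R)^'+ (fun=> x) (fun l => l) _ openT cf I (cvg_cst x) id0 ln0).

apply: (cvg_le_cst L).
near=> l.
have l0 : 0 < l by near: l; exact: nbhs_right_gt.
have l1 : l < 1 by near: l; exact: nbhs_right_lt.
rewrite ler_pdivrMl//; have := cvf y x l; rewrite ltW//= ltW//= => /(_ isT).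
rewrite (_ : l * y + (1 - l) * x = x + l *: (y - x)); last by rewrite /GRing.scale/=; ring.
by lra.
Unshelve. all: by end_near. Qed.

(** Adding the tangent inequalities at [r] and [r + l] shows that the derivative is
    nondecreasing. *)
Lemma convex_fun_derive2_ge0 (f : R -> R) r : convex_fun f -> @C1 R R^o setT f ->
  @C1 R R^o setT (fun r => 'D_1 f r) -> 0 <= 'D_1 (fun r => 'D_1 f r) r.
Proof.
move=> cvf cf cf1.
have id0 : (fun l : R => l) @ (0 : R)^'+ --> (0 : R) by exact: cvg_within.
have ln0 : \forall l \near (0 : R)^'+, l != 0.
  by near=> l; rewrite gt_eqF//; near: l; exact: nbhs_right_gt.
have L : (fun l : R => l^-1 * ('D_1 f (r + l *: 1) - 'D_1 f r)) @ (0 : R)^'+ --> 'D_1 (fun r => 'D_1 f r) r.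
  exact: (@quotient_cvg R R^o setT (fun r => 'D_1 f r) 1 r R (0 : R)^'+ (fun=> r) (fun l => l) _ openT cf1 I (cvg_cst r) id0 ln0).

rewrite -oppr_le0; apply: (cvg_le_cst (cvgN L)).
near=> l.
have l0 : 0 < l by near: l; exact: nbhs_right_gt.
rewrite /= oppr_le0 mulr_ge0 ?invr_ge0 ?(ltW l0)// subr_ge0.
rewrite (_ : r + l *: 1 = r + l); last by rewrite [_ *: 1]mulr1.
have := convex_fun_slope r (r + l) cvf cf; have := convex_fun_slope (r + l) r cvf cf.
rewrite (_ : r - (r + l) = - l); last by ring.
rewrite (_ : r + l - r = l); last by ring.
rewrite mulNr => A B; rewrite -(ler_pM2l l0).
by move: A B; set u := l * _; set v := l * _; lra.
Unshelve. all: by end_near. Qed.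

End Convex.

(** * Time derivatives of integrals over the torus *)

Section TimeDerivative.
Variables (R : realType) (n : nat) (O : set (R * 'rV[R]_n)).
Hypothesis oO : open O.
Local Notation dt := ((1, 0) : R * 'rV[R]_n).
Implicit Types (k : R * 'rV[R]_n -> R) (t : R).

Lemma near_cube_mem t : (forall x, cube x -> O (t, x)) ->
  \forall s \near t, forall x, cube x -> O (s, x).
Proof.
move=> Ot; apply: (@near_cube R n (fun s x => O (s, x))) => x cx.
have := open_nbhs_nbhs (conj oO (Ot x cx)).
by apply: filterS => -[].
Qed.

Lemma cube_continuous_time k t : (forall p, O p -> {for p, continuous k}) ->
  (forall x, cube x -> O (t, x)) -> cube_continuous (fun x => k (t, x)).
Proof.
move=> ck Ot x cx; apply: (@cont_comp _ _ _ _ (fun x => (t, x)) k); last exact: ck (Ot x cx).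
by apply: cont_pair; [exact: cont_cst|exact: cont_id].
Qed.

Lemma torus_int_time_cvg k t : (forall p, O p -> {for p, continuous k}) ->
  (forall x, cube x -> O (t, x)) ->
  {for t, continuous (fun s => torus_int (fun x => k (s, x)))}.
Proof.
move=> ck Ot; apply: (@torus_int_cvg R n R (nbhs t) (fun s x => k (s, x))).
- apply: filterS (near_cube_mem Ot) => s Os; exact: cube_continuous_time.
- exact: cube_continuous_time.
- move=> x cx; have := ck _ (Ot x cx).
  rewrite (_ : (fun p : R * 'rV[R]_n => k (p.1, p.2)) = k); first by [].
  by apply/funext => -[].
Qed.

Lemma torus_int_time_derive k t : C1 O k -> (forall x, cube x -> O (t, x)) ->
  is_derive t 1 (fun s => torus_int (fun x => k (s, x))) (torus_int (fun x => 'D_dt k (t, x))).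
Proof.
move=> ck Ot.
apply: (@torus_int_is_derive R n (fun s x => k (s, x)) (fun s x => 'D_dt k (s, x))).
- move=> x cx; apply: filterS (open_nbhs_nbhs (conj oO (Ot x cx))) => -[s z] /= Osz.
  have E (r : R) : (0, z) + r *: dt = (r, z).
    by apply/pair_equal_spec; split => /=; rewrite ?scaler0 ?addr0// [_ *: 1]mulr1 add0r.
  have := @is_derive_line R _ k (0, z) dt s; rewrite E => L.
  have {}L := L (C1_derivable ck Osz).
  apply: (near_eq_is_derive _ L).
  by near=> r; rewrite E.
- apply: filterS (near_cube_mem Ot) => s Os; apply: cube_continuous_time => // p Op.
  exact: (C1_cont ck).
- move=> x cx; have := (ck _ (Ot x cx)).2 dt.
  rewrite (_ : (fun p : R * 'rV[R]_n => 'D_dt k (p.1, p.2)) = (fun p => 'D_dt k p)); first by [].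
  by apply/funext => -[].
Unshelve. all: by end_near. Qed.

End TimeDerivative.

Section Evolution.
Variables (R : realType) (n : nat) (T : R) (h : R -> 'rV[R]_n -> R).
Local Notation dt := ((1, 0) : R * 'rV[R]_n).
Local Notation H := (fun p : R * 'rV[R]_n => h p.1 p.2).
Implicit Types (Phi : R -> R) (t : R).

Lemma Ck_on_C1_real k Phi : @Ck_on R R^o k.+1 setT Phi -> @C1 R R^o setT Phi.
Proof.
move=> cPhi; apply: (Ck_on1_C1 (finite_coords_R R) openT).
exact: (@Ck_on_le R R^o 1 k.+1).
Qed.

Section Domain.
Variable O : set (R * 'rV[R]_n).
Hypotheses (oO : open O) (cH : C1 O H).

Lemma C1_integrand Phi : @C1 R R^o setT Phi ->
  C1 O (fun p => Phi (h p.1 p.2)) /\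
  forall p v, O p -> 'D_v (fun p : R * 'rV[R]_n => Phi (h p.1 p.2)) p = 'D_1 Phi (h p.1 p.2) * 'D_v H p.
Proof. by move=> cPhi; exact: (C1_comp oO cPhi cH). Qed.

Lemma I_Phi_is_derive Phi t : @C1 R R^o setT Phi -> (forall x, cube x -> O (t, x)) ->
  is_derive t 1 (I_Phi Phi h) (torus_int (fun x => 'D_1 Phi (h t x) * 'D_dt H (t, x))).
Proof.
move=> cPhi Ot; have [cPH DPH] := C1_integrand cPhi.
apply: (is_derive_eq (torus_int_time_derive oO cPH Ot)).
by apply: eq_torus_int => x cx; rewrite DPH//; exact: Ot.
Qed.

Hypothesis (cHt : C1 O (fun p => 'D_dt H p)).

Definition velocity_integrand Phi (p : R * 'rV[R]_n) : R := 'D_1 Phi (h p.1 p.2) * 'D_dt H p.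

Lemma C1_velocity_integrand Phi : @C1 R R^o setT (fun r => 'D_1 Phi r) ->
  C1 O (velocity_integrand Phi) /\
  forall p, O p -> 'D_dt (velocity_integrand Phi) p =
    'D_1 Phi (h p.1 p.2) * 'D_dt (fun p => 'D_dt H p) p +
    'D_1 (fun r => 'D_1 Phi r) (h p.1 p.2) * 'D_dt H p ^+ 2.
Proof.
move=> cPhi1; have [cPH DPH] := C1_integrand cPhi1.
split=> [|p Op]; first exact: (C1M oO cPH cHt).
have -> : 'D_dt (velocity_integrand Phi) p = 'D_1 Phi (h p.1 p.2) * 'D_dt (fun p => 'D_dt H p) p +
    'D_dt H p * 'D_dt (fun p : R * 'rV[R]_n => 'D_1 Phi (h p.1 p.2)) p.
  exact: (derive_mul dt cPH cHt Op).
by apply: f_equal2 => //; rewrite (DPH p dt Op) mulrCA expr2.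
Qed.

(** The formula for the first derivative must hold at all times near [t], even outside [[0, T]] when
    [t] is an end point. The open set [O] contains the slices of the compact cube at these times. *)
Lemma derive_I_Phi_is_derive Phi t : @C1 R R^o setT Phi -> @C1 R R^o setT (fun r => 'D_1 Phi r) ->
  (forall x, cube x -> O (t, x)) ->
  is_derive t 1 (fun s => derive (I_Phi Phi h) s 1)
    (torus_int (fun x => 'D_dt (velocity_integrand Phi) (t, x))).
Proof.
move=> cPhi cPhi1 Ot; have [cv _] := C1_velocity_integrand cPhi1.
apply: (near_eq_is_derive _ (torus_int_time_derive oO cv Ot)).
apply: filterS (near_cube_mem oO Ot) => s Os.
have d := I_Phi_is_derive cPhi Os.
by rewrite (@derive_val _ _ _ _ _ _ _ d).
Qed.

End Domain.

Lemma smooth_solution_domain : hele_shaw_smooth_solution T h ->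
  exists O : set (R * 'rV[R]_n), [/\ open O, forall t x, 0 <= t <= T -> O (t, x), C1 O H,
    C1 O (fun p => 'D_dt H p) &
    forall t, 0 <= t <= T -> exists phi, harmonic_ext (h t) (h t) phi /\
      forall x, 'D_dt H (t, x) + DtN (h t) phi x = 0].
Proof.
move=> [[U [oO OT sO]] _ sol]; exists U; split=> //.
- by move=> t x tT; exact: OT.
- exact: (Ck_on1_C1 (finite_coords_prod (finite_coords_R R) (finite_coords_rV R n)) oO (sO 1%N)).
- apply: (Ck_on1_C1 (finite_coords_prod (finite_coords_R R) (finite_coords_rV R n)) oO).
  by apply: Ck_on_derive; exact: sO.
- move=> t tT; have [phi [hphi uphi]] := sol t tT; exists phi; split=> // x.
  rewrite -(uphi x); apply: f_equal2 => //.
  apply: eq_derive_reparam => r /=; apply: f_equal2; first by [].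
  by rewrite scaler0 add0r.
Qed.

Lemma derive_I_Phi_le0 Phi t : hele_shaw_smooth_solution T h -> convex_fun Phi ->
  @C1 R R^o setT Phi -> @C1 R R^o setT (fun r => 'D_1 Phi r) -> 0 <= t <= T ->
  derivable (I_Phi Phi h) t 1 /\ derive (I_Phi Phi h) t 1 <= 0.
Proof.
move=> hs cvPhi cPhi cPhi1 tT; have [U [oO OT cH cHt sol]] := smooth_solution_domain hs.
have [_ ph _] := hs.
have d := I_Phi_is_derive oO cH cPhi (fun x _ => OT t x tT).
split; first by [].
rewrite (@derive_val _ _ _ _ _ _ _ d).
have [phi [hphi uphi]] := sol t tT.
have [ch _] := C1_slice oO cH (fun x => OT t x tT).
have F1 r : 0 <= 'D_1 (fun r => 'D_1 Phi r) r := convex_fun_derive2_ge0 r cvPhi cPhi cPhi1.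
have := dissipation cPhi1 F1 ch (ph t tT) hphi.
have ct : cube_continuous (fun x => 'D_1 Phi (h t x) * 'D_dt H (t, x)).
  have [cv _] := C1_velocity_integrand oO cH cHt cPhi1.
  apply: (@cube_continuous_time R n U (velocity_integrand Phi)) => [p Op|x _]; last exact: OT.
  exact: (C1_cont cv).
rewrite -oppr_ge0 -torus_intN//.
rewrite (_ : (fun x => 'D_1 Phi (h t x) * DtN _ phi x) = (fun x => - ('D_1 Phi (h t x) * 'D_dt H (t, x)))) //.
apply/funext => x; rewrite -mulrN; apply: f_equal2 => //.
by have := uphi x; rewrite addrC => /eqP; rewrite addr_eq0 => /eqP.
Qed.

Lemma derive2_I_Phi_ge0 Phi t : 0 < T -> hele_shaw_smooth_solution T h -> convex_fun Phi ->
  convex_fun (fun r => 'D_1 Phi r) -> @C1 R R^o setT Phi ->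
  @C1 R R^o setT (fun r => 'D_1 Phi r) ->
  @C1 R R^o setT (fun r => 'D_1 (fun r => 'D_1 Phi r) r) -> 0 <= t <= T ->
  derivable (fun s => derive (I_Phi Phi h) s 1) t 1 /\
  0 <= derive (fun s => derive (I_Phi Phi h) s 1) t 1.
Proof.
move=> T0 hs cvPhi cvPhi1 cPhi cPhi1 cPhi2 tT.
have [U [oO OT cH cHt sol]] := smooth_solution_domain hs.
have [_ ph _] := hs.
have d := derive_I_Phi_is_derive oO cH cHt cPhi cPhi1 (fun x _ => OT t x tT).
split; first by [].
rewrite (@derive_val _ _ _ _ _ _ _ d).
have [cv Dv] := C1_velocity_integrand oO cH cHt cPhi1.
have F1 r : 0 <= 'D_1 (fun r => 'D_1 Phi r) r := convex_fun_derive2_ge0 r cvPhi cPhi cPhi1.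
have F2 r : 0 <= 'D_1 (fun r => 'D_1 (fun r => 'D_1 Phi r) r) r := convex_fun_derive2_ge0 r cvPhi1 cPhi1 cPhi2.
pose J s := torus_int (fun x => 'D_dt (velocity_integrand Phi) (s, x)).
have J0 s : 0 <= s -> s < T -> 0 <= J s.
  move=> s0 sT; have sI : 0 <= s <= T by rewrite s0 ltW.
  have := second_variation_ge0 oO OT cH cHt ph sol cPhi1 cPhi2 F1 F2 s0 sT.
  rewrite /J (_ : (fun x => 'D_dt (velocity_integrand Phi) (s, x)) = (fun x =>
    'D_1 Phi (h s x) * 'D_dt (fun p => 'D_dt H p) (s, x) +
    'D_1 (fun r => 'D_1 Phi r) (h s x) * 'D_dt H (s, x) ^+ 2)) //.
  by apply/funext => x; rewrite Dv//; exact: OT.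
(* No later time is available at [t = T]; there the sign is obtained as a limit from the left, by
   continuity of [J]. *)
rewrite -/(J t); move: tT => /andP[t0]; rewrite le_eqVlt => /predU1P[tT|]; last exact: J0.
rewrite {}tT {t t0 d}.
have TI : 0 <= T <= T by rewrite lexx ltW.
have cJ : J @ T^'- --> J T.
  apply: cvg_trans; last exact: (@torus_int_time_cvg R n U oO (fun p => 'D_dt (velocity_integrand Phi) p) T
    (fun p Op => (cv p Op).2 dt) (fun x _ => OT T x TI)).
  by apply: cvg_app; exact: cvg_within.
rewrite -oppr_le0; apply: (cvg_le_cst (cvgN cJ)).
near=> s; rewrite /= oppr_le0; apply: J0.
  by apply: ltW; near: s; exact: nbhs_left_gt.
by near: s; exact: nbhs_left_lt.
Unshelve. all: by end_near. Qed.

End Evolution.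

Theorem theorem1p1 (R : realType) (n : nat) (T : R) (h : R -> 'rV[R]_n -> R) :
  (0 < n)%N -> 0 < T ->
  hele_shaw_smooth_solution T h ->
  (* (i) *)
  (forall Phi : R -> R,
     (forall r, 0 <= Phi r) -> convex_fun Phi -> Ck_on 2 setT Phi ->
     forall t, 0 <= t <= T ->
       derivable (I_Phi Phi h) t 1 /\ derive (I_Phi Phi h) t 1 <= 0) /\
  (* (ii) *)
  (forall Phi : R -> R,
     (forall r, 0 <= Phi r) -> convex_fun Phi -> Ck_on 3 setT Phi ->
     convex_fun (fun r => derive Phi r 1) ->
     forall t, 0 <= t <= T ->
       [/\ derivable (I_Phi Phi h) t 1, derive (I_Phi Phi h) t 1 <= 0,
           derivable (fun s => derive (I_Phi Phi h) s 1) t 1 &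
           0 <= derive (fun s => derive (I_Phi Phi h) s 1) t 1]).
Proof.
move=> _ T0 hs; split=> Phi _ cvPhi cPhi.
  move=> t tT; have cPhi1 := @Ck_on_derive R R^o _ _ _ 1 cPhi.
  exact: (derive_I_Phi_le0 hs cvPhi (Ck_on_C1_real cPhi) (Ck_on_C1_real cPhi1) tT).
move=> cvPhi1 t tT; have cPhi1 := @Ck_on_derive R R^o _ _ _ 1 cPhi.
have cPhi2 := @Ck_on_derive R R^o _ _ _ 1 cPhi1.
have C0 := Ck_on_C1_real cPhi; have C1 := Ck_on_C1_real cPhi1; have C2 := Ck_on_C1_real cPhi2.
have [D1 D2] := derive_I_Phi_le0 hs cvPhi C0 C1 tT.
have [D3 D4] := derive2_I_Phi_ge0 T0 hs cvPhi cvPhi1 C0 C1 C2 tT.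
by split.
Qed.
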